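(* We have \[ \mathrm{H}\Gamma^n(\mathrm{A}^{\mathrm{st}}|\mathbb{Z};\mathbb{Z})=\mathrm{H}\Gamma^n(\mathrm{A}|\mathbb{Z};\mathbb{Z})=\begin{cases}\hat{\mathbb{Z}}/\mathbb{Z} & \text{if } n=1,\\ 0 & \text{otherwise.}\end{cases} \] For each prime $p$, \[ \mathrm{H}\Gamma^n(\mathrm{A}^{\mathrm{st}}_{(p)}|\mathbb{Z}_{(p)};\mathbb{Z}_{(p)})=\mathrm{H}\Gamma^n(\mathrm{A}_{(p)}|\mathbb{Z}_{(p)};\mathbb{Z}_{(p)})=\begin{cases}\mathbb{Z}_p/\mathbb{Z}_{(p)} & \text{if } n=1,\\ 0 & \text{otherwise.}\end{cases} \]
   Context: $\mathrm{A}=\{f(w)\in\mathbb{Q}[w]:\forall n\in\mathbb{Z},\ f(n)\in\mathbb{Z}\}$ is the ring of numerical polynomials and $\mathrm{A}^{\mathrm{st}}=\{f(w)\in\mathbb{Q}[w,w^{-1}]:\forall n\in\mathbb{Z}\setminus\{0\},\ f(n)\in\mathbb{Z}[1/n]\}$ the ring of stably numerical polynomials; one has $\mathrm{A}^{\mathrm{st}}=\mathrm{A}[w^{-1}]$. $\mathrm{A}_{(p)}$ and $\mathrm{A}^{\mathrm{st}}_{(p)}$ are their localizations at $p$. $\mathbb{Z}$ (resp. $\mathbb{Z}_{(p)}$) is a module over these rings via the augmentation $f(w)\mapsto f(1)$. $\mathbb{Z}_p$ is the ring of $p$-adic integers and $\hat{\mathbb{Z}}$ the ring of profinite integers. $\Gamma$-cohomology.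 Let $\Bbbk$ be a commutative ring and $A$ a commutative $\Bbbk$-algebra. Let $\Gamma$ be the category of finite pointed sets $[m]=\{0,1,\dots,m\}$ (base point $0$, $m\ge0$). Let $\mathcal{L}(A|\Bbbk)$ be the functor from $\Gamma$ to $A$-modules with $[m]\mapsto A\otimes_{\Bbbk}A^{\otimes_{\Bbbk}m}$ ($A$ acting on the $0$-th factor), a pointed map $\varphi\colon[m]\to[l]$ sending $a_0\otimes\cdots\otimes a_m$ to $b_0\otimes\cdots\otimes b_l$ with $b_j=\prod_{\varphi(i)=j}a_i$. Let $t$ be the contravariant functor from $\Gamma$ to $\Bbbk$-modules sending $[m]$ to the module of pointed maps $[m]\to\Bbbk$. The Robinson–Whitehouse complex $C^\Gamma(A|\Bbbk)_*$ is a chain complex of $A$-modules naturally chain equivalent to $P_*\otimes_\Gamma\mathcal{L}(A|\Bbbk)$, where $P_*\to t$ is a projective resolution of contravariant functors from $\Gamma$ to $\Bbbk$-modules. For an $A$-module $M$, $\mathrm{H}\Gamma^*(A|\Bbbk;M)$ is the cohomology of the derived $A$-homomorphisms from $C^\Gamma(A|\Bbbk)_*$ to $M$. *)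

(* Defs.v *)
From HB Require Import structures.
From mathcomp Require Import all_boot all_order all_algebra generic_quotient.
From mathcomp Require Import boolp classical_sets functions.
From mathcomp Require Import freeg.

Set Implicit Arguments.
Unset Strict Implicit.
Unset Printing Implicit Defensive.

Import Order.TTheory GRing.Theory Num.Theory.
Local Open Scope ring_scope.

Section Submodule.
Variables (R : nzRingType) (V : lmodType R).

Record submodule := Submodule {
  sm_mem :> V -> Prop;
  sm0 : sm_mem 0;
  smD : forall x y, sm_mem x -> sm_mem y -> sm_mem (x + y);
  smZ : forall a x, sm_mem x -> sm_mem (a *: x) }.

Definition sm_pred (S : submodule) : V -> bool := fun x => `[< S x >].

Lemma sm_predP (S : submodule) x : (x \in sm_pred S) <-> S x.
Proof. by split => [/asboolP|?]; last exact/asboolP. Qed.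

Lemma sm_closed (S : submodule) : submod_closed (sm_pred S).
Proof.
split; first exact/sm_predP/sm0.
by move=> a x y /sm_predP Sx /sm_predP Sy; apply/sm_predP/smD => //; apply: smZ.
Qed.

HB.instance Definition _ (S : submodule) :=
  GRing.isSubmodClosed.Build R V (sm_pred S) (sm_closed S).

Record submod_type (S : submodule) :=
  SubmodElt { submod_val : V; _ : submod_val \in sm_pred S }.
HB.instance Definition _ S := [isSub for @submod_val S].
HB.instance Definition _ S := [Choice of submod_type S by <:].
HB.instance Definition _ S :=
  [SubChoice_isSubLmodule of submod_type S by <:].

Definition sm_zmod (S : submodule) : zmodClosed V :=
  Algebra.ZmodClosed.clone V (sm_pred S) _.

Definition quot_mod (S : submodule) : Type := Quotient.quot (sm_zmod S).
HB.instance Definition _ S := GRing.Zmodule.on (quot_mod S).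

Section QuotScale.
Variable S : submodule.
Local Notation Q := (quot_mod S).
Definition to_quot (x : V) : Q := \pi_(Quotient.quot (sm_zmod S))%qT x.

Lemma to_quot_zmod : zmod_morphism to_quot.
Proof. exact: raddfB. Qed.
HB.instance Definition _ := GRing.isZmodMorphism.Build V Q to_quot to_quot_zmod.

Lemma to_quot_surj (q : Q) : exists x, q = to_quot x.
Proof. by exists (repr q); rewrite /to_quot reprK. Qed.

Lemma to_quotP x y : to_quot x = to_quot y <-> S (x - y).
Proof.
rewrite -sm_predP; split.
  by move=> e; rewrite (Quotient.idealrBE (sm_zmod S)); apply/eqP.
by rewrite (Quotient.idealrBE (sm_zmod S)) => /eqP.
Qed.

Lemma to_quot_eq0 x : to_quot x = 0 <-> S x.
Proof. by rewrite -(raddf0 to_quot) to_quotP subr0. Qed.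

Definition quot_scale (a : R) (q : Q) : Q := to_quot (a *: repr q).

Lemma quot_scaleE a x : quot_scale a (to_quot x) = to_quot (a *: x).
Proof.
apply/to_quotP; rewrite -scalerBr; apply: smZ.
by apply/to_quotP; rewrite /to_quot reprK.
Qed.

Lemma quot_scaleA a b q : quot_scale a (quot_scale b q) = quot_scale (a * b) q.
Proof. by have [x ->] := to_quot_surj q; rewrite !quot_scaleE scalerA. Qed.
Lemma quot_scale1 : left_id 1 quot_scale.
Proof. by move=> q; have [x ->] := to_quot_surj q; rewrite quot_scaleE scale1r. Qed.
Lemma quot_scaleDr : right_distributive quot_scale +%R.
Proof.
move=> a q r; have [x ->] := to_quot_surj q; have [y ->] := to_quot_surj r.
by rewrite -raddfD !quot_scaleE scalerDr raddfD.
Qed.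
Lemma quot_scaleDl q : {morph quot_scale^~ q : a b / a + b}.
Proof.
move=> a b; have [x ->] := to_quot_surj q.
by rewrite !quot_scaleE scalerDl raddfD.
Qed.
HB.instance Definition _ := GRing.Zmodule_isLmodule.Build R Q
  quot_scaleA quot_scale1 quot_scaleDr quot_scaleDl.

Lemma to_quot_scalable : scalable to_quot.
Proof. by move=> a x; rewrite -quot_scaleE. Qed.
HB.instance Definition _ := GRing.isScalable.Build R V Q *:%R to_quot to_quot_scalable.

Lemma to_quotB x y : to_quot (x - y) = to_quot x - to_quot y.
Proof. exact: raddfB. Qed.
Lemma to_quotZ a x : to_quot (a *: x) = a *: to_quot x.
Proof. exact: linearZ. Qed.

End QuotScale.

Section Span.
Variable G : V -> Prop.

Definition in_span x := forall S : submodule, (forall y, G y -> S y) -> S x.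
Fact span0 : in_span 0. Proof. by move=> S _; apply: sm0. Qed.
Fact spanD x y : in_span x -> in_span y -> in_span (x + y).
Proof. by move=> Gx Gy S GS; apply: smD; [apply: Gx|apply: Gy]. Qed.
Fact spanZ a x : in_span x -> in_span (a *: x).
Proof. by move=> Gx S GS; apply: smZ; apply: Gx. Qed.
Definition sm_span : submodule := @Submodule in_span span0 spanD spanZ.

Lemma span_incl x : G x -> sm_span x. Proof. by move=> Gx S; apply. Qed.

End Span.

End Submodule.

Section Kernels.
Variables (R : nzRingType) (U V : lmodType R) (f : {linear U -> V}).

Fact ker0 : f 0 = 0. Proof. exact: raddf0. Qed.
Fact kerD x y : f x = 0 -> f y = 0 -> f (x + y) = 0.
Proof. by move=> fx fy; rewrite raddfD /= fx fy addr0. Qed.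
Fact kerZ a x : f x = 0 -> f (a *: x) = 0.
Proof. by move=> fx; rewrite linearZ /= fx scaler0. Qed.
Definition ker : submodule U :=
  @Submodule R U (fun x => f x = 0) ker0 kerD kerZ.

End Kernels.

(* The module with generators [X] and relations [rel]. *)
Section Presented.
Variables (R : nzRingType) (X : choiceType) (rel : {freeg X / R} -> Prop).

Definition pres : Type := quot_mod (sm_span rel).
HB.instance Definition _ := GRing.Lmodule.on pres.

Definition gen (x : X) : pres := to_quot (sm_span rel) << x >>.

Lemma gen_rel r : rel r -> to_quot (sm_span rel) r = 0.
Proof. by move=> rr; apply/to_quot_eq0/span_incl. Qed.

Section Lift.
Variables (M : lmodType R) (f : X -> M).

Lemma fglift_zmod : zmod_morphism (fglift f : {freeg X / R} -> M).
Proof. exact: lift_is_additive. Qed.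
HB.instance Definition _ := GRing.isZmodMorphism.Build {freeg X / R} M
  (fglift f) fglift_zmod.

Lemma freegUZ (a b : R) (x : X) : a *: << b *g x >> = << (a * b) *g x >>.
Proof. by apply/eqP/freeg_eqP => y; rewrite coeffZ !coeffU mulrA. Qed.

Lemma fglift_scalable : scalable (fglift f : {freeg X / R} -> M).
Proof.
move=> a D; rewrite -[in RHS](freeg_sumE D).
have -> : a *: D = \sum_(x <- dom D) << a * coeff x D *g x >> by [].
rewrite !(raddf_sum (fglift f)) scaler_sumr /=.
by apply: eq_bigr => x _; rewrite !liftU scalerA.
Qed.
HB.instance Definition _ := GRing.isScalable.Build R {freeg X / R} M *:%R
  (fglift f) fglift_scalable.

Hypothesis f_rel : forall r, rel r -> fglift f r = 0.

Lemma fglift_span r : sm_span rel r -> fglift f r = 0.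
Proof. by move/(_ (ker (fglift f))); apply. Qed.

Definition pres_lift (q : pres) : M := fglift f (repr q).

Lemma pres_liftE D : pres_lift (to_quot (sm_span rel) D) = fglift f D.
Proof.
apply/eqP; rewrite -subr_eq0 -raddfB; apply/eqP/fglift_span.
by apply/to_quotP; rewrite /to_quot reprK.
Qed.

Lemma pres_lift_gen x : pres_lift (gen x) = f x.
Proof. by rewrite pres_liftE liftU scale1r. Qed.

Lemma pres_lift_zmod : zmod_morphism pres_lift.
Proof.
move=> q r; have [x ->] := to_quot_surj q; have [y ->] := to_quot_surj r.
by rewrite -raddfB !pres_liftE raddfB.
Qed.

Lemma pres_lift_scalable : scalable pres_lift.
Proof.
move=> a q; have [x ->] := to_quot_surj q.
by rewrite -linearZ !pres_liftE linearZ.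
Qed.

Definition pres_hom : {linear pres -> M} :=
  HB.pack_for {linear pres -> M} pres_lift
    (GRing.isZmodMorphism.Build pres M pres_lift pres_lift_zmod)
    (GRing.isScalable.Build R pres M *:%R pres_lift pres_lift_scalable).

Lemma pres_hom_gen x : pres_hom (gen x) = f x.
Proof. exact: pres_lift_gen. Qed.

End Lift.

Lemma pres_hom_ext (M : lmodType R) (g h : {linear pres -> M}) :
  (forall x, g (gen x) = h (gen x)) -> g =1 h.
Proof.
move=> gh q; have [D ->] := to_quot_surj q.
rewrite -[D]freeg_sumE raddf_sum !raddf_sum; apply: eq_bigr => x _ /=.
rewrite -[coeff x D]mulr1 -freegUZ !linearZ /=.
by congr (_ *: _); apply: gh.
Qed.

End Presented.
Arguments gen {R X} rel x.
Arguments pres_hom {R X rel M} f f_rel.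

Section Gamma.

(* The pointed set {0, ..., m} is 'I_m.+1, with base point ord0. *)
Record pmap (m l : nat) := PMap {
  pfun :> 'I_m.+1 -> 'I_l.+1;
  pfun0 : pfun ord0 = ord0 }.

Definition pid m : pmap m m := @PMap m m id erefl.

Fact pcomp_subproof m l j (g : pmap l j) (f : pmap m l) : g (f ord0) = ord0.
Proof. by rewrite !pfun0. Qed.
Definition pcomp m l j (g : pmap l j) (f : pmap m l) : pmap m j :=
  @PMap m j (g \o f) (pcomp_subproof g f).

Lemma pmap_eq m l (f g : pmap m l) : f =1 g -> f = g.
Proof.
case: f g => [f f0] [g g0] /= /funext fg.
by case: _ / fg g0 => g0; congr PMap; apply: Prop_irrelevance.
Qed.

(* Covariant functors from Gamma to R-modules. *)
Record lgmod (R : nzRingType) := LGMod {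
  lg_ob :> nat -> lmodType R;
  lg_map : forall m l, pmap m l -> {linear lg_ob m -> lg_ob l};
  lg_id : forall m, lg_map (pid m) =1 id;
  lg_comp : forall m l j (g : pmap l j) (f : pmap m l),
    lg_map (pcomp g f) =1 lg_map g \o lg_map f }.

(* Contravariant functors from Gamma to R-modules, and their natural
   transformations. *)
Record rgmod (R : nzRingType) := RGMod {
  rg_ob :> nat -> lmodType R;
  rg_map : forall m l, pmap m l -> {linear rg_ob l -> rg_ob m};
  rg_id : forall m, rg_map (pid m) =1 id;
  rg_comp : forall m l j (g : pmap l j) (f : pmap m l),
    rg_map (pcomp g f) =1 rg_map f \o rg_map g }.

Record rgnat (R : nzRingType) (P P' : rgmod R) := RGNat {
  rgn :> forall m, {linear P m -> P' m};
  rgn_nat : forall m l (f : pmap m l) x,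
    rgn m (rg_map P f x) = rg_map P' f (rgn l x) }.

Definition surj_fun (X Y : Type) (f : X -> Y) := forall y, exists x, f x = y.

(* Epimorphisms of functors are the pointwise surjections. *)
Definition rg_projective (R : nzRingType) (P : rgmod R) : Prop :=
  forall (N N' : rgmod R) (g : rgnat N N') (f : rgnat P N'),
    (forall m, surj_fun (g m)) ->
    exists h : rgnat P N, forall m, g m \o h m =1 f m.

End Gamma.

Section T.
Variables (k : nzRingType) (m : nat).
Local Notation F := {ffun 'I_m.+1 -> k^o}.

Fact pointed0 : (0 : F) ord0 = 0. Proof. by rewrite ffunE. Qed.
Fact pointedD (x y : F) : x ord0 = 0 -> y ord0 = 0 -> (x + y) ord0 = 0.
Proof. by move=> x0 y0; rewrite ffunE x0 y0 addr0. Qed.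
Fact pointedZ a (x : F) : x ord0 = 0 -> (a *: x) ord0 = 0.
Proof. by move=> x0; rewrite ffunE x0 scaler0. Qed.
Definition pointed : submodule F :=
  @Submodule k F (fun x => x ord0 = 0) pointed0 pointedD pointedZ.
Definition t_ob : lmodType k := submod_type pointed.
End T.

Section Tmap.
Variables (k : nzRingType) (m l : nat) (f : pmap m l).

Fact t_map_subproof (x : t_ob k l) :
  [ffun i => val x (f i)] \in sm_pred (pointed k m).
Proof.
by apply/sm_predP; rewrite /= ffunE pfun0; apply/(sm_predP (pointed k l))/(valP x).
Qed.
Definition t_fun (x : t_ob k l) : t_ob k m := SubmodElt (t_map_subproof x).

Lemma t_fun_linear : linear t_fun.
Proof.
move=> a x y; apply/val_inj; rewrite [RHS]linearP; apply/ffunP => i.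
by rewrite /= !ffunE.
Qed.
HB.instance Definition _ :=
  GRing.isLinear.Build k (t_ob k l) (t_ob k m) *:%R t_fun t_fun_linear.
End Tmap.

Section Tfunctor.
Variable k : nzRingType.
Fact t_id m : t_fun (pid m) =1 @id (t_ob k m).
Proof. by move=> x; apply/val_inj/ffunP => i; rewrite /= ffunE. Qed.
Fact t_comp m l j (g : pmap l j) (f : pmap m l) :
  t_fun (pcomp g f) =1 t_fun f \o @t_fun k _ _ g.
Proof. by move=> x; apply/val_inj/ffunP => i; rewrite /= !ffunE. Qed.
Definition t_mod : rgmod k :=
  @RGMod k (t_ob k) (fun m l f => t_fun f) t_id t_comp.
End Tfunctor.

Section Tensor.
Variables (k : comNzRingType) (A : comAlgType k).

Definition upd n (a : {ffun 'I_n -> A}) i (x : A) : {ffun 'I_n -> A} :=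
  [ffun j => if j == i then x else a j].

(* Relations that present A (x)_k A (x)_k ... (x)_k A, with factors 0, ..., m, as
   an A-module through its factor 0; the generator << a >> is the tensor
   a 0 (x) ... (x) a m. *)
Inductive tens_rel m : {freeg {ffun 'I_m.+1 -> A} / A} -> Prop :=
| TensAdd a i x y :
    tens_rel (<< upd a i (x + y) >> - << upd a i x >> - << upd a i y >>)
| TensScale a i (c : k) x :
    tens_rel (<< upd a i (c *: x) >> - c%:A *: << upd a i x >>)
| TensMod a (b : A) x :
    tens_rel (<< upd a ord0 (b * x) >> - b *: << upd a ord0 x >>).

Definition loday_ob m : lmodType A := pres (@tens_rel m).

Section Map.
Variables (m l : nat) (f : pmap m l).

Definition push (a : {ffun 'I_m.+1 -> A}) : {ffun 'I_l.+1 -> A} :=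
  [ffun j => \prod_(i | f i == j) a i].

Lemma push_upd a i x :
  push (upd a i x) = upd (push a) (f i) (x * \prod_(j | (f j == f i) && (j != i)) a j).
Proof.
apply/ffunP => j; rewrite !ffunE; case: eqVneq => [->|ji].
  rewrite (bigD1 i) //= ffunE eqxx; congr (_ * _).
  by apply: eq_bigr => h /andP[_ /negPf hi]; rewrite ffunE hi.
apply: eq_bigr => h /eqP fh; rewrite ffunE; case: eqVneq => // hi.
by rewrite -fh hi eqxx in ji.
Qed.

Definition push_gen a : loday_ob l := gen (@tens_rel l) (push a).

Lemma push_rel r : tens_rel r -> fglift push_gen r = 0.
Proof.
case=> [a i x y|a i c x|a b x]; rewrite !raddfB /= ?fglift_scalable !liftU !scale1r.
- rewrite /push_gen !push_upd mulrDl /gen -!to_quotB.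
  exact/gen_rel/TensAdd.
- rewrite /push_gen !push_upd -scalerAl /gen -to_quotZ -to_quotB.
  exact/gen_rel/TensScale.
- rewrite /push_gen !push_upd pfun0 -mulrA /gen -to_quotZ -to_quotB.
  exact/gen_rel/TensMod.
Qed.

Definition loday_map : {linear loday_ob m -> loday_ob l} :=
  pres_hom push_gen push_rel.

Lemma loday_mapE a : loday_map (gen (@tens_rel m) a) = gen (@tens_rel l) (push a).
Proof. exact: pres_hom_gen. Qed.
End Map.

Fact loday_id m : loday_map (pid m) =1 id.
Proof.
apply: (@pres_hom_ext _ _ _ _ _ (idfun : {linear _ -> _})) => a; rewrite loday_mapE /=; congr gen.
by apply/ffunP => j; rewrite ffunE big_pred1_eq.
Qed.

Fact loday_comp m l j (g : pmap l j) (f : pmap m l) :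
  loday_map (pcomp g f) =1 loday_map g \o loday_map f.
Proof.
apply: (@pres_hom_ext _ _ _ _ _ (loday_map g \o loday_map f)) => a.
transitivity (loday_map g (loday_map f (gen (@tens_rel m) a))) => //.
rewrite !loday_mapE; congr gen; apply/ffunP => h; rewrite !ffunE /=.
rewrite (partition_big f (fun i => g i == h)) //=.
apply: eq_bigr => i /eqP gi; rewrite ffunE; apply: eq_bigl => x.
by case: (eqVneq (f x) i) => [->|]; rewrite ?gi ?eqxx ?andbF.
Qed.

Definition loday : lgmod A :=
  @LGMod A loday_ob loday_map loday_id loday_comp.

Section Coend.
Variables (P : rgmod k) (L : lgmod A).

(* P (x)_Gamma L is the quotient of the direct sum over m of P m (x)_k L m by
   P(f) x (x) y = x (x) L(f) y; A acts through L. *)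
Definition coend_gen : choiceType := {m : nat & (P m * L m)%type}.
Definition pure m (x : P m) (y : L m) : {freeg coend_gen / A} :=
  << (Tagged (fun m => (P m * L m)%type) (x, y) : coend_gen) >>.

Inductive coend_rel : {freeg coend_gen / A} -> Prop :=
| CoendAddl m (x x' : P m) (y : L m) :
    coend_rel (pure (x + x') y - pure x y - pure x' y)
| CoendAddr m (x : P m) (y y' : L m) :
    coend_rel (pure x (y + y') - pure x y - pure x y')
| CoendScalel m (c : k) (x : P m) (y : L m) :
    coend_rel (pure (c *: x) y - c%:A *: pure x y)
| CoendScaler m (a : A) (x : P m) (y : L m) :
    coend_rel (pure x (a *: y) - a *: pure x y)
| CoendMap m l (f : pmap m l) (x : P l) (y : L m) :
    coend_rel (pure (rg_map P f x) y - pure x (lg_map L f y)).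

Definition coend : lmodType A := pres coend_rel.

Lemma pure0 m (y : L m) : to_quot (sm_span coend_rel) (pure (0 : P m) y) = 0.
Proof.
have := gen_rel (CoendScalel 0 (0 : P m) y).
by rewrite to_quotB to_quotZ !scale0r subr0.
Qed.
End Coend.

Section CoendMap.
Variables (P P' : rgmod k) (L : lgmod A) (u : rgnat P P').

Definition coend_map_gen (z : coend_gen P L) : coend P' L :=
  to_quot (sm_span (@coend_rel P' L)) (pure (u (tag z) (tagged z).1) (tagged z).2).

Lemma coend_map_rel r : @coend_rel P L r -> fglift coend_map_gen r = 0.
Proof.
case=> [m x x' y|m x y y'|m c x y|m a x y|m l f x y];
  rewrite !raddfB /= ?fglift_scalable !liftU !scale1r /coend_map_gen /=.
- rewrite raddfD -!to_quotB; exact/gen_rel/CoendAddl.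
- rewrite -!to_quotB; exact/gen_rel/CoendAddr.
- rewrite linearZ /= -to_quotZ -to_quotB; exact/gen_rel/CoendScalel.
- rewrite -to_quotZ -to_quotB; exact/gen_rel/CoendScaler.
- rewrite rgn_nat -to_quotB; exact/gen_rel/CoendMap.
Qed.
Definition coend_map : {linear coend P L -> coend P' L} :=
  pres_hom coend_map_gen coend_map_rel.

Lemma coend_mapE m (x : P m) (y : L m) :
  coend_map (to_quot (sm_span (@coend_rel P L)) (pure x y)) =
  to_quot (sm_span (@coend_rel P' L)) (pure (u m x) y).
Proof. exact: pres_hom_gen. Qed.
End CoendMap.

End Tensor.

Section Complexes.
Variable R : nzRingType.

Section SubmoduleOps.
Variables U V : lmodType R.

Section Image.
Variable f : {linear U -> V}.
Definition in_im y := exists x, y = f x.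
Fact im0 : in_im 0. Proof. by exists 0; rewrite raddf0. Qed.
Fact imD x y : in_im x -> in_im y -> in_im (x + y).
Proof. by move=> [a ->] [b ->]; exists (a + b); rewrite raddfD. Qed.
Fact imZ a x : in_im x -> in_im (a *: x).
Proof. by move=> [b ->]; exists (a *: b); rewrite linearZ. Qed.
Definition im : submodule V := @Submodule R V in_im im0 imD imZ.
End Image.

Definition sm_full : submodule U :=
  @Submodule R U (fun=> True) I (fun _ _ _ _ => I) (fun _ _ _ => I).

Definition sm_zero : submodule U := ker (idfun : {linear U -> U}).

Section Relative.
Variables S T : submodule U.
Definition in_rel (x : submod_type S) := T (val x).
Fact rel0 : in_rel 0. Proof. by rewrite /in_rel raddf0; apply: sm0. Qed.
Fact relD x y : in_rel x -> in_rel y -> in_rel (x + y).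
Proof. by rewrite /in_rel raddfD; apply: smD. Qed.
Fact relZ a x : in_rel x -> in_rel (a *: x).
Proof. by rewrite /in_rel linearZ; apply: smZ. Qed.
(* The trace of [T] on [S], as a submodule of [S]. *)
Definition sm_rel : submodule (submod_type S) :=
  @Submodule R (submod_type S) in_rel rel0 relD relZ.
End Relative.

End SubmoduleOps.

(* Complexes are concentrated in degrees >= 0. *)
Record chain_complex := ChainComplex {
  cc_ob :> nat -> lmodType R;
  cc_d : forall n, {linear cc_ob n.+1 -> cc_ob n};
  cc_dd : forall n x, cc_d n (cc_d n.+1 x) = 0 }.

Record cochain_complex := CochainComplex {
  co_ob :> nat -> lmodType R;
  co_d : forall n, {linear co_ob n -> co_ob n.+1};
  co_dd : forall n x, co_d n.+1 (co_d n x) = 0 }.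

Definition cycles (C : chain_complex) n : submodule (C n) :=
  match n with 0 => sm_full (C 0) | n.+1 => ker (cc_d C n) end.

Definition boundaries (C : chain_complex) n : submodule (C n) := im (cc_d C n).

Definition cocycles (K : cochain_complex) n : submodule (K n) := ker (co_d K n).

Definition coboundaries (K : cochain_complex) n : submodule (K n) :=
  match n with 0 => sm_zero (K 0) | n.+1 => im (co_d K n) end.

Definition cohomology (K : cochain_complex) n : lmodType R :=
  quot_mod (sm_rel (cocycles K n) (coboundaries K n)).

Record chain_map (C D : chain_complex) := ChainMap {
  cm_fun :> forall n, {linear C n -> D n};
  cm_comm : forall n x, cm_fun n (cc_d C n x) = cc_d D n (cm_fun n.+1 x) }.

(* [f] induces a surjection and an injection on each homology module. *)
Definition quasi_iso C D (f : chain_map C D) : Prop :=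
  forall n,
    (forall z, cycles D n z ->
       exists2 y, cycles C n y & boundaries D n (z - f n y)) /\
    (forall y, cycles C n y -> boundaries D n (f n y) -> boundaries C n y).

Definition projective (P : lmodType R) : Prop :=
  forall (U V : lmodType R) (g : {linear U -> V}) (f : {linear P -> V}),
    surj_fun g -> exists h : {linear P -> U}, g \o h =1 f.

Record projective_replacement (C : chain_complex) := ProjReplacement {
  pr_cx :> chain_complex;
  pr_proj : forall n, projective (pr_cx n);
  pr_map : chain_map pr_cx C;
  pr_qis : quasi_iso pr_map }.

Record projective_resolution (N : rgmod R) := ProjResolution {
  res_ob :> nat -> rgmod R;
  res_d : forall n, rgnat (res_ob n.+1) (res_ob n);
  res_aug : rgnat (res_ob 0) N;
  res_proj : forall n, rg_projective (res_ob n);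
  res_aug_surj : forall m, surj_fun (res_aug m);
  res_exact0 : forall m x, res_aug m x = 0 <-> exists y, x = res_d 0 m y;
  res_exact : forall n m x,
    res_d n m x = 0 <-> exists y, x = res_d n.+1 m y }.

End Complexes.

Section Hom.
Variable A : comNzRingType.

Section HomModule.
Variables U V : lmodType A.
Definition is_linear (f : U -> V) : Prop := linear f.
Fact lin0 : is_linear 0. Proof. by move=> a x y; rewrite scaler0 addr0. Qed.
Fact linD f g : is_linear f -> is_linear g -> is_linear (f + g).
Proof.
by move=> lf lg a x y; rewrite !fctE lf lg scalerDr addrACA.
Qed.
Fact linZ a f : is_linear f -> is_linear (a *: f).
Proof.
move=> lf b x y; rewrite !fctE lf scalerDr !scalerA.
by rewrite [a * b]mulrC.
Qed.
Definition linear_maps : submodule (U -> V) :=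
  @Submodule A (U -> V) is_linear lin0 linD linZ.
Definition Hom : lmodType A := submod_type linear_maps.

Lemma hom_linear (f : Hom) : linear (val f).
Proof. exact/(sm_predP linear_maps)/(valP f). Qed.
Lemma hom0 (f : Hom) : val f 0 = 0.
Proof.
have := hom_linear f (-1) 0 0.
by rewrite scaler0 add0r scaleN1r addNr.
Qed.
End HomModule.

Section Precomp.
Variables (U V W : lmodType A) (d : {linear U -> V}).
Fact precomp_subproof (f : Hom V W) : val f \o d \in sm_pred (linear_maps U W).
Proof.
apply/sm_predP => a x y; rewrite /= linearP.
exact: hom_linear.
Qed.
Definition precomp (f : Hom V W) : Hom U W := SubmodElt (precomp_subproof f).
Lemma precomp_linear : linear precomp.
Proof.
by move=> a f g; apply/val_inj; rewrite [RHS]linearP.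
Qed.
HB.instance Definition _ :=
  GRing.isLinear.Build A (Hom V W) (Hom U W) *:%R precomp precomp_linear.
End Precomp.

Section HomComplex.
Variables (C : chain_complex A) (M : lmodType A).
Fact hom_dd n (f : Hom (C n) M) :
  precomp (cc_d C n.+1) (precomp (cc_d C n) f) = 0.
Proof.
by apply/val_inj/funext => x; rewrite /= cc_dd hom0.
Qed.
Definition hom_complex : cochain_complex A :=
  @CochainComplex A (fun n => Hom (C n) M) (fun n => precomp (cc_d C n)) hom_dd.
End HomComplex.
End Hom.

Section GammaCohomology.
Variables (k : comNzRingType) (A : comAlgType k).

Section TensorComplex.
Variables (N : rgmod k) (P : projective_resolution N) (L : lgmod A).
Fact coend_dd n x :
  coend_map L (res_d P n) (coend_map L (res_d P n.+1) x) = 0.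
Proof.
pose c0 : {linear coend (P n.+2) L -> coend (P n) L} := \0.
pose c : {linear coend (P n.+2) L -> coend (P n) L} :=
  coend_map L (res_d P n) \o coend_map L (res_d P n.+1).
apply: (@pres_hom_ext _ _ _ _ c c0) x => -[m [x y]].
transitivity (coend_map L (res_d P n) (coend_map L (res_d P n.+1)
  (to_quot (sm_span (@coend_rel _ _ (P n.+2) L)) (pure x y)))) => //.
rewrite !coend_mapE; have /res_exact -> : exists z, res_d P n.+1 m x = res_d P n.+1 m z.
  by exists x.
exact: pure0.
Qed.
Definition coend_complex : chain_complex A :=
  @ChainComplex A (fun n => coend (P n) L) (fun n => coend_map L (res_d P n)) coend_dd.
End TensorComplex.

(* Cohomology of the derived A-homomorphisms from P (x)_Gamma L(A|k) to M, computed
   from a projective resolution [P] of t and a complex [Q] of projective A-modules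
   quasi-isomorphic to P (x)_Gamma L(A|k). *)
Definition HGamma (M : lmodType A) (P : projective_resolution (t_mod k))
    (Q : projective_replacement (coend_complex P (loday A))) n : lmodType A :=
  cohomology (hom_complex Q M) n.

End GammaCohomology.

Section Subring.
Variable E : comNzRingType.

Record subring := Subring {
  sr_mem :> E -> Prop;
  sr1 : sr_mem 1;
  srB : forall x y, sr_mem x -> sr_mem y -> sr_mem (x - y);
  srM : forall x y, sr_mem x -> sr_mem y -> sr_mem (x * y) }.

Definition sr_pred (S : subring) : E -> bool := fun x => `[< S x >].

Lemma sr_predP (S : subring) x : (x \in sr_pred S) <-> S x.
Proof. by split => [/asboolP|?]; last exact/asboolP. Qed.

Fact sr_closed (S : subring) : subring_closed (sr_pred S).
Proof.
split=> [|x y /sr_predP Sx /sr_predP Sy|x y /sr_predP Sx /sr_predP Sy];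
  apply/sr_predP; [exact: sr1|exact: srB|exact: srM].
Qed.
HB.instance Definition _ (S : subring) :=
  GRing.isSubringClosed.Build E (sr_pred S) (sr_closed S).

Record subring_type (S : subring) :=
  SubringElt { subring_val : E; _ : subring_val \in sr_pred S }.
HB.instance Definition _ S := [isSub for @subring_val S].
HB.instance Definition _ S := [Choice of subring_type S by <:].
HB.instance Definition _ S :=
  [SubChoice_isSubComNzRing of subring_type S by <:].

Lemma subringP (S : subring) (x : subring_type S) : S (val x).
Proof. exact/sr_predP/valP. Qed.

Definition to_subring (S : subring) x (Sx : S x) : subring_type S :=
  SubringElt ((sr_predP S x).2 Sx).

Lemma sr_int (S : subring) (n : int) : S n%:~R.
Proof. by apply/sr_predP; rewrite rpred_int. Qed.

Section Localization.
Variables (p : nat) (S : subring).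
Definition in_loc x := exists s : nat,
  [/\ (0 < s)%N, coprime p s & S (s%:R * x)].
Fact loc1 : in_loc 1.
Proof. by exists 1%N; rewrite coprimen1 mulr1; split=> //; apply: sr1. Qed.
Fact locB x y : in_loc x -> in_loc y -> in_loc (x - y).
Proof.
move=> [s [s0 ps Sx]] [u [u0 pu Sy]]; exists (s * u)%N.
split; [by rewrite muln_gt0 s0|by rewrite coprimeMr ps|].
rewrite mulrBr natrM; apply: srB; last by rewrite -mulrA; apply/srM/Sy/(sr_int S s).
by rewrite mulrAC mulrC; apply/srM/Sx/(sr_int S u).
Qed.
Fact locM x y : in_loc x -> in_loc y -> in_loc (x * y).
Proof.
move=> [s [s0 ps Sx]] [u [u0 pu Sy]]; exists (s * u)%N.
split; [by rewrite muln_gt0 s0|by rewrite coprimeMr ps|].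
by rewrite natrM mulrACA; apply: srM.
Qed.
(* For [p] prime and [E] without torsion this is the localization of [S] at
   the prime ideal (p) of the integers. *)
Definition localize : subring := Subring loc1 locB locM.
End Localization.

End Subring.

(* A ring is an algebra over the integers. *)
Section IntAlgebra.
Variable B : comNzRingType.
Definition zalg : Type := B.
HB.instance Definition _ := GRing.ComNzRing.on zalg.
Definition zscale (n : int) (x : zalg) : zalg := x *~ n.
Fact zscaleA a b x : zscale a (zscale b x) = zscale (a * b) x.
Proof. by rewrite /zscale mulrzA_C. Qed.
Fact zscale1 : left_id 1 zscale. Proof. by []. Qed.
Fact zscaleDr : right_distributive zscale +%R.
Proof. by move=> a x y; apply: mulrzDl. Qed.
Fact zscaleDl x : {morph zscale^~ x : a b / a + b}.
Proof. by move=> a b; apply: mulrzDr. Qed.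
HB.instance Definition _ := GRing.Zmodule_isLmodule.Build int zalg
  zscaleA zscale1 zscaleDr zscaleDl.
Fact zscaleAl (a : int) (x y : zalg) : a *: (x * y) = (a *: x) * y.
Proof. by rewrite [LHS]/GRing.scale /= /zscale -mulrzAl. Qed.
HB.instance Definition _ := GRing.Lmodule_isLalgebra.Build int zalg zscaleAl.
HB.instance Definition _ := GRing.Lalgebra_isComAlgebra.Build int zalg.
End IntAlgebra.

Definition int_sub : subring rat.
Proof.
refine (@Subring _ (fun x => x \is a Num.int) _ _ _).
- exact: rpred1.
- by move=> x y; apply: rpredB.
- by move=> x y; apply: rpredM.
Defined.

Definition Zloc p := subring_type (localize p int_sub).
HB.instance Definition _ p := GRing.ComNzRing.on (Zloc p).

(* The localization at [p] of a subring of a rational algebra [E], as an algebra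
   over the localization of the integers. *)
Section LocAlgebra.
Variables (E : comNzRingType).

Definition loc_ring of {rmorphism rat -> E} := fun (p : nat) (S : subring E) =>
  subring_type (localize p S).

Variables (iota : {rmorphism rat -> E}) (p : nat) (S : subring E).
Local Notation loc_alg := (loc_ring iota p S).
HB.instance Definition _ := GRing.ComNzRing.on loc_alg.

Fact loc_scale_subproof (c : Zloc p) (x : loc_alg) :
  localize p S (iota (val c) * val x).
Proof.
have [s [s0 ps cs]] := subringP c; have [u [u0 pu Sx]] := subringP x.
exists (s * u)%N; split; [by rewrite muln_gt0 s0|by rewrite coprimeMr ps|].
rewrite natrM mulrACA; apply: srM => //.
have /intrP[n en] : s%:R * val c \is a Num.int by exact: cs.
by rewrite -(rmorph_nat iota) -rmorphM en rmorph_int; apply: sr_int.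
Qed.
Definition loc_scale (c : Zloc p) (x : loc_alg) : loc_alg :=
  to_subring (loc_scale_subproof c x).
Fact loc_scaleA a b x : loc_scale a (loc_scale b x) = loc_scale (a * b) x.
Proof. by apply/val_inj; rewrite /= rmorphM mulrA. Qed.
Fact loc_scale1 : left_id 1 loc_scale.
Proof. by move=> x; apply/val_inj; rewrite /= rmorph1 mul1r. Qed.
Fact loc_scaleDr : right_distributive loc_scale +%R.
Proof. by move=> a x y; apply/val_inj; rewrite /= mulrDr. Qed.
Fact loc_scaleDl x : {morph loc_scale^~ x : a b / a + b}.
Proof. by move=> a b; apply/val_inj; rewrite /= rmorphD mulrDl. Qed.
HB.instance Definition _ := GRing.Zmodule_isLmodule.Build (Zloc p) loc_alg
  loc_scaleA loc_scale1 loc_scaleDr loc_scaleDl.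
Fact loc_scaleAl (a : Zloc p) (x y : loc_alg) : a *: (x * y) = (a *: x) * y.
Proof. by apply/val_inj; rewrite /= mulrA. Qed.
HB.instance Definition _ := GRing.Lmodule_isLalgebra.Build (Zloc p) loc_alg
  loc_scaleAl.
HB.instance Definition _ := GRing.Lalgebra_isComAlgebra.Build (Zloc p) loc_alg.
End LocAlgebra.

(* The base ring as a module through an augmentation. *)
Section AugmentationModule.
Variables (k A : comNzRingType).
Definition aug_module of {rmorphism A -> k} : Type := k.

Variable aug : {rmorphism A -> k}.
Local Notation aug_mod := (aug_module aug).
HB.instance Definition _ := GRing.Zmodule.on aug_mod.
Definition aug_scale (a : A) (x : aug_mod) : aug_mod := aug a * (x : k).
Fact aug_scaleA a b x : aug_scale a (aug_scale b x) = aug_scale (a * b) x.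
Proof. by rewrite /aug_scale rmorphM mulrA. Qed.
Fact aug_scale1 : left_id 1 aug_scale.
Proof. by move=> x; rewrite /aug_scale rmorph1 mul1r. Qed.
Fact aug_scaleDr : right_distributive aug_scale +%R.
Proof. by move=> a x y; apply: mulrDr. Qed.
Fact aug_scaleDl x : {morph aug_scale^~ x : a b / a + b}.
Proof. by move=> a b; rewrite /aug_scale rmorphD mulrDl. Qed.
HB.instance Definition _ := GRing.Zmodule_isLmodule.Build A aug_mod
  aug_scaleA aug_scale1 aug_scaleDr aug_scaleDl.
End AugmentationModule.

Definition numerical (f : {poly rat}) : Prop :=
  forall n : int, f.[n%:~R] \is a Num.int.

Definition numerical_sub : subring {poly rat}.
Proof.
refine (@Subring _ numerical _ _ _).
- by move=> n; rewrite hornerC rpred1.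
- by move=> f g nf ng n; rewrite hornerD hornerN rpredB.
- by move=> f g nf ng n; rewrite hornerM rpredM.
Defined.

Local Notation ratfun := {fraction {poly rat}}.
Local Notation "P %:F" := (@FracField.tofrac {poly rat} P).

(* Value at [x] of a rational function; 0 if [x] is a pole. *)
Definition is_value (f : ratfun) (x v : rat) : Prop :=
  exists P D : {poly rat}, [/\ D.[x] != 0, f = P%:F / D%:F & v = P.[x] / D.[x]].
Definition feval (f : ratfun) (x : rat) : rat := xget 0 [set v | is_value f x v].

Lemma feval_value f x v : is_value f x v -> feval f x = v.
Proof.
move=> fv; apply: xget_unique => // w {}[P' [D' [D'x ef ->]]].
case: fv ef => [P [D [Dx -> ->]]] e.
have nz (Q : {poly rat}) : Q.[x] != 0 -> Q%:F != 0 :> ratfun.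
  by move=> Qx; rewrite tofrac_eq0; apply: contraNneq Qx => ->; rewrite horner0.
have : P * D' = P' * D.
  apply/eqP; rewrite -tofrac_eq !tofracM; apply/eqP.
  by move/eqP: e; rewrite eqr_div ?nz // => /eqP.
move/(congr1 (horner^~ x)); rewrite !hornerM => e'.
by apply/eqP; rewrite eqr_div // e' eqxx.
Qed.

Definition laurent (f : ratfun) : Prop :=
  exists (P : {poly rat}) m, f = P%:F / ('X^m)%:F.

Lemma laurent_value f x : laurent f -> x != 0 -> is_value f x (feval f x).
Proof.
move=> [P [m ->]] x0.
have v : is_value (P%:F / ('X^m)%:F) x (P.[x] / ('X^m).[x]).
  by exists P, 'X^m; split=> //; rewrite hornerXn expf_neq0.
by rewrite (feval_value v).
Qed.

Lemma Xn_neq0 m : ('X^m)%:F != 0 :> ratfun.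
Proof. by rewrite tofrac_eq0 monic_neq0 // monicXn. Qed.

Lemma laurent1 : laurent 1.
Proof. by exists 1, 0; rewrite expr0 tofrac1 divr1. Qed.

Lemma laurentB f g : laurent f -> laurent g -> laurent (f - g).
Proof.
move=> [P [m ->]] [Q [l ->]]; exists (P * 'X^l - Q * 'X^m), (m + l)%N.
rewrite -mulNr addf_div ?Xn_neq0 // exprD tofracB !tofracM mulNr.
by congr (_ / _).
Qed.

Lemma laurentM f g : laurent f -> laurent g -> laurent (f * g).
Proof.
move=> [P [m ->]] [Q [l ->]]; exists (P * Q), (m + l)%N.
by rewrite mulf_div exprD !tofracM.
Qed.

Section Values.
Variables (x : rat) (x0 : x != 0).

Lemma is_valueB f g v w :
  is_value f x v -> is_value g x w -> is_value (f - g) x (v - w).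
Proof.
move=> [P [D [Dx -> ->]]] [Q [G [Gx -> ->]]].
have nz (H : {poly rat}) : H.[x] != 0 -> H%:F != 0 :> ratfun.
  by move=> Hx; rewrite tofrac_eq0; apply: contraNneq Hx => ->; rewrite horner0.
exists (P * G - Q * D), (D * G); split; first by rewrite hornerM mulf_neq0.
  by rewrite -mulNr addf_div ?nz // tofracB !tofracM mulNr.
by rewrite -mulNr addf_div // hornerD hornerN !hornerM mulNr.
Qed.

Lemma is_valueM f g v w :
  is_value f x v -> is_value g x w -> is_value (f * g) x (v * w).
Proof.
move=> [P [D [Dx -> ->]]] [Q [G [Gx -> ->]]].
exists (P * Q), (D * G); split; first by rewrite hornerM mulf_neq0.
  by rewrite mulf_div !tofracM.
by rewrite mulf_div !hornerM.
Qed.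

Lemma feval1 : feval 1 x = 1.
Proof.
apply: feval_value; exists 1, 1.
by split; rewrite ?hornerC ?oner_eq0 // ?tofrac1 divr1.
Qed.

Lemma fevalB f g : laurent f -> laurent g ->
  feval (f - g) x = feval f x - feval g x.
Proof. by move=> lf lg; apply/feval_value/is_valueB; apply: laurent_value. Qed.

Lemma fevalM f g : laurent f -> laurent g ->
  feval (f * g) x = feval f x * feval g x.
Proof. by move=> lf lg; apply/feval_value/is_valueM; apply: laurent_value. Qed.
End Values.

(* [v] lies in Z[1/n] *)
Definition in_Zinv (n : int) (v : rat) : Prop :=
  exists j, n%:~R ^+ j * v \is a Num.int.

Definition stably_numerical (f : ratfun) : Prop :=
  laurent f /\ forall n : int, n != 0 -> in_Zinv n (feval f n%:~R).

Definition stable_sub : subring ratfun.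
Proof.
refine (@Subring _ stably_numerical _ _ _).
- split; first exact: laurent1.
  by move=> n n0; exists 0; rewrite feval1 mulr1 rpred1.
- move=> f g [lf nf] [lg ng]; split; first exact: laurentB.
  move=> n n0; have [i fi] := nf n n0; have [j gj] := ng n n0.
  exists (i + j)%N; rewrite fevalB ?intr_eq0 // mulrBr exprD.
  rewrite rpredB //; first by rewrite mulrAC rpredM // rpredX ?rpred_int.
  by rewrite -mulrA rpredM // rpredX ?rpred_int.
- move=> f g [lf nf] [lg ng]; split; first exact: laurentM.
  move=> n n0; have [i fi] := nf n n0; have [j gj] := ng n n0.
  exists (i + j)%N; rewrite fevalM ?intr_eq0 // exprD mulrACA.
  by rewrite rpredM.
Defined.

Definition Anum : comAlgType int := zalg (subring_type numerical_sub).
Definition Ast : comAlgType int := zalg (subring_type stable_sub).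

Definition poly_const : {rmorphism rat -> {poly rat}} := polyC.
Definition ratfun_const : {rmorphism rat -> ratfun} :=
  @FracField.tofrac {poly rat} \o polyC.

Definition Anum_loc p : comAlgType (Zloc p) := loc_ring poly_const p numerical_sub.
Definition Ast_loc p : comAlgType (Zloc p) := loc_ring ratfun_const p stable_sub.

(* A map [ev] on [E] that restricts to a ring morphism on [S], with values in [K]. *)
Section Augmentation.
Variables (E F : comNzRingType) (S : subring E) (K : subring F) (ev : E -> F).

Definition morph_on : Prop :=
  [/\ ev 1 = 1, forall x y, S x -> S y -> ev (x - y) = ev x - ev y
    & forall x y, S x -> S y -> ev (x * y) = ev x * ev y].

Hypothesis ev_morph : morph_on.
Hypothesis ev_val : forall x, S x -> K (ev x).

Definition res_ev (x : subring_type S) : subring_type K :=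
  to_subring (ev_val (subringP x)).

Fact res_ev_zmod : zmod_morphism res_ev.
Proof.
by case: ev_morph => _ evB _ x y; apply/val_inj; rewrite /= evB //; apply: subringP.
Qed.
Fact res_ev_monoid : monoid_morphism res_ev.
Proof.
case: ev_morph => ev1 _ evM.
by split=> [|x y]; apply/val_inj; rewrite /= ?evM //; apply: subringP.
Qed.
Definition res_morph : {rmorphism subring_type S -> subring_type K} :=
  HB.pack_for {rmorphism subring_type S -> subring_type K} res_ev
    (GRing.isZmodMorphism.Build _ _ res_ev res_ev_zmod)
    (GRing.isMonoidMorphism.Build _ _ res_ev res_ev_monoid).

Lemma ev_natM (n : nat) x : S x -> ev (n%:R * x) = n%:R * ev x.
Proof.
case: ev_morph => ev1 evB evM Sx.
have S0 : S 0 by exact: (sr_int S 0).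
have ev0 : ev 0 = 0 by rewrite -(subrr 0) evB // subrr.
have evN y : S y -> ev (- y) = - ev y.
  by move=> Sy; rewrite -sub0r evB // ev0 sub0r.
have SN y : S y -> S (- y) by move=> Sy; rewrite -sub0r; apply: srB.
have Sn (m : nat) : S (m%:R * x) by apply/srM/Sx/(sr_int S m).
elim: n => [|n IH]; first by rewrite !mul0r.
rewrite -[n.+1]addn1 !natrD !mulrDl !mul1r -[X in ev (_ + X)]opprK.
by rewrite evB ?evN ?IH ?opprK //; apply: SN.
Qed.
End Augmentation.

Lemma localize_val (E F : comNzRingType) p (S : subring E) (K : subring F)
    (ev : E -> F) :
  morph_on (localize p S) ev -> (forall x, S x -> K (ev x)) ->
  forall x, localize p S x -> localize p K (ev x).
Proof.
move=> evm evK x lx; have [s [s0 ps Sx]] := lx; exists s; split=> //.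
by rewrite -(ev_natM evm) //; apply: evK.
Qed.

(* The integers as the subring [int_sub] of the rationals. *)
Definition int_of_sub (x : subring_type int_sub) : int := numq (val x).
Lemma int_of_subK x : (int_of_sub x)%:~R = val x.
Proof.
by have /intrP[n en] : val x \is a Num.int := subringP x; rewrite /int_of_sub en numq_int.
Qed.
Fact int_of_sub_zmod : zmod_morphism int_of_sub.
Proof.
by move=> x y; apply: (@intr_inj rat); rewrite int_of_subK mulrzBr !int_of_subK.
Qed.
Fact int_of_sub_monoid : monoid_morphism int_of_sub.
Proof.
by split=> [|x y]; apply: (@intr_inj rat); rewrite ?intrM !int_of_subK.
Qed.
HB.instance Definition _ :=
  GRing.isZmodMorphism.Build _ _ int_of_sub int_of_sub_zmod.
HB.instance Definition _ :=
  GRing.isMonoidMorphism.Build _ _ int_of_sub int_of_sub_monoid.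

Definition eval1_poly (f : {poly rat}) : rat := f.[1].
Definition eval1_ratfun (f : ratfun) : rat := feval f 1.

Fact eval1_poly_morph (S : subring {poly rat}) : morph_on S eval1_poly.
Proof.
by split=> [|f g _ _|f g _ _]; rewrite /eval1_poly ?hornerC ?hornerD ?hornerN ?hornerM.
Qed.

Fact eval1_ratfun_morph (S : subring ratfun) :
  (forall f, S f -> laurent f) -> morph_on S eval1_ratfun.
Proof.
move=> Sl; split=> [|f g /Sl lf /Sl lg|f g /Sl lf /Sl lg]; rewrite /eval1_ratfun.
- exact: feval1.
- by rewrite fevalB ?oner_eq0.
- by rewrite fevalM ?oner_eq0.
Qed.

Fact numerical_val f : numerical_sub f -> int_sub (eval1_poly f).
Proof. by move/(_ 1). Qed.
Fact stable_laurent f : stable_sub f -> laurent f. Proof. by case. Qed.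
Fact stable_val f : stable_sub f -> int_sub (eval1_ratfun f).
Proof. by case=> _ /(_ 1 isT)[j]; rewrite expr1n mul1r. Qed.
Fact stable_loc_laurent p f : localize p stable_sub f -> laurent f.
Proof.
move=> [s [s0 _ [lsf _]]].
have s0' : s%:R != 0 :> rat by rewrite pnatr_eq0 -lt0n.
have -> : f = ratfun_const s%:R^-1 * (s%:R * f).
  by rewrite mulrA -(rmorph_nat ratfun_const) -rmorphM mulVf // rmorph1 mul1r.
apply: laurentM lsf; exists (s%:R^-1)%:P, 0.
by rewrite expr0 tofrac1 divr1.
Qed.

Definition aug_num : {rmorphism Anum -> int} := int_of_sub \o
  res_morph (eval1_poly_morph numerical_sub) numerical_val.

Definition aug_st : {rmorphism Ast -> int} := int_of_sub \o
  res_morph (eval1_ratfun_morph stable_laurent) stable_val.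

Definition aug_num_loc p : {rmorphism Anum_loc p -> Zloc p} :=
  res_morph (eval1_poly_morph (localize p numerical_sub))
    (localize_val (eval1_poly_morph (localize p numerical_sub)) numerical_val).

Definition aug_st_loc p : {rmorphism Ast_loc p -> Zloc p} :=
  res_morph (eval1_ratfun_morph (@stable_loc_laurent p))
    (localize_val (eval1_ratfun_morph (@stable_loc_laurent p)) stable_val).

Section ProfiniteLimit.
Variable N : nat -> nat.

(* The additive group Z/n is 'I_n, which needs n to have the form _.+1; here
   n = (N i).+1 for some i. *)
Definition residues : Type := forall i, 'I_(N i).+1.
HB.instance Definition _ := gen_eqMixin residues.
HB.instance Definition _ := gen_choiceMixin residues.

Definition res0 : residues := fun i => 0.
Definition res_add (x y : residues) : residues := fun i => x i + y i.
Definition res_opp (x : residues) : residues := fun i => - x i.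
Fact res_addA : associative res_add.
Proof. by move=> x y z; apply/functional_extensionality_dep => i; apply: addrA. Qed.
Fact res_addC : commutative res_add.
Proof. by move=> x y; apply/functional_extensionality_dep => i; apply: addrC. Qed.
Fact res_add0 : left_id res0 res_add.
Proof. by move=> x; apply/functional_extensionality_dep => i; apply: add0r. Qed.
Fact res_addN : left_inverse res0 res_opp res_add.
Proof. by move=> x; apply/functional_extensionality_dep => i; apply: addNr. Qed.
HB.instance Definition _ := GRing.isZmodule.Build residues
  res_addA res_addC res_add0 res_addN.

Definition res_scale (n : int) (x : residues) : residues := x *~ n.
Fact res_scaleA a b x : res_scale a (res_scale b x) = res_scale (a * b) x.
Proof. by rewrite /res_scale mulrzA_C. Qed.
Fact res_scale1 : left_id 1 res_scale. Proof. by []. Qed.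
Fact res_scaleDr : right_distributive res_scale +%R.
Proof. by move=> a x y; apply: mulrzDl. Qed.
Fact res_scaleDl x : {morph res_scale^~ x : a b / a + b}.
Proof. by move=> a b; apply: mulrzDr. Qed.
HB.instance Definition _ := GRing.Zmodule_isLmodule.Build int residues
  res_scaleA res_scale1 res_scaleDr res_scaleDl.

Definition compatible (x : residues) : Prop :=
  forall i j, ((N j).+1 %| (N i).+1)%N -> x i = x j %[mod (N j).+1].

Fact compat0 : compatible 0. Proof. by []. Qed.
Fact compatD x y : compatible x -> compatible y -> compatible (x + y).
Proof.
move=> cx cy i j ji.
rewrite [LHS](modn_dvdm _ ji) -modnDm cx // cy // modnDm.
by rewrite [RHS]modn_mod.
Qed.
Fact compatN x : compatible x -> compatible (- x).
Proof.
move=> cx i j ji; rewrite [LHS](modn_dvdm _ ji) [RHS]modn_mod.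
apply/eqP; rewrite -(eqn_modDr (x i)).
rewrite subnK; last exact/ltnW/ltn_ord.
rewrite -modnDmr cx // modnDmr subnK; last exact/ltnW/ltn_ord.
by rewrite modnn; apply: ji.
Qed.
Fact compatZ (n : int) x : compatible x -> compatible (n *: x).
Proof.
move=> cx; have cn (m : nat) : compatible (x *+ m).
  elim: m => [|m IH]; first by rewrite mulr0n; apply: compat0.
  by rewrite mulrS; apply: compatD.
case: n => n; first exact: cn.
by rewrite /GRing.scale /= /res_scale NegzE mulrNz; apply/compatN/cn.
Qed.
Definition compat : submodule residues :=
  @Submodule int residues compatible compat0 compatD compatZ.

Definition res_one : residues := fun i => inZp 1.
Fact res_one_compat : res_one \in sm_pred compat.
Proof. by apply/sm_predP => i j ji; rewrite [LHS](modn_dvdm _ ji) [RHS]modn_mod. Qed.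

(* The inverse limit of the groups Z/(N i).+1 along the divisibility order. *)
Definition limZ : lmodType int := submod_type compat.
Definition limZ1 : limZ := SubmodElt res_one_compat.
End ProfiniteLimit.

Definition Zhat : lmodType int := limZ (fun i => i).

(* (p ^ i).-1.+1 = p ^ i *)
Definition Zp (p : nat) : lmodType int := limZ (fun i => (p ^ i).-1).

Definition int_in_Zhat : submodule Zhat.
Proof.
refine (@Submodule int Zhat (fun x => exists n : int, x = n *: limZ1 _) _ _ _).
- by exists 0; rewrite scale0r.
- by move=> x y [m ->] [n ->]; exists (m + n); rewrite scalerDl.
- by move=> a x [n ->]; exists (a * n); rewrite scalerA.
Defined.

(* The image of Z_(p): an integer [s] prime to [p] is invertible in Z_p, so that
   s x = a means that x is the fraction a / s. *)
Definition Zloc_in_Zp p : submodule (Zp p).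
Proof.
refine (@Submodule int (Zp p) (fun x => exists (s : nat) (a : int),
  [/\ (0 < s)%N, coprime p s & s%:Z *: x = a *: limZ1 _]) _ _ _).
- by exists 1%N, 0; rewrite coprimen1 scale0r scaler0.
- move=> x y [s [a [s0 ps ex]]] [u [b [u0 pu ey]]].
  exists (s * u)%N, (u%:Z * a + s%:Z * b).
  split; [by rewrite muln_gt0 s0|by rewrite coprimeMr ps|].
  rewrite PoszM scalerDr -[in X in _ + X]scalerA ey mulrC -scalerA ex.
  by rewrite !scalerA -scalerDl.
- move=> c x [s [a [s0 ps ex]]]; exists s, (c * a); split => //.
  by rewrite scalerA mulrC -scalerA ex scalerA.
Defined.

(* Between modules over a localization of Z, additive maps are linear. *)
Definition zmod_iso (U V : zmodType) : Prop :=
  exists f : {additive U -> V}, bijective f.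

Definition Zhat_mod_Z : zmodType := quot_mod int_in_Zhat.
Definition Zp_mod_Zloc p : zmodType := quot_mod (Zloc_in_Zp p).
Definition zero_group : zmodType := 'I_1.

(* Projective resolutions and projective replacements exist, so the quantification
   over them that goes with [HGamma] is not vacuous: see
   [projective_resolution_exists] and [projective_replacement_exists]. *)
Section FreeCover.
Variable R : nzRingType.

Section FreeLift.
Variables (X : choiceType) (M : lmodType R) (f : X -> M).

Lemma fglift_gen x : fglift f << x >> = f x.
Proof. by rewrite liftU scale1r. Qed.

Lemma fglift_ext (g h : {linear {freeg X / R} -> M}) :
  (forall x, g << x >> = h << x >>) -> g =1 h.
Proof.
move=> gh D; rewrite -[D]freeg_sumE !raddf_sum; apply: eq_bigr => x _ /=.
by rewrite -[coeff x D]mulr1 -freegUZ !linearZ /= gh.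
Qed.
End FreeLift.

Lemma free_projective (X : choiceType) : projective {freeg X / R}.
Proof.
move=> U V g f sg.
have /choice[s sP] : forall x : X, exists u, g u = f << x >> by move=> x; apply: sg.
exists (fglift s) => D.
apply: (@fglift_ext X V (g \o fglift s : {linear _ -> _}) f) => x /=.
by rewrite fglift_gen.
Qed.
End FreeCover.

Section PmapChoice.
Variables m l : nat.
HB.instance Definition _ := gen_eqMixin (pmap m l).
HB.instance Definition _ := gen_choiceMixin (pmap m l).
End PmapChoice.

Lemma pcompA m l j h (a : pmap j h) (b : pmap l j) (c : pmap m l) :
  pcomp a (pcomp b c) = pcomp (pcomp a b) c.
Proof. exact: pmap_eq. Qed.
Lemma pcomp1f m l (f : pmap m l) : pcomp (pid l) f = f.
Proof. exact: pmap_eq. Qed.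
Lemma pcompf1 m l (f : pmap m l) : pcomp f (pid m) = f.
Proof. exact: pmap_eq. Qed.

Section GammaCover.
Variables (R : nzRingType) (N : rgmod R).

Definition cover_gen (l : nat) : choiceType := {m : nat & (N m * pmap l m)%type}.
Definition cov l m (x : N m) (f : pmap l m) : cover_gen l :=
  Tagged (fun m => (N m * pmap l m)%type) (x, f).
Definition cover_ob l : lmodType R := {freeg (cover_gen l) / R}.
Definition cover_map_gen l j (f : pmap l j) (z : cover_gen j) : cover_ob l :=
  << cov (tagged z).1 (pcomp (tagged z).2 f) >>.
Definition cover_map l j (f : pmap l j) : {linear cover_ob j -> cover_ob l} :=
  fglift (cover_map_gen f).

Lemma cover_mapE l j m (f : pmap l j) (x : N m) (g : pmap j m) :
  cover_map f << cov x g >> = << cov x (pcomp g f) >>.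
Proof. exact: fglift_gen. Qed.

Fact cover_id m : cover_map (pid m) =1 id.
Proof.
apply: (@fglift_ext _ _ _ _ (idfun : {linear _ -> _})) => -[j [x f]].
by rewrite cover_mapE pcompf1.
Qed.
Fact cover_comp m l j (g : pmap l j) (f : pmap m l) :
  cover_map (pcomp g f) =1 cover_map f \o cover_map g.
Proof.
apply: (@fglift_ext _ _ _ _ (cover_map f \o cover_map g)) => -[h [x a]].
transitivity (cover_map f (cover_map g << cov x a >>)) => //.
by rewrite !cover_mapE pcompA.
Qed.
Definition cover : rgmod R := @RGMod R cover_ob cover_map cover_id cover_comp.

Definition cover_proj_fun l : {linear cover_ob l -> N l} :=
  fglift (fun z : cover_gen l => rg_map N (tagged z).2 (tagged z).1).

Lemma cover_projE l m (x : N m) (f : pmap l m) :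
  cover_proj_fun l << cov x f >> = rg_map N f x.
Proof. exact: fglift_gen. Qed.

Fact cover_proj_nat m l (f : pmap m l) x :
  cover_proj_fun m (rg_map cover f x) = rg_map N f (cover_proj_fun l x).
Proof.
pose a : {linear cover_ob l -> N m} := cover_proj_fun m \o cover_map f.
pose b : {linear cover_ob l -> N m} := rg_map N f \o cover_proj_fun l.
apply: (@fglift_ext _ _ _ a b) x => -[j [x g]].
transitivity (cover_proj_fun m (cover_map f << cov x g >>)) => //.
rewrite cover_mapE cover_projE rg_comp; apply: (congr1 (rg_map N f)).
exact/esym/cover_projE.
Qed.
Definition cover_proj : rgnat cover N := RGNat cover_proj_nat.

Lemma cover_proj_surj m : surj_fun (cover_proj m).
Proof. by move=> x; exists << cov x (pid m) >>; rewrite cover_projE rg_id. Qed.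

Lemma cover_projective : rg_projective cover.
Proof.
move=> M M' g f sg.
pose s (z : {m : nat & N m}) : M (tag z) :=
  projT1 (cid (sg (tag z) (f (tag z) << cov (tagged z) (pid (tag z)) >>))).
have sP z : g (tag z) (s z) = f (tag z) << cov (tagged z) (pid (tag z)) >>.
  exact: (projT2 (cid (sg (tag z) _))).
pose h l : {linear cover_ob l -> M l} := fglift (fun z : cover_gen l =>
  rg_map M (tagged z).2 (s (Tagged (fun m => N m : Type) (tagged z).1))).
have hE l m (x : N m) (u : pmap l m) :
    h l << cov x u >> = rg_map M u (s (Tagged (fun m => N m : Type) x)).
  exact: fglift_gen.
have hnat m l (u : pmap m l) x : h m (rg_map cover u x) = rg_map M u (h l x).
  pose a : {linear cover_ob l -> M m} := h m \o cover_map u.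
  pose b : {linear cover_ob l -> M m} := rg_map M u \o h l.
  apply: (@fglift_ext _ _ _ a b) x => -[j [x v]].
  transitivity (h m (cover_map u << cov x v >>)) => //.
  rewrite cover_mapE hE rg_comp; apply: (congr1 (rg_map M u)).
  exact/esym/hE.
exists (RGNat hnat) => m.
apply: (@fglift_ext _ _ _ (g m \o h m : {linear _ -> _}) (f m)) => -[j [x v]].
transitivity (g m (h m << cov x v >>)) => //.
rewrite hE; apply: etrans; first exact: (rgn_nat g v).
rewrite (sP (Tagged (fun m => N m : Type) x)); apply: etrans.
  exact/esym/(rgn_nat f v).
by congr (f m _); apply: etrans (cover_mapE _ _ _) _; rewrite pcomp1f.
Qed.

Definition syz_ob m : lmodType R := submod_type (ker (cover_proj m)).
Fact syz_map_subproof m l (f : pmap m l) (x : syz_ob l) :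
  rg_map cover f (val x) \in sm_pred (ker (cover_proj m)).
Proof.
apply/sm_predP; apply: etrans; first exact: (rgn_nat cover_proj f).
have /(sm_predP (ker (cover_proj l))) e := valP x.
by rewrite -[RHS](raddf0 (rg_map N f)); congr (rg_map N f _).
Qed.
Definition syz_map m l (f : pmap m l) (x : syz_ob l) : syz_ob m :=
  SubmodElt (syz_map_subproof f x).
Fact syz_map_linear m l (f : pmap m l) : linear (syz_map f).
Proof. move=> a x y; apply/val_inj; rewrite [RHS]linearP.
transitivity (cover_map f (a *: val x + val y)); last exact: linearP.
by congr (cover_map f _); rewrite linearP. Qed.
HB.instance Definition _ m l (f : pmap m l) :=
  GRing.isLinear.Build R (syz_ob l) (syz_ob m) *:%R (syz_map f) (syz_map_linear f).
Fact syz_id m : syz_map (pid m) =1 id.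
Proof. by move=> x; apply/val_inj; rewrite /= cover_id. Qed.
Fact syz_comp m l j (g : pmap l j) (f : pmap m l) :
  syz_map (pcomp g f) =1 syz_map f \o syz_map g.
Proof. by move=> x; apply/val_inj; rewrite /= cover_comp. Qed.
Definition syz : rgmod R := @RGMod R syz_ob (fun m l f => syz_map f) syz_id syz_comp.

Definition syz_incl_fun m (x : syz_ob m) : cover m := val x.
Fact syz_incl_linear m : linear (@syz_incl_fun m).
Proof. by move=> a x y; rewrite /syz_incl_fun linearP. Qed.
HB.instance Definition _ m :=
  GRing.isLinear.Build R (syz_ob m) (cover m) *:%R (@syz_incl_fun m)
    (@syz_incl_linear m).
Fact syz_incl_nat m l (f : pmap m l) x :
  syz_incl_fun (rg_map syz f x) = rg_map cover f (syz_incl_fun x).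
Proof. by []. Qed.
Definition syz_incl : rgnat syz cover :=
  @RGNat R syz cover (fun m => @syz_incl_fun m) syz_incl_nat.

Lemma syz_inclP m (x : cover m) : cover_proj m x = 0 <-> exists y, x = syz_incl m y.
Proof.
split=> [/(sm_predP (ker (cover_proj m))) kx|[y ->]]; first by exists (SubmodElt kx).
exact/(sm_predP (ker (cover_proj m)))/(valP y).
Qed.
End GammaCover.

Section Existence.
Variables (R : nzRingType) (N : rgmod R).

Section Comp.
Variables (P P' P'' : rgmod R) (v : rgnat P' P'') (u : rgnat P P').
Fact rgcomp_nat m l (f : pmap m l) x :
  v m (u m (rg_map P f x)) = rg_map P'' f (v l (u l x)).
Proof. by rewrite !rgn_nat. Qed.
Definition rgcomp : rgnat P P'' :=
  @RGNat R P P'' (fun m => v m \o u m) rgcomp_nat.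
End Comp.

Definition syzygies n : rgmod R := iter n (@syz R) N.

Lemma projective_resolution_exists : inhabited (projective_resolution N).
Proof.
constructor.
apply: (@ProjResolution R N (fun n => cover (syzygies n))
  (fun n => rgcomp (syz_incl (syzygies n)) (cover_proj (syzygies n.+1)))
  (cover_proj N)).
- by move=> n; apply: cover_projective.
- exact: cover_proj_surj.
- move=> m x; rewrite syz_inclP; split=> [[y ->]|[y ->]].
    by have [z <-] := cover_proj_surj y; exists z.
  by exists (cover_proj (syz N) m y).
- move=> n m x; split=> [e|[y ->]].
    have /syz_inclP[y ->] : cover_proj (syzygies n.+1) m x = 0.
      by apply/val_inj; exact: e.
    by have [z <-] := cover_proj_surj y; exists z.
  have -> // : rgcomp (syz_incl (syzygies n)) (cover_proj (syzygies n.+1)) m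
    (syz_incl (syzygies n.+1) m (cover_proj (syzygies n.+2) m y)) = 0.
  have /syz_inclP e : exists z, syz_incl (syzygies n.+1) m
    (cover_proj (syzygies n.+2) m y) = syz_incl (syzygies n.+1) m z by eexists.
  by rewrite /= e raddf0.
Qed.
End Existence.

Section Replacement.
Variables (R : nzRingType) (C : chain_complex R).

(* A stage of the construction: Q_n with its differential and its map to C_n. *)
Record stage n := Stage {
  st_prev : lmodType R;
  st_ob : lmodType R;
  st_d : {linear st_ob -> st_prev};
  st_f : {linear st_ob -> C n} }.

Section Step.
Variables (n : nat) (s : stage n).
Local Notation T := (st_ob s * C n.+1)%type.
Definition step_fun (z : T) : st_prev s * C n :=
  (st_d s z.1, st_f s z.1 - cc_d C n z.2).
Fact step_fun_linear : linear step_fun.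
Proof.
move=> a x y; rewrite /step_fun /= !linearP; congr (_, _).
by rewrite /= scalerDr addrACA.
Qed.
HB.instance Definition _ :=
  GRing.isLinear.Build R T (st_prev s * C n)%type *:%R step_fun step_fun_linear.
Definition step_ob : lmodType R := submod_type (ker step_fun).
Definition step_gen (z : step_ob) : T := val z.
Definition step_next : stage n.+1 :=
  @Stage n.+1 (st_ob s) {freeg step_ob / R}
    (fglift (fun z => (step_gen z).1)) (fglift (fun z => (step_gen z).2)).
End Step.

Definition stage0 : stage 0 :=
  @Stage 0 (C 0) {freeg (C 0) / R} (\0 : {linear _ -> C 0}) (fglift id).
Fixpoint stages n : stage n :=
  match n with 0 => stage0 | n.+1 => step_next (stages n) end.

Lemma stage_proj n : projective (st_ob (stages n)).
Proof. by case: n => [|n]; apply: free_projective. Qed.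

Lemma step_ker n (s : stage n) x :
  st_d s (st_d (step_next s) x) = 0 /\
  st_f s (st_d (step_next s) x) = cc_d C n (st_f (step_next s) x).
Proof.
have key (z : step_ob s) :
    st_d s (step_gen z).1 = 0 /\ st_f s (step_gen z).1 = cc_d C n (step_gen z).2.
  have /(sm_predP (ker (@step_fun _ s))) [-> e] := valP z.
  by split=> //; apply/eqP; rewrite -subr_eq0; apply/eqP.
pose z0 : {linear st_ob (step_next s) -> st_prev s} := \0.
pose a : {linear st_ob (step_next s) -> st_prev s} := st_d s \o st_d (step_next s).
pose b : {linear st_ob (step_next s) -> C n} := st_f s \o st_d (step_next s).
pose c : {linear st_ob (step_next s) -> C n} := cc_d C n \o st_f (step_next s).
split; [apply: (@fglift_ext _ _ _ a z0)|apply: (@fglift_ext _ _ _ b c)] => z;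
  by have [e1 e2] := key z; rewrite /a /b /c /= !fglift_gen.
Qed.

Lemma step_lift n (s : stage n) q c :
  st_d s q = 0 -> st_f s q = cc_d C n c ->
  exists x, st_d (step_next s) x = q /\ st_f (step_next s) x = c.
Proof.
move=> dq fq.
have k : (q, c) \in sm_pred (ker (@step_fun _ s)).
  by apply/sm_predP; rewrite /= /step_fun dq fq subrr.
by exists << SubmodElt k >>; rewrite /= !fglift_gen.
Qed.

Definition repl : chain_complex R :=
  @ChainComplex R (fun n => st_ob (stages n)) (fun n => st_d (stages n.+1))
    (fun n x => proj1 (step_ker x)).

Definition repl_map : chain_map repl C :=
  @ChainMap R repl C (fun n => st_f (stages n)) (fun n x => proj2 (step_ker x)).

Lemma cycles_repl n x : cycles repl n x <-> st_d (stages n) x = 0.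
Proof. by case: n x. Qed.

Lemma repl_qis : quasi_iso repl_map.
Proof.
move=> n; split=> [z cz|y /cycles_repl dy [c fy]]; last first.
  by have [x [<- _]] := step_lift dy fy; exists x.
have [y dy fy] : exists2 y, st_d (stages n) y = 0 & st_f (stages n) y = z.
  case: n z cz => [z _|n z cz].
    by exists << z >>; rewrite //= fglift_gen.
  have [|x [dx fx]] := @step_lift n (stages n) 0 z (raddf0 _).
    by rewrite raddf0; apply/esym.
  by exists x.
exists y; first exact/cycles_repl.
by rewrite /= fy subrr; apply: im0.
Qed.

Lemma projective_replacement_exists : inhabited (projective_replacement C).
Proof. by constructor; exists repl repl_map; [apply: stage_proj|apply: repl_qis]. Qed.
End Replacement.

(* Main.v *)
(* The complex P (x)_Gamma L(A) has the homology of A (x) Q, placed in degree 0, so that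
   HGamma^n(A; M) = Ext^n_A(A (x) Q, M).

   Evaluation at positive rationals embeds A (x) ... (x) A (m + 1 factors) into the functions
   of points (n_0, ..., n_m), and Gamma acts by substitution.  As t is additive, a natural map
   that factors through the wedge m v m is, in homology, the sum of its two restrictions.
   Hence three kinds of functors have no homology: constant ones; those on which a reduced
   functor acts with local units; and those where the identity factors through the wedge with
   both restrictions equal to some h for which 1 - 2h is invertible.  These remove, in turn,
   the values on the diagonal; the difference between A and A (x) Q (Frobenius x^p = x mod p
   gives units); the denominators (powers of w give units); and, by the midpoint map, for
   which h is 2^-d in degree d, the homogeneous polynomials of degree d > 1 in the
   differences n_i - n_0.  The linear functions sum_i b_i (n_i - n_0), b_i in A (x) Q, that
   remain are computed by a contraction of P_*([1]).

   A (x) Q is the colimit of A -q_0-> A -q_1-> ... (q_n = n + 1, or q_n = p), so Ext^1 is the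
   cokernel of y |-> (q_n y_(n+1) - y_n) on sequences in M, and the other groups vanish.  With
   M_n = q_0 ... q_(n-1), sending an element of lim Z/M_n to its digits identifies this
   cokernel with (lim Z/M_n) / M. *)
From HB Require Import structures.
From mathcomp Require Import all_boot all_order all_algebra generic_quotient.
From mathcomp Require Import boolp classical_sets functions.
From mathcomp Require Import freeg ring lra zify.
Require Import Defs.

Set Implicit Arguments.
Unset Strict Implicit.
Unset Printing Implicit Defensive.

Import Order.TTheory GRing.Theory Num.Theory.
Local Open Scope ring_scope.

(** * Modules and functors on Gamma *)

(** Points are rational rather than integral because the midpoint of two points must again be a
    point, and positive because powers of [w] occur as denominators. Integrality is remembered only
    by membership in the image of the tensor power.

    The diagonal has to be removed first. Multiplication by x factors through the wedge by putting x
    on one copy and its argument on the other; the retractions then vanish because x and the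
    argument vanish at [0], that is, on the diagonal. If moreover some such x acts as the identity
    on any given finite set of elements of a quotient, that quotient has no homology. One source of
    such x is y^(p-1), when y^p - y is divisible by p; the other is 1 - (w_1 ... w_m)^j / w_0^(m j),
    which vanishes on the diagonal and whose complement clears denominators.

    Degree 1 is exactly where halving fails: there h = 1/2 and 1 - 2h = 0. All four rings enter only
    through [evaluable]. *)

Section LinearMaps.
Variable R : nzRingType.

Section Mk.
Variables (U V : lmodType R) (f : U -> V) (f_lin : linear f).
Fact mklin_zmod : zmod_morphism f.
Proof. by move=> x y; rewrite addrC -scaleN1r f_lin scaleN1r addrC. Qed.
Fact mklin_scale : scalable f.
Proof.
have f0 : f 0 = 0 by rewrite -(subrr 0) mklin_zmod subrr.
by move=> a x; rewrite -[a *: x]addr0 f_lin f0 addr0.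
Qed.
Definition mklin : {linear U -> V} :=
  HB.pack_for {linear U -> V} f
    (GRing.isZmodMorphism.Build U V f mklin_zmod)
    (GRing.isScalable.Build R U V *:%R f mklin_scale).
Lemma mklinE x : mklin x = f x. Proof. by []. Qed.
End Mk.

Lemma linZZ (U V : lmodType R) (f : {linear U -> V}) a x : f (a *: x) = a *: f x.
Proof. by rewrite linearZ. Qed.

Lemma linDD (U V : lmodType R) (f : {linear U -> V}) x y : f (x + y) = f x + f y.
Proof. by rewrite raddfD. Qed.
Lemma linBB (U V : lmodType R) (f : {linear U -> V}) x y : f (x - y) = f x - f y.
Proof. by rewrite raddfB. Qed.
Lemma lin00 (U V : lmodType R) (f : {linear U -> V}) : f 0 = 0.
Proof. by rewrite raddf0. Qed.

Lemma linSS (U V : lmodType R) (f : {linear U -> V}) I (r : seq I) (P : pred I) F :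
  f (\sum_(i <- r | P i) F i) = \sum_(i <- r | P i) f (F i).
Proof. exact: raddf_sum. Qed.

Section Submod.
Variables (V : lmodType R) (S : submodule V).
Lemma smN x : S x -> S (- x).
Proof. by move=> Sx; rewrite -scaleN1r; apply: smZ. Qed.
Lemma smB x y : S x -> S y -> S (x - y).
Proof. by move=> Sx Sy; apply/smD/smN. Qed.
Lemma sm_sum I (r : seq I) (P : pred I) (F : I -> V) :
  (forall i, P i -> S (F i)) -> S (\sum_(i <- r | P i) F i).
Proof. by move=> SF; apply: big_ind => // [|x y]; [apply: sm0|apply: smD]. Qed.
Section Cap.
Variable T : submodule V.
Definition in_cap x := S x /\ T x.
Fact cap0 : in_cap 0. Proof. by split; apply: sm0. Qed.
Fact capD x y : in_cap x -> in_cap y -> in_cap (x + y).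
Proof. by move=> [? ?] [? ?]; split; apply: smD. Qed.
Fact capZ a x : in_cap x -> in_cap (a *: x).
Proof. by move=> [? ?]; split; apply: smZ. Qed.
Definition sm_cap : submodule V := Submodule cap0 capD capZ.
End Cap.
Lemma submodP (x : submod_type S) : S (val x).
Proof. exact/(sm_predP S)/valP. Qed.
Definition to_submod x (Sx : S x) : submod_type S :=
  SubmodElt ((sm_predP S x).2 Sx).
Fact submod_val_lin : linear (fun x : submod_type S => val x).
Proof. by move=> a x y; rewrite linearP. Qed.
Definition sm_incl : {linear submod_type S -> V} := mklin submod_val_lin.
Fact to_quot_lin : linear (to_quot S).
Proof. by move=> a x y; rewrite linearP. Qed.

Section Corestrict.
Variables (U : lmodType R) (f : {linear U -> V}) (fS : forall x, S (f x)).
Fact corestrict_lin : linear (fun x => to_submod (fS x)).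
Proof. by move=> a x y; apply/val_inj; rewrite [RHS]linearP; exact: (linearP f). Qed.
Definition corestrict : {linear U -> submod_type S} := mklin corestrict_lin.
End Corestrict.
End Submod.

Section QuotLift.
Variables (U V : lmodType R) (S : submodule U) (f : {linear U -> V}).
Hypothesis fS : forall x, S x -> f x = 0.
Definition quot_lift_fun (q : quot_mod S) : V := f (repr q).
Lemma quot_lift_funE x : quot_lift_fun (to_quot S x) = f x.
Proof.
apply/eqP; rewrite -subr_eq0 -raddfB; apply/eqP/fS.
by apply/to_quotP; rewrite /to_quot reprK.
Qed.
Fact quot_lift_lin : linear quot_lift_fun.
Proof.
move=> a q r; have [x ->] := to_quot_surj q; have [y ->] := to_quot_surj r.
by rewrite -linearP !quot_lift_funE linearP.
Qed.
Definition quot_lift : {linear quot_mod S -> V} := mklin quot_lift_lin.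
Lemma quot_liftE x : quot_lift (to_quot S x) = f x.
Proof. exact: quot_lift_funE. Qed.
End QuotLift.
Arguments quot_lift : simpl never.

Section ProjLift.
Variables (P : lmodType R) (pP : projective P).
(** Corestricting [d] to its image makes it surjective, and the hypothesis puts the values of [f]
    there. Lifts along exact sequences of modules take this form. *)
Lemma projective_lift (U V : lmodType R) (d : {linear U -> V}) (f : {linear P -> V}) :
  (forall x, exists y, f x = d y) -> exists h : {linear P -> U}, forall x, d (h x) = f x.
Proof.
move=> fd.
have df (y : U) : im d (d y) by exists y.
have [|h hE] := pP (g := corestrict df) (corestrict (S := im d) fd).
  by move=> y; have [x e] := submodP y; exists x; apply/val_inj; exact/esym.
by exists h => x; have /(congr1 val) := hE x.
Qed.
End ProjLift.
End LinearMaps.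

Section Gfunctors.
Variable R : nzRingType.

Record lgnat (F G : lgmod R) := LGNat {
  lgn :> forall m, {linear F m -> G m};
  lgn_nat : forall m l (f : pmap m l) x,
    lgn l (lg_map F f x) = lg_map G f (lgn m x) }.

Definition lg_closed (F : lgmod R) (S : forall m, submodule (F m)) : Prop :=
  forall m l (f : pmap m l) x, S m x -> S l (lg_map F f x).

Section SubFunctor.
Variables (F : lgmod R) (S : forall m, submodule (F m)) (Sc : lg_closed S).
Definition lg_sub_map m l (f : pmap m l) : {linear submod_type (S m) -> submod_type (S l)} :=
  corestrict (f := lg_map F f \o sm_incl (S m)) (fun x => Sc f (submodP x)).
Fact lg_sub_id m : lg_sub_map (pid m) =1 id.
Proof. by move=> x; apply/val_inj; rewrite /= lg_id. Qed.
Fact lg_sub_comp m l j (g : pmap l j) (f : pmap m l) :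
  lg_sub_map (pcomp g f) =1 lg_sub_map g \o lg_sub_map f.
Proof. by move=> x; apply/val_inj; rewrite /= lg_comp. Qed.
Definition lg_sub : lgmod R :=
  @LGMod R (fun m => submod_type (S m)) lg_sub_map lg_sub_id lg_sub_comp.
Fact lg_incl_nat m l (f : pmap m l) (x : lg_sub m) :
  sm_incl (S l) (lg_map lg_sub f x) = lg_map F f (sm_incl (S m) x).
Proof. by []. Qed.
Definition lg_incl : lgnat lg_sub F := @LGNat lg_sub F (fun m => sm_incl (S m)) lg_incl_nat.
Lemma lg_incl_inj m : injective (lg_incl m).
Proof. exact: val_inj. Qed.

Fact lg_quot_subproof m l (f : pmap m l) (x : F m) :
  S m x -> (to_quot (S l) \o lg_map F f) x = 0.
Proof. by move=> Sx; apply/to_quot_eq0/Sc. Qed.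
Definition lg_quot_map m l (f : pmap m l) :
  {linear quot_mod (S m) -> quot_mod (S l)} := quot_lift (@lg_quot_subproof m l f).
Lemma lg_quot_mapE m l (f : pmap m l) x :
  lg_quot_map f (to_quot (S m) x) = to_quot (S l) (lg_map F f x).
Proof. exact: quot_liftE. Qed.
Fact lg_quot_id m : lg_quot_map (pid m) =1 id.
Proof. by move=> q; have [x ->] := to_quot_surj q; rewrite lg_quot_mapE lg_id. Qed.
Fact lg_quot_comp m l j (g : pmap l j) (f : pmap m l) :
  lg_quot_map (pcomp g f) =1 lg_quot_map g \o lg_quot_map f.
Proof.
move=> q; have [x ->] := to_quot_surj q.
transitivity (lg_quot_map g (lg_quot_map f (to_quot _ x))) => //.
by rewrite !lg_quot_mapE lg_comp.
Qed.
Definition lg_quot : lgmod R := @LGMod R (fun m => quot_mod (S m))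
  lg_quot_map lg_quot_id lg_quot_comp.
Definition lg_proj : lgnat F lg_quot :=
  @LGNat F lg_quot (fun m => mklin (to_quot_lin (S m)))
    (fun m l f x => esym (lg_quot_mapE f x)).
Lemma lg_proj_surj m : surj_fun (lg_proj m).
Proof. by move=> q; have [x ->] := to_quot_surj q; exists x. Qed.
Lemma lg_proj_eq0 m x : lg_proj m x = 0 <-> S m x.
Proof. exact: to_quot_eq0. Qed.
End SubFunctor.

Section ImKer.
Variables (F G : lgmod R) (t : lgnat F G).
Fact lg_im_closed : lg_closed (fun m => im (t m)).
Proof. by move=> m l f _ [x ->]; exists (lg_map F f x); rewrite lgn_nat. Qed.
Fact lg_ker_closed : lg_closed (fun m => ker (t m)).
Proof. by move=> m l f x /= e; rewrite lgn_nat e raddf0. Qed.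
Definition lg_coker : lgmod R := lg_quot lg_im_closed.
Definition lg_kernel : lgmod R := lg_sub lg_ker_closed.
Definition lg_coker_proj : lgnat G lg_coker := lg_proj lg_im_closed.
Definition lg_kernel_incl : lgnat lg_kernel F := lg_incl lg_ker_closed.
End ImKer.

Section RSub.
Variables (N : rgmod R) (S : forall m, submodule (N m)).
Hypothesis Sc : forall m l (f : pmap m l) x, S l x -> S m (rg_map N f x).
Definition rg_sub_map m l (f : pmap m l) : {linear submod_type (S l) -> submod_type (S m)} :=
  corestrict (f := rg_map N f \o sm_incl (S l)) (fun x => Sc f (submodP x)).
Fact rg_sub_id m : rg_sub_map (pid m) =1 id.
Proof. by move=> x; apply/val_inj; rewrite /= rg_id. Qed.
Fact rg_sub_comp m l j (g : pmap l j) (f : pmap m l) :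
  rg_sub_map (pcomp g f) =1 rg_sub_map f \o rg_sub_map g.
Proof. by move=> x; apply/val_inj; rewrite /= rg_comp. Qed.
Definition rg_sub : rgmod R :=
  @RGMod R (fun m => submod_type (S m)) rg_sub_map rg_sub_id rg_sub_comp.
End RSub.

(** The same for functors: the pointwise images of [d] form a subfunctor, against which the
    projectivity of [P] is tested. *)
Lemma rg_projective_lift (P N N' : rgmod R) (d : rgnat N N') (f : rgnat P N') :
  rg_projective P -> (forall m x, exists y, f m x = d m y) ->
  exists h : rgnat P N, forall m x, d m (h m x) = f m x.
Proof.
move=> pP fd.
have Sc m l (u : pmap m l) x : im (d l) x -> im (d m) (rg_map N' u x).
  by move=> [y ->]; exists (rg_map N u y); rewrite rgn_nat.
pose I := rg_sub Sc.
have dd m (y : N m) : im (d m) (d m y) by exists y.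
pose d1 m : {linear N m -> I m} := corestrict (dd m).
have d1n m l (u : pmap m l) x : d1 m (rg_map N u x) = rg_map I u (d1 l x).
  by apply/val_inj; apply: (rgn_nat d).
pose f1 m : {linear P m -> I m} := corestrict (S := im (d m)) (fd m).
have f1n m l (u : pmap m l) x : f1 m (rg_map P u x) = rg_map I u (f1 l x).
  by apply/val_inj; apply: (rgn_nat f).
have [|h hE] := pP N I (@RGNat _ N I _ d1n) (@RGNat _ P I _ f1n).
  by move=> m y; have [x e] := submodP y; exists x; apply/val_inj; exact/esym.
by exists h => m x; have /(congr1 val) := hE m x.
Qed.

Section NatOps.
Variables (P N : rgmod R).
Fact rgsub_nat (u v : rgnat P N) m l (f : pmap m l) x :
  (u m \- v m) (rg_map P f x) = rg_map N f ((u l \- v l) x).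
Proof. by rewrite /= !rgn_nat raddfB. Qed.
Definition rgsubn (u v : rgnat P N) : rgnat P N :=
  @RGNat R P N (fun m => u m \- v m) (rgsub_nat u v).
End NatOps.
End Gfunctors.

(** * Coends *)

Lemma pres_ind (R : nzRingType) (X : choiceType) (rel : {freeg X / R} -> Prop)
    (S : submodule (pres rel)) : (forall x, S (gen rel x)) -> forall q, S q.
Proof.
move=> Sg q; have [D ->] := to_quot_surj q.
rewrite -[D]freeg_sumE raddf_sum; apply: sm_sum => x _ /=.
by rewrite -[coeff _ _]mulr1 -freegUZ to_quotZ; apply: smZ; apply: Sg.
Qed.

(** Flatness of a projective functor is thereby reduced to that of the explicit functor
    [cover N]. *)
Lemma cover_retract (R : nzRingType) (N : rgmod R) : rg_projective N ->
  exists i : rgnat N (cover N), forall m x, cover_proj N m (i m x) = x.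
Proof.
move=> pN; pose idN : rgnat N N :=
  @RGNat R N N (fun m => idfun : {linear N m -> N m}) (fun m l f x => erefl).
exact: (pN _ _ (cover_proj N) idN (@cover_proj_surj _ N)).
Qed.

Section Coends.
Variables (k : comNzRingType) (A : comAlgType k).

Section Basics.
Variables (P : rgmod k) (F : lgmod A).
Definition cpure m (x : P m) (y : F m) : coend P F :=
  to_quot (sm_span (@coend_rel k A P F)) (pure x y).

Lemma cpureDl m (x x' : P m) (y : F m) : cpure (x + x') y = cpure x y + cpure x' y.
Proof.
apply/eqP; rewrite -subr_eq0 opprD addrA /cpure -!to_quotB; apply/eqP.
exact/gen_rel/CoendAddl.
Qed.
Lemma cpureDr m (x : P m) (y y' : F m) : cpure x (y + y') = cpure x y + cpure x y'.
Proof.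
apply/eqP; rewrite -subr_eq0 opprD addrA /cpure -!to_quotB; apply/eqP.
exact/gen_rel/CoendAddr.
Qed.
Lemma cpureZl m c (x : P m) (y : F m) : cpure (c *: x) y = c%:A *: cpure x y.
Proof.
apply/eqP; rewrite -subr_eq0 /cpure -to_quotZ -!to_quotB; apply/eqP.
exact/gen_rel/CoendScalel.
Qed.
Lemma cpureZr m a (x : P m) (y : F m) : cpure x (a *: y) = a *: cpure x y.
Proof.
apply/eqP; rewrite -subr_eq0 /cpure -to_quotZ -!to_quotB; apply/eqP.
exact/gen_rel/CoendScaler.
Qed.
Lemma cpure_nat m l (f : pmap m l) (x : P l) (y : F m) :
  cpure (rg_map P f x) y = cpure x (lg_map F f y).
Proof. by apply/eqP; rewrite -subr_eq0 /cpure -!to_quotB; apply/eqP/gen_rel/CoendMap. Qed.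
Lemma cpure0l m (y : F m) : cpure (0 : P m) y = 0.
Proof. exact: pure0. Qed.
Lemma cpure0r m (x : P m) : cpure x (0 : F m) = 0.
Proof. by rewrite -(scale0r 0) cpureZr scale0r. Qed.
Lemma cpureNl m (x : P m) (y : F m) : cpure (- x) y = - cpure x y.
Proof. by apply/eqP; rewrite -subr_eq0 opprK -cpureDl addNr cpure0l. Qed.
Lemma cpureNr m (x : P m) (y : F m) : cpure x (- y) = - cpure x y.
Proof. by rewrite -scaleN1r cpureZr scaleN1r. Qed.

Lemma coend_ind (S : submodule (coend P F)) :
  (forall m (x : P m) (y : F m), S (cpure x y)) -> forall z, S z.
Proof. by move=> Sp; apply: pres_ind => -[m [x y]]; apply: Sp. Qed.

Lemma coend_ext (M : lmodType A) (g h : {linear coend P F -> M}) :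
  (forall m (x : P m) (y : F m), g (cpure x y) = h (cpure x y)) -> g =1 h.
Proof.
move=> gh z; apply/eqP; rewrite -subr_eq0; apply/eqP.
apply: (@coend_ind (ker (g \- h))) z => m x y /=.
by rewrite gh subrr.
Qed.

(** The universal property of the coend: a family with these properties is the same as a linear map
    out of it. *)
Record balanced (M : lmodType A) (b : forall m, P m -> F m -> M) : Prop := Balanced {
  bal_Dl : forall m (x x' : P m) (y : F m), b m (x + x') y = b m x y + b m x' y;
  bal_Dr : forall m (x : P m) (y y' : F m), b m x (y + y') = b m x y + b m x y';
  bal_Zl : forall m c (x : P m) (y : F m), b m (c *: x) y = c%:A *: b m x y;
  bal_Zr : forall m a (x : P m) (y : F m), b m x (a *: y) = a *: b m x y;
  bal_nat : forall m l (f : pmap m l) (x : P l) (y : F m),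
    b m (rg_map P f x) y = b l x (lg_map F f y) }.

Section Lift.
Variables (M : lmodType A) (b : forall m, P m -> F m -> M) (bb : balanced b).
Definition coend_lift_gen (z : coend_gen P F) : M := b (tagged z).1 (tagged z).2.
Fact coend_lift_rel r : @coend_rel k A P F r -> fglift coend_lift_gen r = 0.
Proof.
case=> [m x x' y|m x y y'|m c x y|m a x y|m l f x y];
  rewrite !raddfB /= ?fglift_scalable !liftU !scale1r /coend_lift_gen /=.
- by rewrite bal_Dl // -addrA -opprD subrr.
- by rewrite bal_Dr // -addrA -opprD subrr.
- by rewrite bal_Zl // subrr.
- by rewrite bal_Zr // subrr.
- by rewrite bal_nat // subrr.
Qed.
Definition coend_lift : {linear coend P F -> M} :=
  pres_hom coend_lift_gen coend_lift_rel.
Lemma coend_liftE m (x : P m) (y : F m) : coend_lift (cpure x y) = b x y.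
Proof. exact: pres_hom_gen. Qed.
End Lift.
End Basics.
Arguments coend_lift : simpl never.

Lemma coend_mapE' (P P' : rgmod k) (F : lgmod A) (u : rgnat P P') m (x : P m) (y : F m) :
  coend_map F u (cpure x y) = cpure (u m x) y.
Proof. exact: coend_mapE. Qed.

Section Mapr.
Variables (P : rgmod k) (F G : lgmod A) (t : lgnat F G).
Fact coend_mapr_bal : balanced (fun m (x : P m) y => cpure x (t m y)).
Proof.
split=> *; rewrite ?raddfD ?linearZ /= ?cpureDl ?cpureDr ?cpureZl ?cpureZr //.
by rewrite lgn_nat cpure_nat.
Qed.
Definition coend_mapr : {linear coend P F -> coend P G} := coend_lift coend_mapr_bal.
Lemma coend_maprE m (x : P m) (y : F m) : coend_mapr (cpure x y) = cpure x (t m y).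
Proof. exact: coend_liftE. Qed.
End Mapr.
Arguments coend_mapr : simpl never.

Lemma coend_map_mapr (P P' : rgmod k) (F G : lgmod A) (u : rgnat P P') (t : lgnat F G) z :
  coend_map G u (coend_mapr P t z) = coend_mapr P' t (coend_map F u z).
Proof.
apply: (coend_ext (g := coend_map G u \o coend_mapr P t)
  (h := coend_mapr P' t \o coend_map F u)) => m x y.
transitivity (coend_map G u (coend_mapr P t (cpure x y))) => //.
transitivity (coend_mapr P' t (coend_map F u (cpure x y))) => //.
by rewrite coend_maprE !coend_mapE' coend_maprE.
Qed.

Lemma coend_mapr_surj (P : rgmod k) (F G : lgmod A) (t : lgnat F G) :
  (forall m, surj_fun (t m)) -> surj_fun (coend_mapr P t).
Proof.
move=> ts z; have : im (coend_mapr P t) z.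
  apply: coend_ind => m x y; have [y' <-] := ts m y.
  by exists (cpure x y'); rewrite coend_maprE.
by case=> w ->; exists w.
Qed.

Section Middle.
Variables (P : rgmod k) (F G H : lgmod A) (t : lgnat F G) (q : lgnat G H).
Hypothesis qs : forall m, surj_fun (q m).
Hypothesis qt : forall m y, q m y = 0 -> exists x, y = t m x.

Let I := im (coend_mapr P t).
Let lift m (y : H m) : G m := projT1 (cid (qs y)).
Let liftK m (y : H m) : q m (lift y) = y. Proof. exact: (projT2 (cid (qs y))). Qed.
Let b m (x : P m) (y : H m) : quot_mod I := to_quot I (cpure x (lift y)).

Let bE m (x : P m) (y : G m) : b x (q m y) = to_quot I (cpure x y).
Proof.
apply/to_quotP; rewrite -cpureNr -cpureDr.
have [|w ->] := @qt m (lift (q m y) - y); first by apply/eqP; rewrite raddfB subr_eq0; apply/eqP/liftK.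
by exists (cpure x w); rewrite coend_maprE.
Qed.

Let bb : balanced b.
Proof.
split.
- by move=> m x x' y; rewrite /b cpureDl raddfD.
- by move=> m x y y'; rewrite -[y]liftK -[y']liftK -raddfD !bE cpureDr raddfD.
- by move=> m c x y; rewrite /b cpureZl linearZ.
- by move=> m a x y; rewrite -[y]liftK -linearZ !bE cpureZr linearZ.
- by move=> m l f x y; rewrite -[y]liftK -lgn_nat !bE cpure_nat.
Qed.

(** Right exactness. Two lifts of an element along [q] differ by an element of the image of [t], so
    an arbitrary choice of lifts is balanced modulo [I]; the map it induces is a left inverse of the
    one that [q] induces on the quotient by [I]. *)
Lemma coend_mapr_exact z : coend_mapr P q z = 0 -> exists w, z = coend_mapr P t w.
Proof.
move=> qz; suff : to_quot I z = 0 by move/to_quot_eq0.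
suff <- : coend_lift bb (coend_mapr P q z) = to_quot I z by rewrite qz raddf0.
apply: (coend_ext (g := coend_lift bb \o coend_mapr P q) (h := mklin (to_quot_lin I))).
move=> m x y; transitivity (coend_lift bb (coend_mapr P q (cpure x y))) => //.
by rewrite coend_maprE coend_liftE bE.
Qed.
End Middle.

Section Restrict.
Variable M : lmodType A.
(** Restriction of scalars along the structure map of [A]: [cover N] is free over [k], whereas the
    coend takes values in [A]-modules. *)
Definition restr : Type := M.
HB.instance Definition _ := GRing.Zmodule.on restr.
Definition restr_scale (c : k) (x : restr) : restr := c%:A *: (x : M).
Fact restr_scaleA a b x : restr_scale a (restr_scale b x) = restr_scale (a * b) x.
Proof. by rewrite /restr_scale scalerA mulr_algl scalerA. Qed.
Fact restr_scale1 : left_id 1 restr_scale.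
Proof. by move=> x; rewrite /restr_scale !scale1r. Qed.
Fact restr_scaleDr : right_distributive restr_scale +%R.
Proof. by move=> a x y; apply: scalerDr. Qed.
Fact restr_scaleDl x : {morph restr_scale^~ x : a b / a + b}.
Proof. by move=> a b; rewrite /restr_scale !scalerDl. Qed.
HB.instance Definition _ := GRing.Zmodule_isLmodule.Build k restr
  restr_scaleA restr_scale1 restr_scaleDr restr_scaleDl.
End Restrict.

(* A projective functor is a retract of [cover], a sum of representables, and
   the coend of a representable functor with [F] is a value of [F]. *)
Section Flat.
Variables (N : rgmod k).

Section Component.
Variables (F : lgmod A) (z0 : {m : nat & N m}).

(** By co-Yoneda, the summand of [cover N] indexed by [z0] contributes one copy of [F (tag z0)]. A
    generator [(x, f)] belongs to the summand of [x]; once the two indices are known to be equal,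
    its contribution is transported to that copy. *)
Definition cover_comp_gen l (g : cover_gen N l) (y : F l) : F (tag z0) :=
  match (Tagged (fun m => N m) (tagged g).1 : {m : nat & N m}) =P z0 with
  | ReflectT e => ecast z (F (tag z)) e (lg_map F (tagged g).2 y)
  | ReflectF _ => 0
  end.

Fact cover_comp_gen_lin l (g : cover_gen N l) : linear (cover_comp_gen g).
Proof.
move=> a x y; rewrite /cover_comp_gen; case: eqP => [e|_].
  by case: _ / e; rewrite /= linearP.
by rewrite scaler0 addr0.
Qed.

Lemma cover_comp_gen_nat l j (f : pmap l j) (g : cover_gen N j) (y : F l) :
  cover_comp_gen (cov (tagged g).1 (pcomp (tagged g).2 f) : cover_gen N l) y =
  cover_comp_gen g (lg_map F f y).
Proof.
case: g => m [x u]; rewrite /cover_comp_gen /=; case: eqP => // e.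
by case: _ / e; rewrite /= lg_comp.
Qed.

Definition cover_comp_fun l (D : cover N l) (y : F l) : F (tag z0) :=
  (@fglift k (restr (F (tag z0))) (cover_gen N l) (fun g => cover_comp_gen g y)
    : {linear {freeg (cover_gen N l) / k} -> restr (F (tag z0))}) D.

Lemma cover_comp_funE l (g : cover_gen N l) (y : F l) :
  cover_comp_fun << g >> y = cover_comp_gen g y.
Proof. exact: (@fglift_gen k _ (restr (F (tag z0)))). Qed.

Fact cover_comp_bal : balanced (fun l (D : cover N l) (y : F l) => cover_comp_fun D y).
Proof.
have Dl l (D D' : cover N l) (y : F l) :
    cover_comp_fun (D + D') y = cover_comp_fun D y + cover_comp_fun D' y.
  exact: (raddfD (@fglift k (restr (F (tag z0))) (cover_gen N l) _)).
have Zl l c (D : cover N l) (y : F l) :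
    cover_comp_fun (c *: D) y = c%:A *: cover_comp_fun D y.
  exact: (@fglift_scalable k (cover_gen N l) (restr (F (tag z0))) (fun g => cover_comp_gen g y) c D).
have ind l (h h' : cover N l -> F (tag z0)) :
    (forall D D', h (D + D') = h D + h D') -> (forall D D', h' (D + D') = h' D + h' D') ->
    (forall c D, h (c *: D) = c%:A *: h D) -> (forall c D, h' (c *: D) = c%:A *: h' D) ->
    (forall g, h << g >> = h' << g >>) -> h =1 h'.
  move=> hD hD' hZ hZ' e.
  have hl : linear (h : cover N l -> restr (F (tag z0))) by move=> c x y; rewrite hD hZ.
  have hl' : linear (h' : cover N l -> restr (F (tag z0))) by move=> c x y; rewrite hD' hZ'.
  exact: (@fglift_ext _ _ _ (mklin hl) (mklin hl')).
split=> //.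
- move=> l D y y'; move: D; apply: ind => // [D D'|c D|g].
  + by rewrite !Dl addrACA.
  + by rewrite !Zl -scalerDr.
  + by rewrite !cover_comp_funE; apply: (raddfD (mklin (cover_comp_gen_lin g))).
- move=> l a D y; move: D; apply: ind => // [D D'|c D|g].
  + by rewrite !Dl scalerDr.
  + by rewrite !Zl !scalerA mulrC.
  + by rewrite !cover_comp_funE; apply: (mklin_scale (cover_comp_gen_lin g)).
- move=> l j f D y; move: D; apply: ind => // [D D'|c D|[m [x u]]].
  + by rewrite raddfD Dl.
  + by rewrite linearZ Zl.
  + have -> : rg_map (cover N) f << cov x u >> = << cov x (pcomp u f) >> :> cover N l.
      exact: cover_mapE.
    by rewrite !cover_comp_funE -cover_comp_gen_nat.
Qed.

Definition cover_comp : {linear coend (cover N) F -> F (tag z0)} :=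
  coend_lift cover_comp_bal.

Lemma cover_compE l (g : cover_gen N l) (y : F l) :
  cover_comp (cpure (<< g >> : cover N l) y) = cover_comp_gen g y.
Proof. by rewrite /cover_comp coend_liftE cover_comp_funE. Qed.
End Component.

Definition cover_inc (F : lgmod A) (z : {m : nat & N m}) (y : F (tag z)) :
  coend (cover N) F := cpure (<< cov (tagged z) (pid (tag z)) >> : cover N (tag z)) y.

Lemma cover_inc0 (F : lgmod A) z : cover_inc (0 : F (tag z)) = 0.
Proof. exact: cpure0r. Qed.

(** A finite support is not canonical here, so the sum is asserted over every duplicate-free list
    that contains some given one; two elements can then be added over a common list. *)
Lemma cover_decomp (F : lgmod A) (w : coend (cover N) F) :
  exists s : seq {m : nat & N m}, forall s', uniq s' -> {subset s <= s'} ->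
    w = \sum_(z <- s') cover_inc (cover_comp F z w).
Proof.
pose Q (w : coend (cover N) F) := exists s : seq {m : nat & N m},
  forall s', uniq s' -> {subset s <= s'} ->
    w = \sum_(z <- s') cover_inc (cover_comp F z w).
have Q0 : Q 0.
  by exists [::] => s' _ _; rewrite big1 // => z _; rewrite raddf0 cover_inc0.
have QD x y : Q x -> Q y -> Q (x + y).
  move=> [s sE] [t tE]; exists (s ++ t) => s' us' ss'.
  transitivity (\sum_(z <- s') cover_inc (cover_comp F z x) +
                \sum_(z <- s') cover_inc (cover_comp F z y)).
    congr (_ + _); [apply: sE|apply: tE] => // z zs; apply: ss';
      by rewrite mem_cat zs ?orbT.
  rewrite -big_split; apply: eq_bigr => z _.
  transitivity (cover_inc (cover_comp F z x + cover_comp F z y)).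
    exact/esym/cpureDr.
  by congr (cover_inc _); apply/esym/(raddfD (cover_comp F z)).
have QZ a x : Q x -> Q (a *: x).
  move=> [s sE]; exists s => s' us' ss'.
  transitivity (a *: \sum_(z <- s') cover_inc (cover_comp F z x)).
    by congr (_ *: _); apply: sE.
  rewrite scaler_sumr; apply: eq_bigr => z _.
  transitivity (cover_inc (a *: cover_comp F z x)); first exact/esym/cpureZr.
  by congr (cover_inc _); apply/esym/(linZZ (cover_comp F z)).
apply: (coend_ind (S := @Submodule _ _ Q Q0 QD QZ)) w => l D y /=.
have -> : D = \sum_(g <- dom (D : {freeg (cover_gen N l) / k}))
    coeff g D *: (<< g >> : cover N l).
  rewrite -[LHS](@freeg_sumE _ _ D); apply: eq_bigr => g _.
  by rewrite -[in LHS](mulr1 (coeff g D)) -freegUZ.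
elim/big_ind: _ => [|D1 D2 q1 q2|g _]; first by rewrite cpure0l.
  by rewrite cpureDl; apply: QD.
rewrite cpureZl; apply: (QZ); case: g => m [x u].
suff: Q (cpure (<< cov x u >> : cover N l) y) by [].
pose z0 : {m : nat & N m} := Tagged (fun m => N m) x.
have e : cpure (<< cov x u >> : cover N l) y = cover_inc (z := z0) (lg_map F u y).
  rewrite /cover_inc -cpure_nat; congr (cpure _ _).
  by rewrite [RHS]cover_mapE pcomp1f.
have cE z : cover_comp F z (cpure (<< cov x u >> : cover N l) y) =
    match z0 =P z with
    | ReflectT e => ecast z (F (tag z)) e (lg_map F u y) | ReflectF _ => 0 end.
  by rewrite cover_compE.
exists [:: z0] => s' us' ss'.
rewrite (bigD1_seq z0) //; last by apply: ss'; rewrite inE.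
rewrite big1; last first.
  move=> z zz0; rewrite cE; case: eqP => [ez|_]; first by rewrite ez eqxx in zz0.
  exact: cover_inc0.
rewrite cE; case: eqP => // ez; rewrite (eq_irrelevance ez erefl) /=.
by rewrite e; apply/esym/addr0.
Qed.

Lemma cover_comp_nat (F G : lgmod A) (t : lgnat F G) z w :
  cover_comp G z (coend_mapr (cover N) t w) = t (tag z) (cover_comp F z w).
Proof.
apply: (coend_ext (g := cover_comp G z \o coend_mapr (cover N) t)
  (h := t (tag z) \o cover_comp F z)) => l D y.
transitivity (cover_comp G z (coend_mapr (cover N) t (cpure D y))) => //.
transitivity (t (tag z) (cover_comp F z (cpure D y))) => //.
rewrite coend_maprE.
have -> : D = \sum_(g <- dom (D : {freeg (cover_gen N l) / k}))
    coeff g D *: (<< g >> : cover N l).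
  rewrite -[LHS](@freeg_sumE _ _ D); apply: eq_bigr => g _.
  by rewrite -[in LHS](mulr1 (coeff g D)) -freegUZ.
elim/big_ind: _ => [|D1 D2 q1 q2|g _]; first by rewrite !cpure0l !lin00.
  by rewrite !cpureDl !linDD q1 q2.
rewrite !cpureZl !linZZ !cover_compE /=; congr (_ *: _).
case: g => m [x u]; rewrite /cover_comp_gen /=; case: eqP => [e|_]; last by rewrite raddf0.
by case: _ / e; rewrite /= lgn_nat.
Qed.

(** The map acts componentwise by [t], so all components of an element of the kernel vanish, and an
    element is the sum of its components. *)
Lemma cover_mapr_inj (F G : lgmod A) (t : lgnat F G) :
  (forall m, injective (t m)) -> injective (coend_mapr (cover N) t).
Proof.
move=> ti w w' e; apply/eqP; rewrite -subr_eq0; apply/eqP.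
set v := w - w'; have tv : coend_mapr (cover N) t v = 0 by rewrite linBB e subrr.
have [s sE] := cover_decomp v.
rewrite (sE (undup s)) ?undup_uniq // => [|z]; last by rewrite mem_undup.
rewrite big1 // => z _; suff -> : cover_comp F z v = 0 by apply: cover_inc0.
by apply: (ti); rewrite -cover_comp_nat tv !lin00.
Qed.
End Flat.

(** Flatness passes to retracts. *)
Lemma coend_mapr_inj (P : rgmod k) (F G : lgmod A) (t : lgnat F G) :
  rg_projective P -> (forall m, injective (t m)) -> injective (coend_mapr P t).
Proof.
move=> pP ti w w' e.
have [i iE] := cover_retract pP.
have ret (H : lgmod A) (z : coend P H) :
    coend_map H (cover_proj P) (coend_map H i z) = z.
  apply: (coend_ext (g := coend_map H (cover_proj P) \o coend_map H i)
    (h := idfun)) => m x y.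
  transitivity (coend_map H (cover_proj P) (coend_map H i (cpure x y))) => //.
  rewrite !coend_mapE'; congr (cpure _ _); exact: (iE m x).
rewrite -(ret _ w) -(ret _ w'); congr (coend_map _ _ _).
by apply: (cover_mapr_inj ti); rewrite -!coend_map_mapr e.
Qed.
End Coends.

(** * Wedges and additivity *)

(* [m + m] is the wedge of two copies of [m], with inclusions winl and winr. *)
Section Wedge.
Variable m : nat.

Fact winl_subproof (i : 'I_m.+1) : (i < (m + m).+1)%N.
Proof. by rewrite ltnS (leq_trans _ (leq_addr m m)) // -ltnS. Qed.
Fact winl0 : Ordinal (winl_subproof ord0) = ord0. Proof. exact/val_inj. Qed.
Definition winl : pmap m (m + m) :=
  @PMap m (m + m) (fun i => Ordinal (winl_subproof i)) winl0.

Fact winr_subproof (i : 'I_m.+1) :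
  ((if val i == 0 then 0 else m + i) < (m + m).+1)%N.
Proof. by case: ifP => // _; rewrite ltnS leq_add2l -ltnS. Qed.
Fact winr0 : Ordinal (winr_subproof ord0) = ord0. Proof. exact/val_inj. Qed.
Definition winr : pmap m (m + m) :=
  @PMap m (m + m) (fun i => Ordinal (winr_subproof i)) winr0.

Lemma wedgeP (j : 'I_(m + m).+1) : (exists i, j = winl i) \/ (exists i, j = winr i).
Proof.
have [jm|mj] := leqP j m.
  by left; exists (Ordinal (jm : j < m.+1)%N); apply/val_inj.
right; have jm : (j - m < m.+1)%N by rewrite ltnS leq_subLR -ltnS.
exists (Ordinal jm); apply/val_inj => /=.
by rewrite subn_eq0 leqNgt mj /= subnKC // ltnW.
Qed.

Definition wcase l (f g : pmap m l) (j : 'I_(m + m).+1) : 'I_l.+1 :=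
  if (j <= m)%N then f (inord j) else g (inord (j - m)).

Fact wcase0 l (f g : pmap m l) : wcase f g ord0 = ord0.
Proof. by rewrite /wcase /= -[RHS](pfun0 f); congr (f _); apply/val_inj; rewrite /= inordK. Qed.
Definition copair l (f g : pmap m l) : pmap (m + m) l := PMap (wcase0 f g).

Lemma copair_winl l (f g : pmap m l) i : copair f g (winl i) = f i.
Proof.
rewrite /= /wcase /= -ltnS ltn_ord; congr (f _); apply/val_inj.
by rewrite /= inordK.
Qed.
Lemma copair_winr l (f g : pmap m l) i : copair f g (winr i) = g i.
Proof.
rewrite /= /wcase /=; case: eqVneq => [i0|i0].
  have -> : i = ord0 by apply/val_inj.
  by rewrite leq0n pfun0 -[RHS](pfun0 f); congr (f _); apply/val_inj; rewrite /= inordK.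
rewrite leqNgt -[m in (m < _)%N]addn0 ltn_add2l lt0n i0 /= addKn.
by congr (g _); apply/val_inj; rewrite /= inordK.
Qed.

Lemma wedge_ext l (f g : pmap (m + m) l) :
  (forall i, f (winl i) = g (winl i)) -> (forall i, f (winr i) = g (winr i)) -> f = g.
Proof. by move=> el er; apply: pmap_eq => j; case: (wedgeP j) => -[i ->]. Qed.

Lemma wedge_pext l (f g : pmap (m + m) l) :
  pcomp f winl = pcomp g winl -> pcomp f winr = pcomp g winr -> f = g.
Proof.
move=> el er; apply: wedge_ext => i.
  exact: (congr1 (fun h : pmap _ _ => h i) el).
exact: (congr1 (fun h : pmap _ _ => h i) er).
Qed.

Definition pnull l : pmap m l := @PMap m l (fun=> ord0) erefl.
Definition wfold : pmap (m + m) m := copair (pid m) (pid m).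
Definition wretl : pmap (m + m) m := copair (pid m) (pnull m).
Definition wretr : pmap (m + m) m := copair (pnull m) (pid m).
End Wedge.

Definition wmap m l (f : pmap m l) : pmap (m + m) (l + l) :=
  copair (pcomp (winl l) f) (pcomp (winr l) f).

Lemma wmap_winl m l (f : pmap m l) : pcomp (wmap f) (winl m) = pcomp (winl l) f.
Proof. by apply: pmap_eq => i; rewrite [LHS]copair_winl. Qed.
Lemma wmap_winr m l (f : pmap m l) : pcomp (wmap f) (winr m) = pcomp (winr l) f.
Proof. by apply: pmap_eq => i; rewrite [LHS]copair_winr. Qed.

Lemma wmap_id m : wmap (pid m) = pid (m + m).
Proof. by apply: wedge_ext => i; rewrite ?copair_winl ?copair_winr. Qed.
Lemma wmap_comp m l j (g : pmap l j) (f : pmap m l) :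
  wmap (pcomp g f) = pcomp (wmap g) (wmap f).
Proof.
by apply: wedge_pext; rewrite -!pcompA ?wmap_winl ?wmap_winr !pcompA
  ?wmap_winl ?wmap_winr -!pcompA.
Qed.

Lemma pnullf l j m (f : pmap l j) : pcomp f (pnull m l) = pnull m j.
Proof. by apply: pmap_eq => i; rewrite /= pfun0. Qed.
Lemma pnullC m l j (f : pmap m l) : pcomp (pnull l j) f = pnull m j.
Proof. exact: pmap_eq. Qed.

Lemma pid_nat m l (f : pmap m l) : pcomp (pid l) f = pcomp f (pid m).
Proof. by rewrite pcomp1f pcompf1. Qed.
Lemma pnull_nat m l (f : pmap m l) : pcomp (pnull l l) f = pcomp f (pnull m m).
Proof. by rewrite pnullC pnullf. Qed.

Section CopairPcomp.
Variables (m l : nat) (f g : pmap m l).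
Lemma pcopair_winl : pcomp (copair f g) (winl m) = f.
Proof. by apply: pmap_eq => i; apply: copair_winl. Qed.
Lemma pcopair_winr : pcomp (copair f g) (winr m) = g.
Proof. by apply: pmap_eq => i; apply: copair_winr. Qed.
End CopairPcomp.

Lemma wcopair_nat m l (f : pmap m l) (u v : forall m, pmap m m) :
  pcomp (u l) f = pcomp f (u m) -> pcomp (v l) f = pcomp f (v m) ->
  pcomp (copair (u l) (v l)) (wmap f) = pcomp f (copair (u m) (v m)).
Proof.
move=> uf vf; apply: wedge_pext; rewrite -!pcompA ?wmap_winl ?wmap_winr pcompA.
  by rewrite !pcopair_winl.
by rewrite !pcopair_winr.
Qed.

Section Doubling.
Variable k : comNzRingType.

Section Dbl.
Variable N : rgmod k.
Fact dbl_id m : rg_map N (wmap (pid m)) =1 id.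
Proof. by move=> x; rewrite wmap_id rg_id. Qed.
Fact dbl_comp m l j (g : pmap l j) (f : pmap m l) :
  rg_map N (wmap (pcomp g f)) =1 rg_map N (wmap f) \o rg_map N (wmap g).
Proof. by move=> x; rewrite wmap_comp rg_comp. Qed.
Definition dbl : rgmod k :=
  @RGMod k (fun m => N (m + m)%N) (fun m l f => rg_map N (wmap f)) dbl_id dbl_comp.

Section Pull.
Variables (u v : forall m, pmap m m).
Hypothesis uN : forall m l (f : pmap m l), pcomp (u l) f = pcomp f (u m).
Hypothesis vN : forall m l (f : pmap m l), pcomp (v l) f = pcomp f (v m).
Fact wpull_nat m l (f : pmap m l) x :
  rg_map N (copair (u m) (v m)) (rg_map N f x) =
  rg_map dbl f (rg_map N (copair (u l) (v l)) x).
Proof.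
transitivity (rg_map N (pcomp f (copair (u m) (v m))) x); first by rewrite rg_comp.
by rewrite -wcopair_nat // rg_comp.
Qed.
Definition wpull : rgnat N dbl :=
  @RGNat k N dbl (fun m => rg_map N (copair (u m) (v m))) wpull_nat.
End Pull.

Definition npull : rgnat N dbl := wpull pid_nat pid_nat.
Definition lpull : rgnat N dbl := wpull pid_nat pnull_nat.
Definition rpull : rgnat N dbl := wpull pnull_nat pid_nat.
(** The deviation from additivity: on an additive contravariant functor, pulling back along the fold
    is the sum of the pullbacks along the two retractions. *)
Definition wdefect : rgnat N dbl := rgsubn (rgsubn npull lpull) rpull.
Lemma wdefectE m (x : N m) : wdefect m x =
  rg_map N (wfold m) x - rg_map N (wretl m) x - rg_map N (wretr m) x.
Proof. by []. Qed.
End Dbl.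

Lemma wdefect_nat (N N' : rgmod k) (u : rgnat N N') m (x : N m) :
  u (m + m)%N (wdefect N m x) = wdefect N' m (u m x).
Proof. by rewrite !wdefectE !linBB !rgn_nat. Qed.

Definition dbln (N N' : rgmod k) (u : rgnat N N') : rgnat (dbl N) (dbl N') :=
  @RGNat k (dbl N) (dbl N') (fun m => u (m + m)%N) (fun m l f x => rgn_nat u (wmap f) x).

(** At each point of the wedge one retraction gives the base point, where a pointed function
    vanishes, and the other agrees with the fold. *)
Lemma t_wdefect m (x : t_mod k m) : wdefect (t_mod k) m x = 0.
Proof.
have x0 : val x ord0 = 0 by have := submodP x.
rewrite wdefectE; apply/val_inj/ffunP => j.
have -> : val (rg_map (t_mod k) (wfold m) x - rg_map (t_mod k) (wretl m) x -
    rg_map (t_mod k) (wretr m) x) j =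
    val x (wfold m j) - val x (wretl m j) - val x (wretr m j).
  by rewrite !raddfB /= !ffunE.
rewrite raddf0 ffunE; case: (wedgeP j) => -[i ->].
  by rewrite !copair_winl /= x0 subrr subr0.
by rewrite !copair_winr /= x0 subr0 subrr.
Qed.

Section Homotopy.
Variable P : projective_resolution (t_mod k).

Lemma res_dd n m (x : P n.+2 m) : res_d P n m (res_d P n.+1 m x) = 0.
Proof. by apply/res_exact; exists x. Qed.

(** Since [dbl P] is exact, its values being values of [P], the usual construction of a
    null-homotopy applies: [wdefect] is a chain map between the complexes that covers the zero map
    of [t], and its source is projective. *)
Lemma wdefect_homotopy0 : exists h : rgnat (P 0) (dbl (P 1)),
  forall m x, res_d P 0 (m + m) (h m x) = wdefect (P 0) m x.
Proof.
apply: (@rg_projective_lift _ (P 0) (dbl (P 1)) (dbl (P 0)) (dbln (res_d P 0))).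
  exact: res_proj.
by move=> m x; apply/res_exact0; rewrite wdefect_nat t_wdefect.
Qed.

(** The hypothesis is weaker than the homotopy identity in degree n and is what the next degree
    requires: it makes [wdefect - h d] a cycle. The new [h'] satisfies it again because
    [d d = 0]. *)
Lemma wdefect_homotopy_step n (h : rgnat (P n) (dbl (P n.+1))) :
  (forall m x, res_d P n (m + m) (h m (res_d P n m x)) = wdefect (P n) m (res_d P n m x)) ->
  exists h' : rgnat (P n.+1) (dbl (P n.+2)), forall m x,
    res_d P n.+1 (m + m) (h' m x) = wdefect (P n.+1) m x - h m (res_d P n m x).
Proof.
move=> hE.
have hdn m l (f : pmap m l) x :
   (h m \o res_d P n m) (rg_map (P n.+1) f x) =
   rg_map (dbl (P n.+1)) f ((h l \o res_d P n l) x) by rewrite /= !rgn_nat.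
pose hd : rgnat (P n.+1) (dbl (P n.+1)) := @RGNat k _ _ (fun m => h m \o res_d P n m) hdn.
apply: (@rg_projective_lift _ (P n.+1) (dbl (P n.+2)) (dbl (P n.+1))
  (dbln (res_d P n.+1)) (rgsubn (wdefect _) hd)); first exact: res_proj.
move=> m x; apply/res_exact; rewrite [X in res_d _ _ _ X]/=.
by rewrite linBB wdefect_nat hE subrr.
Qed.

Lemma wdefect_homotopy_ex n : exists h : rgnat (P n) (dbl (P n.+1)), forall m x,
  res_d P n (m + m) (h m (res_d P n m x)) = wdefect (P n) m (res_d P n m x).
Proof.
elim: n => [|n [h hE]]; first by have [h hE] := wdefect_homotopy0; exists h.
have [h' h'E] := wdefect_homotopy_step hE; exists h' => m x.
by rewrite h'E res_dd lin00 subr0.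
Qed.

Lemma wdefect_homotopy n : exists (h : rgnat (P n) (dbl (P n.+1)))
    (h' : rgnat (P n.+1) (dbl (P n.+2))), forall m x,
  res_d P n.+1 (m + m) (h' m x) = wdefect (P n.+1) m x - h m (res_d P n m x).
Proof.
have [h /wdefect_homotopy_step[h' h'E]] := wdefect_homotopy_ex n.
by exists h, h'.
Qed.
End Homotopy.

Variable A : comAlgType k.

Section Twist.
Variables (F G : lgmod A) (s : forall m, {linear F m -> G (m + m)%N}).
Hypothesis s_nat : forall m l (f : pmap m l) y,
  s l (lg_map F f y) = lg_map G (wmap f) (s m y).

Section Act.
Variables (N N' : rgmod k) (u : rgnat N (dbl N')).
Fact wact_bal : balanced (fun m (x : N m) (y : F m) =>
  cpure (P := N') (F := G) (u m x : N' (m + m)%N) (s m y)).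
Proof.
split=> *; rewrite ?linDD ?linZZ ?cpureDl ?cpureDr ?cpureZl ?cpureZr //.
rewrite rgn_nat s_nat; exact: cpure_nat.
Qed.
Definition wact : {linear coend N F -> coend N' G} := coend_lift wact_bal.
Lemma wactE m (x : N m) (y : F m) :
  wact (cpure x y) = cpure (P := N') (F := G) (u m x : N' (m + m)%N) (s m y).
Proof. exact: coend_liftE. Qed.
End Act.

Variables (a b c : lgnat F G).
Hypothesis aE : forall m y, a m y = lg_map G (wfold m) (s m y).
Hypothesis bE : forall m y, b m y = lg_map G (wretl m) (s m y).
Hypothesis cE : forall m y, c m y = lg_map G (wretr m) (s m y).

(** The coend relation moves the pullbacks along the fold and the two retractions from [N] to
    [G]. *)
Lemma wact_wdefect (N : rgmod k) z : wact (wdefect N) z =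
  coend_mapr N a z - coend_mapr N b z - coend_mapr N c z.
Proof.
apply: (coend_ext (g := wact (wdefect N))
  (h := coend_mapr N a \- coend_mapr N b \- coend_mapr N c)) => m x y.
rewrite wactE wdefectE.
transitivity (coend_mapr N a (cpure x y) - coend_mapr N b (cpure x y)
   - coend_mapr N c (cpure x y)) => //.
by rewrite !coend_maprE aE bE cE !cpureDl !cpureNl !cpure_nat.
Qed.

Variable P : projective_resolution (t_mod k).

(* Since [t] is additive, the map (fold)^* - (retl)^* - (retr)^* from the resolution P to
   P o dbl lifts the zero map, hence is null-homotopic. *)
Theorem wedge_additive n z : cycles (coend_complex P F) n z ->
  boundaries (coend_complex P G) n
    (coend_mapr (P n) a z - coend_mapr (P n) b z - coend_mapr (P n) c z).
Proof.
rewrite -wact_wdefect; case: n z => [|n] z zc.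
  have [h hE] := wdefect_homotopy0 P; exists (wact h z).
  apply: (coend_ext (g := wact (wdefect (P 0)))
    (h := coend_map G (res_d P 0) \o wact h)) => m x y.
  transitivity (coend_map G (res_d P 0) (wact h (cpure x y))) => //.
  by rewrite !wactE coend_mapE' hE.
have [h [h' hE]] := wdefect_homotopy P n; exists (wact h' z).
have e w : coend_map G (res_d P n.+1) (wact h' w) =
    wact (wdefect (P n.+1)) w - wact h (coend_map F (res_d P n) w).
  apply: (coend_ext (g := coend_map G (res_d P n.+1) \o wact h')
    (h := wact (wdefect (P n.+1)) \- (wact h \o coend_map F (res_d P n)))) => m x y.
  transitivity (coend_map G (res_d P n.+1) (wact h' (cpure x y))) => //.
  transitivity (wact (wdefect (P n.+1)) (cpure x y) -
    wact h (coend_map F (res_d P n) (cpure x y))) => //.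
  by rewrite coend_mapE' !wactE coend_mapE' hE cpureDl cpureNl.
apply: etrans; last exact/esym/e.
have -> : coend_map F (res_d P n) z = 0 by exact: zc.
by rewrite lin00 subr0.
Qed.
End Twist.
End Doubling.

(** * Acyclic functors *)

Section Complex.
Variables (k : comNzRingType) (A : comAlgType k).
Variable P : projective_resolution (t_mod k).
Local Notation cx F := (coend_complex (A := A) P F).

Section ChainMap.
Variables (F G : lgmod A) (t : lgnat F G).
Definition cmap n : {linear cx F n -> cx G n} := coend_mapr (P n) t.

Lemma cmap_d n z : cc_d (cx G) n (cmap n.+1 z) = cmap n (cc_d (cx F) n z).
Proof. exact: coend_map_mapr. Qed.
Lemma cmap_cycles n z : cycles (cx F) n z -> cycles (cx G) n (cmap n z).
Proof.
case: n z => // n z zc; apply: etrans; first exact: cmap_d.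
by rewrite zc lin00.
Qed.
Lemma cmap_boundaries n z : boundaries (cx F) n z -> boundaries (cx G) n (cmap n z).
Proof. by move=> [w ->]; exists (cmap n.+1 w); rewrite cmap_d. Qed.
End ChainMap.

Lemma cmap_eq0 (F G : lgmod A) (t : lgnat F G) n z :
  (forall m y, t m y = 0) -> cmap t n z = 0.
Proof.
move=> t0; apply: (coend_ext (g := cmap t n) (h := \0)) => m x y.
by rewrite [LHS]coend_maprE t0 cpure0r.
Qed.

Definition acyclic (F : lgmod A) : Prop :=
  forall n z, cycles (cx F) n z -> boundaries (cx F) n z.

Lemma acyclic0 (F : lgmod A) : (forall m (y : F m), y = 0) -> acyclic F.
Proof.
move=> F0 n z _; apply: coend_ind => m x y; rewrite [y]F0 cpure0r; exact: sm0.
Qed.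

Lemma wedge_null (F G : lgmod A) (s : forall m, {linear F m -> G (m + m)%N})
    (a : lgnat F G) :
  (forall m l (f : pmap m l) y, s l (lg_map F f y) = lg_map G (wmap f) (s m y)) ->
  (forall m y, a m y = lg_map G (wfold m) (s m y)) ->
  (forall m y, lg_map G (wretl m) (s m y) = 0) ->
  (forall m y, lg_map G (wretr m) (s m y) = 0) ->
  forall n z, cycles (cx F) n z -> boundaries (cx G) n (cmap a n z).
Proof.
move=> sn aE s1 s2 n z zc.
have on m l (f : pmap m l) (x : F m) :
    (\0 : {linear F l -> G l}) (lg_map F f x) = lg_map G f ((\0 : {linear F m -> G m}) x).
  by rewrite /= lin00.
pose o := LGNat on.
have := @wedge_additive k A F G s sn a o o aE (fun m y => esym (s1 m y))
  (fun m y => esym (s2 m y)) P n z zc.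
have -> : coend_mapr (P n) o z = 0 by exact: (@cmap_eq0 _ _ o).
by rewrite !subr0.
Qed.

Section Unital.
Variable X : lgmod A.
Hypothesis X0 : forall x : X 0, x = 0.

(* The maps [act x] are thought of as multiplications by elements of an
   augmentation ideal; additivity in [x] is not required. *)
Record unital_action (F : lgmod A) (act : forall m, X m -> {linear F m -> F m}) : Prop :=
  UnitalAction {
  ua_nat : forall m l (f : pmap m l) x y,
    lg_map F f (act m x y) = act l (lg_map X f x) (lg_map F f y);
  ua_0 : forall m y, act m 0 y = 0;
  ua_C : forall m x x' y, act m x (act m x' y) = act m x' (act m x y);
  ua_unit : forall m (s : seq (F m)), exists x, forall y, y \in s -> act m x y = y }.

Lemma unital_reduced F act : @unital_action F act -> forall y : F 0, y = 0.
Proof.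
move=> ua y; have [x xy] := ua_unit ua [:: y].
by rewrite -(xy y) ?inE // [x]X0 ua_0.
Qed.

Lemma lg_null (F : lgmod A) m l (y : F m) : (forall y : F 0, y = 0) ->
  lg_map F (pnull m l) y = 0.
Proof.
move=> F0; have -> : pnull m l = pcomp (pnull 0 l) (pnull m 0) by apply: pmap_eq.
by rewrite lg_comp /= [lg_map F _ y]F0 lin00.
Qed.

Section Smash.
Variables (F : lgmod A) (act : forall m, X m -> {linear F m -> F m}).
Hypothesis ua : unital_action act.

(** The quotient below is additive in neither variable: a linear map out of it is any function that
    vanishes at [y = 0]. The pairs [(x, 0)] are killed so that the action on the second factor
    satisfies [ua_0] again. *)
Inductive smash_rel m : {freeg (X m * F m) / A} -> Prop :=
| SmashRel x : smash_rel << (x, 0) >>.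
Definition smash_ob m : lmodType A := pres (@smash_rel m).
Definition smash m (x : X m) (y : F m) : smash_ob m := gen (@smash_rel m) (x, y).
Lemma smash0 m (x : X m) : smash x 0 = 0.
Proof. exact: gen_rel (SmashRel x). Qed.

Section SmashHom.
Variables (m : nat) (M : lmodType A) (g : X m -> F m -> M).
Hypothesis g0 : forall x, g x 0 = 0.
Fact smash_hom_rel r : @smash_rel m r -> fglift (fun z => g z.1 z.2) r = 0.
Proof. by case=> x; rewrite liftU scale1r. Qed.
Definition smash_hom : {linear smash_ob m -> M} :=
  pres_hom (fun z => g z.1 z.2) smash_hom_rel.
Lemma smash_homE x y : smash_hom (smash x y) = g x y.
Proof. exact: pres_hom_gen. Qed.
End SmashHom.
Arguments smash_hom : simpl never.

Lemma smash_ext m (M : lmodType A) (g h : {linear smash_ob m -> M}) :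
  (forall x y, g (smash x y) = h (smash x y)) -> g =1 h.
Proof. by move=> gh; apply: pres_hom_ext => -[x y]; apply: gh. Qed.

Section SmashMap.
Variables (m l : nat) (f : pmap m l).
Fact smash_map_subproof (x : X m) : smash (lg_map X f x) (lg_map F f 0) = 0.
Proof. by rewrite lin00 smash0. Qed.
Definition smash_map : {linear smash_ob m -> smash_ob l} :=
  smash_hom (g := fun x y => smash (lg_map X f x) (lg_map F f y)) smash_map_subproof.
Lemma smash_mapE x y : smash_map (smash x y) = smash (lg_map X f x) (lg_map F f y).
Proof. exact: smash_homE. Qed.
End SmashMap.
Fact smash_id m : smash_map (pid m) =1 id.
Proof.
by apply: (smash_ext (h := idfun)) => x y; rewrite smash_mapE !lg_id.
Qed.
Fact smash_comp m l j (g : pmap l j) (f : pmap m l) :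
  smash_map (pcomp g f) =1 smash_map g \o smash_map f.
Proof.
apply: (smash_ext (h := smash_map g \o smash_map f)) => x y.
transitivity (smash_map g (smash_map f (smash x y))) => //.
by rewrite !smash_mapE !lg_comp.
Qed.
Definition smash_mod : lgmod A := @LGMod A smash_ob smash_map smash_id smash_comp.

Definition smash_act_fun m : {linear smash_ob m -> F m} :=
  smash_hom (g := fun x y => act x y) (fun x => lin00 (act x)).
Lemma smash_act_funE m (x : X m) (y : F m) : smash_act_fun m (smash x y) = act x y.
Proof. exact: smash_homE. Qed.
Fact smash_act_nat m l (f : pmap m l) z :
  smash_act_fun l (lg_map smash_mod f z) = lg_map F f (smash_act_fun m z).
Proof.
apply: (smash_ext (g := smash_act_fun l \o smash_map f)
  (h := lg_map F f \o smash_act_fun m)) => x y.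
transitivity (smash_act_fun l (smash_map f (smash x y))) => //.
transitivity (lg_map F f (smash_act_fun m (smash x y))) => //.
by rewrite smash_mapE !smash_act_funE ua_nat.
Qed.
Definition smash_act : lgnat smash_mod F := LGNat smash_act_nat.
Lemma smash_actE m (x : X m) (y : F m) : smash_act m (smash x y) = act x y.
Proof. exact: smash_act_funE. Qed.

Lemma smash_act_surj m : surj_fun (smash_act m).
Proof.
move=> y; have [x xy] := ua_unit ua [:: y]; exists (smash x y).
by rewrite smash_actE xy ?inE.
Qed.

Fact smash_wedge_subproof m (x : X m) :
  act (lg_map X (winl m) x) (lg_map F (winr m) 0) = 0.
Proof. by rewrite !lin00. Qed.
Definition smash_wedge m : {linear smash_mod m -> F (m + m)%N} :=
  smash_hom (g := fun x y => act (lg_map X (winl m) x) (lg_map F (winr m) y))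
    (@smash_wedge_subproof m).
Lemma smash_wedgeE m (x : X m) (y : F m) : smash_wedge m (smash x y) =
  act (lg_map X (winl m) x) (lg_map F (winr m) y).
Proof. exact: smash_homE. Qed.

Lemma smash_wedge_case m (u v : pmap m m) (x : X m) (y : F m) :
  lg_map F (copair u v) (smash_wedge m (smash x y)) = act (lg_map X u x) (lg_map F v y).
Proof.
rewrite smash_wedgeE ua_nat //.
rewrite -[lg_map X _ _]/((lg_map X (copair u v) \o lg_map X (winl m)) x).
rewrite -[lg_map F _ _]/((lg_map F (copair u v) \o lg_map F (winr m)) y).
by rewrite -lg_comp -[in X in act _ X]lg_comp pcopair_winl pcopair_winr.
Qed.

(** With [x] on the left copy and [y] on the right one, the fold recovers the action, while each
    retraction sends one of the two factors through the value at [0], which is zero. *)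
Lemma smash_act_null n z : cycles (cx smash_mod) n z ->
  boundaries (cx F) n (cmap smash_act n z).
Proof.
have F0 := unital_reduced ua.
apply: (@wedge_null _ _ smash_wedge) => m.
- move=> l f z'; apply: (smash_ext (g := smash_wedge l \o smash_map f)
    (h := lg_map F (wmap f) \o smash_wedge m)) z' => x y.
  transitivity (smash_wedge l (smash_map f (smash x y))) => //.
  transitivity (lg_map F (wmap f) (smash_wedge m (smash x y))) => //.
  rewrite smash_mapE !smash_wedgeE ua_nat //; congr (act _ _).
    by rewrite -[LHS]/((lg_map X _ \o lg_map X _) x) -[RHS]/((lg_map X _ \o lg_map X _) x)
      -!lg_comp wmap_winl.
  by rewrite -[LHS]/((lg_map F _ \o lg_map F _) y) -[RHS]/((lg_map F _ \o lg_map F _) y)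
    -!lg_comp wmap_winr.
- move=> z'; apply: (smash_ext (g := smash_act m)
    (h := lg_map F (wfold m) \o smash_wedge m)) z' => x y.
  transitivity (lg_map F (wfold m) (smash_wedge m (smash x y))) => //.
  by rewrite smash_wedge_case smash_actE !lg_id.
- move=> z'; apply: (smash_ext (g := lg_map F (wretl m) \o smash_wedge m)
    (h := \0)) z' => x y.
  transitivity (lg_map F (wretl m) (smash_wedge m (smash x y))) => //.
  by rewrite smash_wedge_case (lg_null _ _ F0) lin00.
- move=> z'; apply: (smash_ext (g := lg_map F (wretr m) \o smash_wedge m)
    (h := \0)) z' => x y.
  transitivity (lg_map F (wretr m) (smash_wedge m (smash x y))) => //.
  by rewrite smash_wedge_case (lg_null _ _ X0) ua_0.
Qed.

Fact smash_actr_subproof m (x x' : X m) : smash x' (act x 0) = 0.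
Proof. by rewrite lin00 smash0. Qed.
Definition smash_actr m (x : X m) : {linear smash_mod m -> smash_mod m} :=
  smash_hom (g := fun x' y => smash x' (act x y)) (smash_actr_subproof x).
Lemma smash_actrE m (x x' : X m) (y : F m) :
  smash_actr x (smash x' y) = smash x' (act x y).
Proof. exact: smash_homE. Qed.

(** Commutativity of the action enters here; it makes the kernel of the action map stable under
    [smash_actr]. *)
Lemma smash_act_actr m (x : X m) z : smash_act m (smash_actr x z) = act x (smash_act m z).
Proof.
apply: (smash_ext (g := smash_act m \o smash_actr x) (h := act x \o smash_act m)) => x' y.
transitivity (smash_act m (smash_actr x (smash x' y))) => //.
transitivity (act x (smash_act m (smash x' y))) => //.
by rewrite smash_actrE !smash_actE ua_C.
Qed.

(** Only finitely many elements of [F m] occur in [z], and whatever fixes them fixes [z]. This is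
    how local units pass from [F] to the smash product and to the kernel of the action. *)
Lemma smash_support m (z : smash_mod m) : exists s : seq (F m), forall x : X m,
  (forall y, y \in s -> act x y = y) -> smash_actr x z = z.
Proof.
pose Q (z : smash_mod m) := exists s : seq (F m), forall x : X m,
  (forall y, y \in s -> act x y = y) -> smash_actr x z = z.
have Q0 : Q 0 by exists [::] => x _; rewrite lin00.
have QD z1 z2 : Q z1 -> Q z2 -> Q (z1 + z2).
  move=> [s1 s1E] [s2 s2E]; exists (s1 ++ s2) => x xs.
  by rewrite linDD s1E ?s2E // => y ys; apply: xs; rewrite mem_cat ys ?orbT.
have QZ a z1 : Q z1 -> Q (a *: z1).
  by move=> [s sE]; exists s => x xs; rewrite linZZ sE.
apply: (pres_ind (S := @Submodule _ _ Q Q0 QD QZ)) z => -[x y].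
exists [:: y] => x' xs; suff: smash_actr x' (smash x y) = smash x y by [].
by rewrite smash_actrE xs // inE.
Qed.

Lemma smash_actr_unital : unital_action (F := smash_mod) smash_actr.
Proof.
split.
- move=> m l f x z; apply: (smash_ext (g := smash_map f \o smash_actr x)
    (h := smash_actr (lg_map X f x) \o smash_map f)) z => x' y.
  transitivity (smash_map f (smash_actr x (smash x' y))) => //.
  transitivity (smash_actr (lg_map X f x) (smash_map f (smash x' y))) => //.
  by rewrite smash_mapE !smash_actrE smash_mapE ua_nat.
- move=> m z; apply: (smash_ext (g := smash_actr 0) (h := \0)) z => x y.
  by rewrite smash_actrE ua_0 // smash0.
- move=> m x x' z; apply: (smash_ext (g := smash_actr x \o smash_actr x')
    (h := smash_actr x' \o smash_actr x)) z => x0 y.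
  transitivity (smash_actr x (smash_actr x' (smash x0 y))) => //.
  transitivity (smash_actr x' (smash_actr x (smash x0 y))) => //.
  by rewrite !smash_actrE ua_C.
- move=> m s; have [t tE] : exists t : seq (F m), forall x : X m,
      (forall y, y \in t -> act x y = y) -> forall z, z \in s -> smash_actr x z = z.
    elim: s => [|z s [t tE]]; first by exists [::].
    have [t' t'E] := smash_support z; exists (t' ++ t) => x xt z'.
    rewrite inE => /predU1P[->|zs].
      by apply: t'E => y yt; apply: xt; rewrite mem_cat yt.
    by apply: tE zs => y yt; apply: xt; rewrite mem_cat yt orbT.
  by have [x xt] := ua_unit ua t; exists x; apply: tE.
Qed.

Local Notation K := (lg_kernel smash_act).
Fact smash_ker_subproof m (x : X m) (z : K m) :
  ker (smash_act m) (smash_actr x (val z)).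
Proof.
apply: etrans (smash_act_actr x (val z)) _.
have -> : smash_act m (val z) = 0 by exact: submodP z.
exact: lin00.
Qed.
Definition smash_ker_act m (x : X m) : {linear K m -> K m} :=
  corestrict (f := smash_actr x \o sm_incl (ker (smash_act m))) (smash_ker_subproof x).

Lemma smash_ker_unital : unital_action (F := K) smash_ker_act.
Proof.
have [aN a0 aC aU] := smash_actr_unital; split.
- by move=> m l f x y; apply/val_inj; apply: aN.
- by move=> m y; apply/val_inj; apply: a0.
- by move=> m x x' y; apply/val_inj; apply: aC.
- move=> m s; have [x xs] := aU m (map val s); exists x => y ys.
  by apply/val_inj; apply: xs; apply: map_f.
Qed.
End Smash.

Lemma lg_kernel_exact (F G : lgmod A) (t : lgnat F G) m y :
  t m y = 0 -> exists x, y = lg_kernel_incl t m x.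
Proof. by move=> ty; exists (to_submod (ty : ker (t m) y)). Qed.

(* The action map from the smash product to [F] factors through the wedge, so it vanishes
   in homology by [wedge_null]; it is onto, and its kernel is again unital, which gives
   the induction on the degree. *)
Theorem unital_acyclic (F : lgmod A) act : @unital_action F act -> acyclic F.
Proof.
move=> ua n; elim: n F act ua => [|n IH] F act ua z zc;
  have [w wz] := coend_mapr_surj (P := P _) (smash_act_surj ua) z.
  by rewrite -wz; apply: (smash_act_null ua (n := 0)).
pose K := lg_kernel (smash_act ua); pose i := lg_kernel_incl (smash_act ua).
have dw : cmap (smash_act ua) n (cc_d (cx _) n w) = 0.
  by rewrite -cmap_d /cmap wz; exact: zc.
have [v vE] := coend_mapr_exact (smash_act_surj ua)
  (@lg_kernel_exact _ _ (smash_act ua)) dw.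
have vc : cycles (cx K) n v.
  case: n IH z zc w wz dw v vE => // n IH z zc w wz dw v vE.
  apply: (coend_mapr_inj (P := P n) (t := i)); first exact: res_proj.
    exact: lg_incl_inj.
  rewrite lin00 -[LHS]/(cmap i n (cc_d (cx K) n v)) -cmap_d.
  by rewrite -[cmap i _ v]vE cc_dd.
have [u uE] := IH K _ (smash_ker_unital ua) v vc.
(* The lift [w] of [z] is corrected to a cycle by [u], which comes from the kernel of the action and
   hence does not change the image [z]. *)
have wuc : cycles (cx _) n.+1 (w - cmap i n.+1 u).
  suff e : cc_d (cx (smash_mod F)) n (w - cmap i n.+1 u) = 0 by exact: e.
  rewrite linBB; apply/eqP; rewrite subr_eq0; apply/eqP.
  by apply: etrans vE _; rewrite uE; apply/esym/cmap_d.
have := smash_act_null ua wuc; rewrite linBB /cmap wz.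
have -> : coend_mapr (P n.+1) (smash_act ua) (coend_mapr (P n.+1) i u) = 0.
  apply: (coend_ext (g := coend_mapr (P n.+1) (smash_act ua) \o coend_mapr (P n.+1) i)
    (h := \0)) => m x y.
  transitivity (coend_mapr (P n.+1) (smash_act ua) (coend_mapr (P n.+1) i (cpure x y))) => //.
  rewrite !coend_maprE; have -> : smash_act ua m (i m y) = 0 by exact: submodP y.
  exact: cpure0r.
by rewrite subr0.
Qed.
End Unital.
End Complex.

Section Criteria.
Variables (k : comNzRingType) (A : comAlgType k).
Variable P : projective_resolution (t_mod k).
Local Notation cx F := (coend_complex (A := A) P F).

Definition lg_idn (F : lgmod A) : lgnat F F :=
  @LGNat _ F F (fun m => idfun : {linear F m -> F m}) (fun m l f x => erefl).

Lemma cmap_id (F : lgmod A) n z : cmap P (lg_idn F) n z = z.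
Proof.
apply: (coend_ext (g := cmap P (lg_idn F) n) (h := idfun)) => m x y.
by rewrite [LHS]coend_maprE.
Qed.

(** After the left inclusion, the fold and the left retraction are the identity, and the right
    retraction is a null map, which acts as the identity by hypothesis. Additivity then says that z
    - z - z = -z is a boundary. *)
Lemma constant_acyclic (F : lgmod A) :
  (forall m y, lg_map F (pnull m m) y = y) -> acyclic P F.
Proof.
move=> Fc n z zc.
have cl m (u v : pmap m m) y :
    lg_map F (copair u v) (lg_map F (winl m) y) = lg_map F u y.
  by rewrite -[LHS]/((lg_map F _ \o lg_map F _) y) -lg_comp pcopair_winl.
have := @wedge_additive k A F F (fun m => lg_map F (winl m)) _
  (lg_idn F) (lg_idn F) (lg_idn F) _ _ _ P n z zc.
rewrite -/(cmap P (lg_idn F) n z) cmap_id subrr sub0r => bz.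
rewrite -[z]opprK; apply: smN; apply: bz.
- move=> m l f y; rewrite -[LHS]/((lg_map F _ \o lg_map F _) y).
  by rewrite -[RHS]/((lg_map F _ \o lg_map F _) y) -!lg_comp wmap_winl.
- by move=> m y; rewrite [RHS]cl lg_id.
- by move=> m y; rewrite [RHS]cl lg_id.
- by move=> m y; rewrite [RHS]cl Fc.
Qed.

Section Halving.
Variables (F : lgmod A) (s : forall m, {linear F m -> F (m + m)%N}) (h : lgnat F F).
Hypothesis s_nat : forall m l (f : pmap m l) y,
  s l (lg_map F f y) = lg_map F (wmap f) (s m y).
Hypothesis s_fold : forall m y, lg_map F (wfold m) (s m y) = y.
Hypothesis s_retl : forall m y, lg_map F (wretl m) (s m y) = h m y.
Hypothesis s_retr : forall m y, lg_map F (wretr m) (s m y) = h m y.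
Hypothesis inj : forall m (y : F m), y - h m y - h m y = 0 -> y = 0.
Hypothesis surj : forall m (y : F m), exists x, y = x - h m x - h m x.

Let d m : {linear F m -> F m} := (idfun \- h m) \- h m.
Let g m (y : F m) : F m := projT1 (cid (surj y)).
Let gE m (y : F m) : d m (g y) = y.
Proof. exact/esym/(projT2 (cid (surj y))). Qed.
Let dI m : injective (d m).
Proof.
move=> x y e; apply/eqP; rewrite -subr_eq0; apply/eqP/inj.
by rewrite -[LHS]/(d m (x - y)) linBB e subrr.
Qed.
Let g_lin m : linear (@g m).
Proof. by move=> a x y; apply: dI; rewrite linDD linZZ !gE. Qed.
Let d_nat m l (f : pmap m l) x : d l (lg_map F f x) = lg_map F f (d m x).
Proof.
transitivity (lg_map F f x - h l (lg_map F f x) - h l (lg_map F f x)) => //.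
by rewrite lgn_nat -!linBB.
Qed.
Let g_nat m l (f : pmap m l) x : mklin (@g_lin l) (lg_map F f x) =
  lg_map F f (mklin (@g_lin m) x).
Proof. by apply: dI; rewrite mklinE gE d_nat mklinE gE. Qed.
Let gn : lgnat F F := LGNat g_nat.
Let dn : lgnat F F := LGNat d_nat.

(** By additivity 1 - 2h sends every cycle to a boundary. Applied to the image of [z] under the
    inverse [gn] of 1 - 2h, this gives [z] itself. *)
Lemma halving_acyclic : acyclic P F.
Proof.
move=> n z zc; have gc := cmap_cycles gn zc.
have := @wedge_additive k A F F s s_nat (lg_idn F) h h
  (fun m y => esym (s_fold y)) (fun m y => esym (s_retl y)) (fun m y => esym (s_retr y)) P n _ gc.
suff -> : coend_mapr (P n) (lg_idn F) (cmap P gn n z) - coend_mapr (P n) h (cmap P gn n z)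
  - coend_mapr (P n) h (cmap P gn n z) = z by [].
apply: (coend_ext (g := ((coend_mapr (P n) (lg_idn F) \- coend_mapr (P n) h) \-
  coend_mapr (P n) h) \o cmap P gn n) (h := idfun)) => m x y.
transitivity (coend_mapr (P n) (lg_idn F) (coend_mapr (P n) gn (cpure x y)) -
  coend_mapr (P n) h (coend_mapr (P n) gn (cpure x y)) -
  coend_mapr (P n) h (coend_mapr (P n) gn (cpure x y))) => //.
rewrite !coend_maprE -!cpureNr -!cpureDr; congr (cpure _ _); exact: gE.
Qed.
End Halving.

Section Cokernel.
Variables (F G : lgmod A) (t : lgnat F G).
Hypothesis t_inj : forall m, injective (t m).
Hypothesis ac : acyclic P (lg_coker t).
Local Notation q := (lg_coker_proj t).

Let qs m : surj_fun (q m). Proof. exact: lg_proj_surj. Qed.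
Let qt m y : q m y = 0 -> exists x, y = t m x.
Proof. by move/(lg_proj_eq0 (@lg_im_closed _ _ _ t)) => [x ->]; exists x. Qed.
Let qtE n v : cmap P q n (cmap P t n v) = 0.
Proof.
apply: (coend_ext (g := cmap P q n \o cmap P t n) (h := \0)) => m x y.
transitivity (coend_mapr (P n) q (coend_mapr (P n) t (cpure x y))) => //.
rewrite !coend_maprE; have -> : q m (t m y) = 0; last exact: cpure0r.
by apply/(lg_proj_eq0 (@lg_im_closed _ _ _ t)); exists y.
Qed.

(** Together with [coker_inj] this says that [t] is a quasi-isomorphism. The sequence of coend
    complexes is short exact because the terms of [P] are projective. *)
Lemma coker_lift n z : cycles (cx G) n z ->
  exists2 v, cycles (cx F) n v & boundaries (cx G) n (z - cmap P t n v).
Proof.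
move=> zc; have [w' w'E] := ac (cmap_cycles q zc).
have [w wE] := coend_mapr_surj (P := P n.+1) qs w'.
have : cmap P q n (z - cc_d (cx G) n w) = 0.
  by rewrite linBB w'E -wE -cmap_d subrr.
move=> /(coend_mapr_exact qs qt)[v vE]; exists v; last first.
  by exists w; rewrite -[cmap P t n v]vE subKr.
case: n z zc w' w'E w wE v vE => // n z zc w' w'E w wE v vE.
apply: (coend_mapr_inj (P := P n) (t := t)) => //; first exact: res_proj.
rewrite lin00 -[LHS]/(cmap P t n (cc_d (cx F) n v)) -cmap_d.
by rewrite -[cmap P t _ v]vE linBB cc_dd subr0.
Qed.

Lemma coker_inj n v : boundaries (cx G) n (cmap P t n v) -> boundaries (cx F) n v.
Proof.
move=> [z zE]; have : cycles (cx (lg_coker t)) n.+1 (cmap P q n.+1 z).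
  suff e : cc_d (cx (lg_coker t)) n (cmap P q n.+1 z) = 0 by exact: e.
  by rewrite cmap_d -zE qtE.
move=> /ac[w' w'E]; have [w wE] := coend_mapr_surj (P := P n.+2) qs w'.
have : cmap P q n.+1 (z - cc_d (cx G) n.+1 w) = 0.
  by rewrite linBB w'E -wE -cmap_d subrr.
move=> /(coend_mapr_exact qs qt)[u uE]; exists u.
apply: (coend_mapr_inj (P := P n) (t := t)) => //; first exact: res_proj.
rewrite -[LHS]/(cmap P t n v) -[RHS]/(cmap P t n (cc_d (cx F) n u)) -cmap_d.
by rewrite -[cmap P t _ u]uE linBB cc_dd subr0.
Qed.
End Cokernel.

Section Concentrated.
Variable B : lmodType A.

(* The homology of P (x) F is B in degree 0, and zero in other degrees; [r] is the graph
   of the projection of the chains of degree 0 to B. *)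
Definition concentrated (F : lgmod A) : Prop :=
  (forall n z, cycles (cx F) n.+1 z -> boundaries (cx F) n.+1 z) /\
  exists r : submodule (cx F 0 * B)%type,
    [/\ forall z, exists v, r (z, v), forall v, exists z, r (z, v),
        forall z, r (z, 0) <-> boundaries (cx F) 0 z & forall v, r (0, v) -> v = 0].

Variables (F G : lgmod A) (t : lgnat F G).
Hypothesis t_inj : forall m, injective (t m).
Hypothesis ac : acyclic P (lg_coker t).

(** The projection of [F] is that of [G] composed with [t]: its graph is the pullback. *)
Lemma concentrated_sub : concentrated G -> concentrated F.
Proof.
move=> [Gn [r [r1 r2 r3 r4]]]; split.
  by move=> n z /(cmap_cycles t)/Gn; apply: coker_inj.
pose T := cmap P t 0.
have p0 : r (T 0, 0) by rewrite lin00; apply: sm0.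
have pD (x y : cx F 0 * B) : r (T x.1, x.2) -> r (T y.1, y.2) -> r (T (x + y).1, (x + y).2).
  move=> rx ry; have -> : (T (x + y).1, (x + y).2) = (T x.1, x.2) + (T y.1, y.2) :> cx G 0 * B.
    by congr (_, _); apply: (linDD T).
  exact: smD.
have pZ a (x : cx F 0 * B) : r (T x.1, x.2) -> r (T (a *: x).1, (a *: x).2).
  move=> rx; have -> : (T (a *: x).1, (a *: x).2) = a *: (T x.1, x.2) :> cx G 0 * B.
    by congr (_, _); apply: (linZZ T).
  exact: smZ.
exists (@Submodule _ _ (fun x : cx F 0 * B => r (T x.1, x.2)) p0 pD pZ); split.
- by move=> z; have [v rv] := r1 (T z); exists v.
- move=> v; have [z rz] := r2 v.
  have [z' _ /r3 b] := coker_lift t_inj ac (z := z) I; exists z' => /=.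
  have -> : (T z', v) = (z, v) - (z - T z', 0) :> cx G 0 * B.
    by congr (_, _); [apply/esym/subKr|apply/esym/subr0].
  exact: smB.
- move=> z; split=> [/r3|/(cmap_boundaries t)/r3 //]; exact: coker_inj.
- by move=> v rv; apply: r4; rewrite -(lin00 T).
Qed.

(** A chain of [G] comes from [F] only up to a boundary, so no formula gives the projection of [G].
    As a graph it takes the value of any such representative, and [coker_inj] makes it
    single-valued. *)
Lemma concentrated_ext : concentrated F -> concentrated G.
Proof.
move=> [Fn [r [r1 r2 r3 r4]]]; split.
  move=> n z /(coker_lift t_inj ac)[v /Fn /(cmap_boundaries t) bv bz].
  by rewrite -(subrK (cmap P t n.+1 v) z); apply: smD.
pose T := cmap P t 0; pose bd := boundaries (cx G) 0.
pose Q (x : cx G 0 * B) := exists2 z, r (z, x.2) & bd (x.1 - T z).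
have p0 : Q 0 by exists 0; [apply: sm0|rewrite (lin00 T) subr0; apply: sm0].
have pD x y : Q x -> Q y -> Q (x + y).
  move=> [zx rx bx] [zy ry by_]; exists (zx + zy).
    exact: (smD rx ry).
  by rewrite (linDD T) opprD [X in bd X]addrACA; apply: smD.
have pZ a x : Q x -> Q (a *: x).
  move=> [z rz bz]; exists (a *: z); first exact: (smZ a rz).
  by rewrite (linZZ T) -[X in bd X]scalerBr; apply: smZ.
exists (@Submodule _ _ Q p0 pD pZ); split.
- move=> z; have [z' _ b] := coker_lift t_inj ac (z := z) I.
  by have [v rv] := r1 z'; exists v; exists z'.
- by move=> v; have [z rz] := r2 v; exists (T z), z => //; rewrite -[X in bd X]/(T z - T z) subrr; apply: sm0.
- move=> z; split=> [[z' /r3 /(cmap_boundaries t) b1 b2]|bz].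
    by rewrite -(subrK (T z') z); apply: smD.
  by exists 0; [apply: sm0|rewrite (lin00 T) subr0].
- move=> v [z rz]; rewrite [X in bd X]sub0r => /smN; rewrite opprK => /(coker_inj t_inj ac)/r3 rz0.
  apply: r4; have -> : (0, v) = (z, v) - (z, 0) :> cx F 0 * B.
    by congr (_, _); [apply/esym/subrr|apply/esym/subr0].
  exact: smB.
Qed.
End Concentrated.
End Criteria.

(** * Tensor powers as functions *)

Definition point : Type := {q : rat | 0 < q}.
Fact half_point (s t : point) : 0 < (val s + val t) / 2.
Proof. by rewrite divr_gt0 // addr_gt0 ?(valP s) ?(valP t). Qed.
Definition mid (s t : point) : point := @exist rat (fun q => 0 < q) _ (half_point s t).
Fact succ_point (t : point) : 0 < val t + 1.
Proof. by rewrite addr_gt0 ?(valP t). Qed.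
Definition psucc (t : point) : point := @exist rat (fun q => 0 < q) _ (succ_point t).

Lemma midxx t : mid t t = t.
Proof. apply/val_inj => /=; lra. Qed.

(** The phantom argument lets the type carry its [A]-module structure, which is multiplication by
    the value of a scalar at the base coordinate. *)
Definition fn (k : comNzRingType) (A : comAlgType k) of point -> {rmorphism A -> rat} :=
  fun m : nat => ('I_m.+1 -> point) -> rat.

Section Functions.
Variables (k : comNzRingType) (A : comAlgType k) (ev : point -> {rmorphism A -> rat}).
Local Notation fn := (fn ev).

HB.instance Definition _ m := GRing.ComPzRing.on (fn m).

Section Scale.
Variable m : nat.
Definition fn_scale (a : A) (y : fn m) : fn m := fun n => ev (n ord0) a * y n.
Fact fn_scaleA a b y : fn_scale a (fn_scale b y) = fn_scale (a * b) y.
Proof. by apply/funext => n; rewrite /fn_scale rmorphM mulrA. Qed.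
Fact fn_scale1 : left_id 1 fn_scale.
Proof. by move=> y; apply/funext => n; rewrite /fn_scale rmorph1 mul1r. Qed.
Fact fn_scaleDr : right_distributive fn_scale +%R.
Proof. by move=> a x y; apply/funext => n; rewrite /fn_scale !fctE mulrDr. Qed.
Fact fn_scaleDl y : {morph fn_scale^~ y : a b / a + b}.
Proof. by move=> a b; apply/funext => n; rewrite /fn_scale rmorphD !fctE mulrDl. Qed.
HB.instance Definition _ := GRing.Zmodule_isLmodule.Build A (fn m)
  fn_scaleA fn_scale1 fn_scaleDr fn_scaleDl.
Lemma fnZ (a : A) (y : fn m) n : (a *: y) n = ev (n ord0) a * y n.
Proof. by []. Qed.
Lemma fnD (x y : fn m) n : (x + y) n = x n + y n. Proof. by []. Qed.
Lemma fnN (x : fn m) n : (- x) n = - x n. Proof. by []. Qed.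
Lemma fnM (x y : fn m) n : (x * y) n = x n * y n. Proof. by []. Qed.
Lemma fn0 n : (0 : fn m) n = 0. Proof. by []. Qed.
Lemma fn1 n : (1 : fn m) n = 1. Proof. by []. Qed.
Lemma fnMn (x : fn m) j n : (x *+ j) n = x n *+ j.
Proof. by elim: j => [|j IH]; rewrite ?mulr0n // !mulrS fnD IH. Qed.
Lemma fnX (x : fn m) j n : (x ^+ j) n = x n ^+ j.
Proof. by elim: j => [|j IH]; rewrite ?expr0 // !exprS fnM IH. Qed.
Lemma fn_sum I (r : seq I) (Q : pred I) (F : I -> fn m) n :
  (\sum_(i <- r | Q i) F i) n = \sum_(i <- r | Q i) F i n.
Proof. exact: (big_morph (fun y : fn m => y n) (fun x y => fnD x y n) (fn0 n)). Qed.
Lemma fn_prod I (r : seq I) (Q : pred I) (F : I -> fn m) n :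
  (\prod_(i <- r | Q i) F i) n = \prod_(i <- r | Q i) F i n.
Proof. exact: (big_morph (fun y : fn m => y n) (fun x y => fnM x y n) (fn1 n)). Qed.
Lemma fnZM a (x y : fn m) : a *: (x * y) = (a *: x) * y.
Proof. by apply/funext => n; rewrite fnZ !fnM fnZ mulrA. Qed.
Lemma fnMZ a (x y : fn m) : a *: (x * y) = x * (a *: y).
Proof. by rewrite mulrC fnZM mulrC. Qed.
End Scale.
Definition fnE := (fnZ, fnD, fnN, fnM, fn0, fn1, fnMn, fnX, fn_sum, fn_prod).

Definition fnmap_fun m l (f : pmap m l) (y : fn m) : fn l := fun n => y (n \o f).
Fact fnmap_lin m l (f : pmap m l) : linear (fnmap_fun f).
Proof. by move=> a x y; apply/funext => n; rewrite /fnmap_fun !fnE /= pfun0. Qed.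
Definition fnmap m l (f : pmap m l) : {linear fn m -> fn l} := mklin (fnmap_lin f).
Lemma fnmapE m l (f : pmap m l) (y : fn m) n : fnmap f y n = y (n \o f).
Proof. by []. Qed.
Lemma fnmapM m l (f : pmap m l) (x y : fn m) : fnmap f (x * y) = fnmap f x * fnmap f y.
Proof. by []. Qed.
Lemma fnmap1 m l (f : pmap m l) : fnmap f 1 = 1.
Proof. by []. Qed.
Lemma fnmapMn m l (f : pmap m l) (x : fn m) j : fnmap f (x *+ j) = fnmap f x *+ j.
Proof. by rewrite raddfMn. Qed.
Fact fnmap_id m : fnmap (pid m) =1 id. Proof. by []. Qed.
Fact fnmap_comp m l j (g : pmap l j) (f : pmap m l) :
  fnmap (pcomp g f) =1 fnmap g \o fnmap f.
Proof. by []. Qed.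
Definition fnmod : lgmod A := @LGMod A (fun m => fn m) fnmap fnmap_id fnmap_comp.

Section Tensors.
Hypothesis ev_scal : forall (c : k) n n', ev n c%:A = ev n' c%:A.

Variable m : nat.
Definition tprod (a : {ffun 'I_m.+1 -> A}) : fn m := fun n => \prod_i ev (n i) (a i).
Lemma tprod_upd a i x : tprod (upd a i x) =
  fun n => ev (n i) x * \prod_(j | j != i) ev (n j) (a j).
Proof.
apply/funext => n; rewrite /tprod (bigD1 i) //= ffunE eqxx; congr (_ * _).
by apply: eq_bigr => j /negPf ji; rewrite ffunE ji.
Qed.
(** By [ev_scal] an element of [k] has the same value at all points, so it may be moved from factor
    i to factor 0. *)
Fact tprod_rel r : @tens_rel k A m r -> fglift tprod r = 0.
Proof.
case=> [a i x y|a i c x|a b x]; rewrite !raddfB /= ?fglift_scalable !liftU !scale1r;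
  rewrite !tprod_upd; apply/funext => n; rewrite !fnE.
- by rewrite rmorphD; ring.
- by rewrite -(mulr_algl c x) rmorphM (ev_scal c (n i) (n ord0)) mulrA subrr.
- by rewrite rmorphM mulrA subrr.
Qed.
Definition tfun : {linear loday_ob A m -> fn m} := pres_hom tprod tprod_rel.
Lemma tfunE a : tfun (gen (@tens_rel k A m) a) = tprod a.
Proof. exact: pres_hom_gen. Qed.
End Tensors.
End Functions.

(** * Independent families over the integers, and separating points *)

Section IntSpan.
Variable V : zmodType.
Hypothesis tf : forall (x : V) (n : int), n != 0 -> x *~ n = 0 -> x = 0.

Definition ispan r (b : 'I_r -> V) (x : V) : Prop := exists c : 'I_r -> int, x = \sum_i b i *~ c i.

Lemma ispanD r (b : 'I_r -> V) x y : ispan b x -> ispan b y -> ispan b (x + y).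
Proof.
move=> [c ->] [d ->]; exists (fun i => c i + d i); rewrite -big_split.
by apply: eq_bigr => i _; rewrite mulrzDr.
Qed.
Lemma ispanZ r (b : 'I_r -> V) x n : ispan b x -> ispan b (x *~ n).
Proof.
move=> [c ->]; exists (fun i => c i * n); rewrite mulrz_suml.
by apply: eq_bigr => i _; rewrite mulrzA.
Qed.
Lemma ispan0 r (b : 'I_r -> V) : ispan b 0.
Proof. by exists (fun=> 0); rewrite big1 // => i _; rewrite mulr0z. Qed.
Lemma ispan_sum r (b : 'I_r -> V) I (s : seq I) (F : I -> V) :
  (forall i, ispan b (F i)) -> ispan b (\sum_(i <- s) F i).
Proof. by move=> bF; apply: big_ind => //; [apply: ispan0|apply: ispanD]. Qed.
Lemma ispan_gen r (b : 'I_r -> V) i : ispan b (b i).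
Proof.
exists (fun j => (j == i)%:Z); rewrite (bigD1 i) //= eqxx big1 ?addr0 //.
by move=> j /negPf ->; rewrite mulr0z.
Qed.
Lemma ispan_trans r r' (b : 'I_r -> V) (b' : 'I_r' -> V) x :
  (forall i, ispan b' (b i)) -> ispan b x -> ispan b' x.
Proof. by move=> bb [c ->]; apply: ispan_sum => i; apply/ispanZ/bb. Qed.

(* Euclid's algorithm on the coefficients of a relation. *)
Lemma ispan_reduce N r (b : 'I_r.+1 -> V) (c : 'I_r.+1 -> int) :
  (\sum_i `|c i| <= N)%N -> (exists i, c i != 0) -> \sum_i b i *~ c i = 0 ->
  exists b' : 'I_r -> V, forall i, ispan b' (b i).
Proof.
elim: N b c => [|N IH] b c cN [i ci] bc.
  by move: cN; rewrite (bigD1 i) //= leqn0 addn_eq0 absz_eq0 (negPf ci).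
have [[j ji cj]|none] := pselect (exists2 j, j != i & c j != 0); last first.
  have bi0 : b i = 0.
    apply: (tf ci); rewrite -[RHS]bc (bigD1 i) //= big1 ?addr0 // => j ji.
    have [->|cj] := eqVneq (c j) 0; first by rewrite mulr0z.
    by case: none; exists j.
  exists (fun j => b (fintype.lift i j)) => j; have [->|ji] := eqVneq j i.
    by rewrite bi0; apply: ispan0.
  case: (unliftP i j) => [l ->|e]; last by rewrite e eqxx in ji.
  exact: (ispan_gen (fun j => b (fintype.lift i j))).
wlog cij : i j ci cj ji / (`|c j| <= `|c i|)%N.
  move=> W; have /orP[h|h] := leq_total `|c j| `|c i|; first exact: (W i j).
  by apply: (W j i) => //; rewrite eq_sym.
(* Replacing b_j by b_j + e b_i and c_i by c_i - e c_j keeps the relation; with this sign the new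
   |c_i| is |c_i| - |c_j|. *)
pose e : int := sgz (c i) * sgz (c j).
have ee : (`|(c i - e * c j)%R| < `|c i|)%N by rewrite /e; case: (sgzP (c i)); case: (sgzP (c j)); lia.
pose b2 l := if l == j then b j + b i *~ e else b l.
pose c2 l := if l == i then c i - e * c j else c l.
have [|||b' b'P] := IH b2 c2.
- rewrite -ltnS; apply: leq_trans cN; rewrite (bigD1 i) //= [X in (_ < X)%N](bigD1 i) //=.
  rewrite /c2 eqxx -addSn leq_add // leq_eqVlt; apply/orP; left; apply/eqP.
  by apply: eq_bigr => l /negPf ->.
- by exists j; rewrite /c2 (negPf ji).
- rewrite -[RHS]bc (bigD1 i) //= (bigD1 j) //= [RHS](bigD1 i) //= [X in _ = _ + X](bigD1 j) //=.
  rewrite /b2 /c2 !eqxx eq_sym (negPf ji) addrA [RHS]addrA; congr (_ + _); last first.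
    by apply: eq_bigr => l /andP[/negPf -> /negPf ->].
  by rewrite mulrzBr mulrzDl -mulrzA (addrC (b j *~ c j)) addrA subrK.
exists b' => l; have [->|lj] := eqVneq l j; last first.
  by have := b'P l; rewrite /b2 (negPf lj).
have bi : ispan b' (b i) by have := b'P i; rewrite /b2 eq_sym (negPf ji).
have := b'P j; rewrite /b2 eqxx => h.
rewrite -(addrK (b i *~ e) (b j)); apply: ispanD h _.
by rewrite -mulrNz; apply: ispanZ.
Qed.

(** As long as the generators satisfy a nontrivial relation, [ispan_reduce] replaces them by one
    fewer. *)
Lemma ispan_free (s : seq V) : exists r (b : 'I_r -> V),
  (forall c : 'I_r -> int, \sum_i b i *~ c i = 0 -> forall i, c i = 0) /\
  (forall x, x \in s -> ispan b x).
Proof.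
suff: forall r (b : 'I_r -> V), (forall x, x \in s -> ispan b x) ->
    exists r (b : 'I_r -> V),
    (forall c : 'I_r -> int, \sum_i b i *~ c i = 0 -> forall i, c i = 0) /\
    (forall x, x \in s -> ispan b x).
  move/(_ (size s) (fun i => nth 0 s i)); apply.
  move=> x /(nthP 0)[i si <-].
  exact: (ispan_gen (fun i : 'I_(size s) => nth 0 s i) (Ordinal si)).
elim=> [|r IH] b bs; first by exists 0, b; split=> // c _ [].
have [fr|/existsNP[c /not_implyP[bc /existsNP[i ci]]]] :=
    pselect (forall c : 'I_r.+1 -> int, \sum_i b i *~ c i = 0 -> forall i, c i = 0).
  by exists r.+1, b.
have [|b' b'P] := ispan_reduce (leqnn _) _ bc; first by exists i; apply/eqP.
by apply: (IH b') => x /bs; apply: ispan_trans.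
Qed.
End IntSpan.

(** Independent functions have a matrix of values of full row rank on suitable finitely many points;
    [d] is a right inverse of that matrix. *)
Lemma separating_points (T : Type) r (b : 'I_r -> T -> rat) :
  (forall c : 'I_r -> rat, (forall t, \sum_i c i * b i t = 0) -> forall i, c i = 0) ->
  exists q (pts : 'I_q -> T) (d : 'I_q -> 'I_r -> rat),
    forall i i', \sum_j b i (pts j) * d j i' = (i == i')%:R.
Proof.
move=> bfree.
pose M q (pts : 'I_q -> T) := \matrix_(i < r, j < q) b i (pts j).
(* While the rank is below r, some relation [c] holds between the rows. The same combination of the
   functions is not identically zero, so a point where it is nonzero raises the rank. *)
have step d : (d <= r)%N -> exists q (pts : 'I_q -> T), (d <= \rank (M q pts))%N.
  elim: d => [|d IH] dr; first by exists 0, (ffun0 (card_ord 0)).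
  have [q [pts rk]] := IH (ltnW dr).
  have [rk'|rk'] := ltnP d (\rank (M q pts)); first by exists q, pts.
  have K0 : kermx (M q pts) != 0.
    by rewrite -mxrank_eq0 mxrank_ker subn_eq0 -ltnNge (leq_ltn_trans rk').
  have /rowV0Pn[c cK c0] := K0.
  have [t ct] : exists t, \sum_i c 0 i * b i t != 0.
    apply: contra_notP (negP c0) => /forallNP nt; apply/eqP/rowP => i; rewrite mxE.
    apply: (bfree (fun i => c 0 i)) => t; apply/eqP; have := nt t.
    by case: (_ == _) => // /(_ isT).
  pose pts' (j : 'I_(q + 1)) := match fintype.split j with inl j => pts j | inr _ => t end.
  exists (q + 1)%N, pts'; apply: leq_ltn_trans rk _.
  have e : M (q + 1)%N pts' = row_mx (M q pts) (\col_i b i t).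
    apply/matrixP => i j; rewrite !mxE /pts'; by case: (fintype.split j) => l; rewrite mxE.
  have lt : (kermx (M (q + 1)%N pts') < kermx (M q pts))%MS.
    rewrite /ltmx; apply/andP; split.
      apply/rV_subP => v /sub_kermxP; rewrite e mul_mx_row => h; apply/sub_kermxP.
      by have := congr1 lsubmx h; rewrite row_mxKl => ->; apply/matrixP => i j; rewrite !mxE.
    apply/negP => /(submx_trans cK)/sub_kermxP; rewrite e mul_mx_row => h.
    have := congr1 rsubmx h; rewrite row_mxKr => /rowP/(_ 0); rewrite !mxE => h'.
    case/eqP: ct; rewrite -[RHS]h'; apply: eq_bigr => i _; by rewrite mxE.
  have := rank_ltmx lt; rewrite !mxrank_ker => h.
  by have := rank_leq_row (M q pts); have := rank_leq_row (M (q + 1)%N pts'); lia.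
have [q [pts rk]] := step r (leqnn r).
exists q, pts, (fun j i => pinvmx (M q pts) j i) => i i'.
have /mulmxVp/matrixP/(_ i i') : row_free (M q pts).
  by rewrite /row_free eqn_leq rank_leq_row.
by rewrite [LHS]mxE [RHS]mxE => <-; apply: eq_bigr => j _; congr (_ * _); rewrite mxE.
Qed.

Lemma psub_rel (k : comNzRingType) (A : comAlgType k) (F : lgmod A)
    (S S' : forall m, submodule (F m)) : (forall m y, S m y -> S' m y) ->
  forall (Sc : lg_closed S) (Sc' : lg_closed S'),
  exists t : lgnat (lg_sub Sc) (lg_sub Sc'), forall m y, val (t m y) = val y.
Proof.
move=> SS Sc Sc'.
pose f m : {linear submod_type (S m) -> submod_type (S' m)} :=
  corestrict (f := sm_incl (S m)) (fun y => SS m _ (submodP y)).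
have fn m l (u : pmap m l) x : f l (lg_map (lg_sub Sc) u x) = lg_map (lg_sub Sc') u (f m x).
  exact/val_inj.
by exists (@LGNat _ (lg_sub Sc) (lg_sub Sc') f fn).
Qed.

(** * Ext out of a telescope *)

Lemma linMn (R : nzRingType) (U V : lmodType R) (f : {linear U -> V}) n x :
  f (x *+ n) = f x *+ n.
Proof. exact: raddfMn. Qed.

Lemma zmod_iso_sym (U V : zmodType) : zmod_iso U V -> zmod_iso V U.
Proof.
move=> [f [g fg gf]].
have gB : zmod_morphism g.
  by move=> x y; apply: (can_inj fg); rewrite raddfB !gf.
exists (HB.pack_for {additive V -> U} g (GRing.isZmodMorphism.Build V U g gB)).
by exists f.
Qed.

Lemma zmod_iso_trans (U V W : zmodType) : zmod_iso U V -> zmod_iso V W -> zmod_iso U W.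
Proof. by move=> [f bf] [g bg]; exists (g \o f); apply: bij_comp. Qed.

Lemma quot_zmod_iso (R : nzRingType) (U : lmodType R) (S : submodule U) (V : zmodType)
    (f : U -> V) : zmod_morphism f -> surj_fun f -> (forall x, f x = 0 <-> S x) ->
  zmod_iso (quot_mod S) V.
Proof.
move=> fB fs fS; pose g (q : quot_mod S) : V := f (repr q).
have gE x : g (to_quot S x) = f x.
  apply/eqP; rewrite -subr_eq0 -fB; apply/eqP/fS/to_quotP.
  by rewrite /to_quot reprK.
have gB : zmod_morphism g.
  move=> q r; have [x ->] := to_quot_surj q; have [y ->] := to_quot_surj r.
  by rewrite -to_quotB !gE fB.
exists (HB.pack_for {additive quot_mod S -> V} g (GRing.isZmodMorphism.Build _ _ g gB)).
have /choice[h hE] : forall v, exists q, g q = v.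
  by move=> v; have [x xv] := fs v; exists (to_quot S x); rewrite gE.
exists h => // q; apply/eqP; rewrite -subr_eq0; apply/eqP.
have : g (h (g q) - q) = 0 by rewrite gB hE subrr.
by have [x ->] := to_quot_surj (h (g q) - q); rewrite gE => /fS/to_quot_eq0.
Qed.

Lemma quot_zmod_iso0 (R : nzRingType) (U : lmodType R) (S : submodule U) :
  (forall x, S x) -> zmod_iso (quot_mod S) zero_group.
Proof.
move=> Sx; apply: (@quot_zmod_iso _ _ _ _ (fun=> 0)) => [x y|y|x].
- by rewrite subrr.
- by exists 0; rewrite [RHS]ord1.
- by split.
Qed.

Section Transfer.
Variables (k : comNzRingType) (A : comAlgType k) (P : projective_resolution (t_mod k)).
Variables (B : lmodType A) (F : lgmod A) (Q : projective_replacement (coend_complex P F)).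
Local Notation cx := (coend_complex P F).

(** [Q] becomes a projective resolution of [B], with augmentation the comparison map to the coend
    complex followed by the projection whose graph is [r]. *)
Lemma replacement_augmentation : concentrated P B F ->
  (forall n z, cc_d Q n z = 0 -> exists w, z = cc_d Q n.+1 w) /\
  exists2 rho : {linear Q 0 -> B}, surj_fun rho &
    forall x, rho x = 0 <-> exists w, x = cc_d Q 0 w.
Proof.
move=> [Cn [r [r1 r2 r3 r4]]]; pose f := pr_map Q; have qis := pr_qis Q.
have r_uniq z v v' : r (z, v) -> r (z, v') -> v = v'.
  move=> rv rv'; apply/eqP; rewrite -subr_eq0; apply/eqP/r4.
  have -> : (0, v - v') = (z, v) - (z, v') :> cx 0 * B.
    by congr (_, _); apply/esym/subrr.
  exact: smB.
split=> [n z dz|].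
  apply: (qis n.+1).2; first exact: dz.
  have e : cc_d cx n (f n.+1 z) = 0.
    by rewrite -(cm_comm (pr_map Q)) dz lin00.
  by apply: Cn; exact: e.
pose rho x := projT1 (cid (r1 (f 0 x))).
have rhoP x : r (f 0 x, rho x) by exact: projT2 (cid (r1 (f 0 x))).
have rho_lin : linear rho.
  move=> a x y; apply: (r_uniq (f 0 (a *: x + y))) => //.
  have -> : (f 0 (a *: x + y), a *: rho x + rho y) =
      a *: (f 0 x, rho x) + (f 0 y, rho y) :> cx 0 * B.
    by congr (_, _); rewrite linDD linZZ.
  by apply: smD => //; apply: smZ.
exists (mklin rho_lin) => [v|x].
  have [z rz] := r2 v; have [y _ /r3 b] := (qis 0%N).1 z I.
  exists y; apply: (r_uniq (f 0 y)) => //.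
  have -> : (f 0 y, v) = (z, v) - (z - f 0 y, 0) :> cx 0 * B.
    by congr (_, _); [apply/esym/subKr|apply/esym/subr0].
  exact: smB.
split=> [e|[w ->]].
  apply: (qis 0%N).2 => //; apply/r3.
  by have := rhoP x; rewrite -[rho x]/(mklin rho_lin x) e.
apply: (r_uniq (f 0 (cc_d Q 0 w))) => //; apply/r3.
by exists (f 1%N w); apply: (cm_comm (pr_map Q)).
Qed.
End Transfer.

Section Telescope.
Variables (A : comNzRingType) (B : lmodType A) (q : nat -> nat) (b : nat -> B).
Hypothesis bq : forall n, b n.+1 *+ q n = b n.
Hypothesis b_gen : forall v, exists n a, v = a *: b n.
Hypothesis b_free : forall n a, a *: b n = 0 -> a = 0.

(* The resolution 0 -> E -> E -> B of the direct limit B of A -q0-> A -q1-> A -> ... *)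
Local Notation E := {freeg nat / A}.
Definition tel_gen n : E := << n.+1 >> *+ q n - << n >>.
Definition tel : {linear E -> E} := fglift tel_gen.
Definition tel_aug : {linear E -> B} := fglift b.

Lemma telE n : tel << n >> = << n.+1 >> *+ q n - << n >>.
Proof. exact: fglift_gen. Qed.
Lemma tel_augE n : tel_aug << n >> = b n.
Proof. exact: fglift_gen. Qed.

Lemma tel_aug_surj : surj_fun tel_aug.
Proof. by move=> v; have [n [a ->]] := b_gen v; exists (a *: << n >>); rewrite linZZ tel_augE. Qed.

Lemma tel_aug_tel x : tel_aug (tel x) = 0.
Proof.
apply: (@fglift_ext A nat B (tel_aug \o tel) \0) x => n.
transitivity (tel_aug (tel << n >>)) => //.
by rewrite telE linBB linMn !tel_augE bq subrr.
Qed.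

Lemma freeg_ind (X : choiceType) (S : submodule {freeg X / A}) :
  (forall x, S << x >>) -> forall D, S D.
Proof.
move=> Sx D; rewrite -[D]freeg_sumE; apply: sm_sum => x _.
by rewrite -[coeff _ _]mulr1 -freegUZ; apply/smZ/Sx.
Qed.

(** Modulo the image of [tel] each generator is a multiple of any later one. Hence every element
    reduces to a single term [a *: << n >>], on which [b_free] detects zero. *)
Lemma tel_shift n m : (n <= m)%N -> exists c, im tel (<< n >> - << m >> *+ c).
Proof.
elim: m => [|m IH]; first by rewrite leqn0 => /eqP ->; exists 1%N; rewrite subrr; apply: im0.
rewrite leq_eqVlt => /predU1P[->|/IH[c ic]]; first by exists 1%N; rewrite subrr; apply: im0.
exists (q m * c)%N; rewrite -(subrK (<< m >> *+ c) << n >>) -addrA; apply: smD => //.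
have -> : << m >> *+ c - << m.+1 >> *+ (q m * c) = c%:R *: tel (- << m >>).
  by rewrite linearN telE opprB scaler_nat mulrnBl mulrnA.
by apply: smZ; exists (- << m >>).
Qed.

Lemma tel_exact x : tel_aug x = 0 -> exists y, x = tel y.
Proof.
have [n [a e]] : exists n a, im tel (x - a *: << n >>).
  pose T (x : E) := exists n, forall m, (n <= m)%N -> exists a, im tel (x - a *: << m >>).
  have T0 : T 0 by exists 0%N => m _; exists 0; rewrite scale0r subrr; apply: im0.
  have TD y z : T y -> T z -> T (y + z).
    move=> [n nP] [n' nP']; exists (maxn n n') => m; rewrite geq_max => /andP[nm nm'].
    have [a ia] := nP m nm; have [a' ia'] := nP' m nm'; exists (a + a').
    by rewrite scalerDl opprD addrACA; apply: smD.
  have TZ a y : T y -> T (a *: y).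
    move=> [n nP]; exists n => m nm; have [c ic] := nP m nm; exists (a * c).
    by rewrite -scalerA -scalerBr; apply: smZ.
  have [n nP] : T x.
    apply: (freeg_ind (S := Submodule T0 TD TZ)) x => n; exists n => m nm.
    by have [c ic] := tel_shift nm; exists c%:R; rewrite scaler_nat.
  by exists n; apply: nP.
move=> x0; suff a0 : a = 0 by move: e; rewrite a0 scale0r subr0.
case: e => y ey; have : tel_aug (x - a *: << n >>) = 0 by rewrite ey tel_aug_tel.
rewrite linBB x0 sub0r linZZ tel_augE => /eqP; rewrite oppr_eq0 => /eqP.
exact: b_free.
Qed.

(** The coefficient of [tel x] at m is q_(m-1) x_(m-1) - x_m, without the first term at m = 0; so
    x_0 = 0, and the others vanish in turn. *)
Lemma tel_inj x : tel x = 0 -> x = 0.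
Proof.
move=> tx; pose p m (D : E) : A^o := if m is j.+1 then coeff j D *+ q j else 0.
have cl m : linear (coeff m : E -> A^o) by move=> a y z; rewrite raddfD /= coeffZ.
have pl m : linear (p m).
  case: m => [|m] a y z; rewrite /p ?scaler0 ?addr0 // cl mulrnDl.
  by congr (_ + _); apply/esym/mulrnAr.
have cE m : p m x = coeff m x.
  apply/eqP; rewrite -subr_eq0; apply/eqP.
  have <- : mklin (cl m) (tel x) = p m x - coeff m x; last by rewrite tx lin00.
  apply: (@fglift_ext A nat A^o (mklin (cl m) \o tel) (mklin (pl m) \- mklin (cl m))) => n.
  transitivity (coeff m (tel << n >>) : A^o) => //.
  transitivity (p m << n >> - coeff m << n >>) => //.
  rewrite telE coeffB coeffMn; congr (_ - _).
  rewrite /p; case: m => [|m]; rewrite !coeffU !mul1r /= ?mul0rn // eqSS.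
  by case: eqVneq => [->|_]; rewrite ?mul0rn.
by apply/eqP/freeg_eqP => m; rewrite coeff0; elim: m => [|m IH]; rewrite -cE /p // IH mul0rn.
Qed.
End Telescope.

Section Ext.
Variables (A : comNzRingType) (B : lmodType A) (q : nat -> nat) (b : nat -> B).
Hypothesis bq : forall n, b n.+1 *+ q n = b n.
Hypothesis b_gen : forall v, exists n a, v = a *: b n.
Hypothesis b_free : forall n a, a *: b n = 0 -> a = 0.

Variables (Q : chain_complex A) (rho : {linear Q 0 -> B}).
Hypothesis Q_proj : forall n, projective (Q n).
Hypothesis Q_exact : forall n z, cc_d Q n z = 0 -> exists w, z = cc_d Q n.+1 w.
Hypothesis rho_surj : surj_fun rho.
Hypothesis rho_ker : forall x, rho x = 0 <-> exists w, x = cc_d Q 0 w.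
Variable V : lmodType A.
Local Notation d n := (cc_d Q n).
Local Notation K := (hom_complex Q V).
Local Notation E := {freeg nat / A}.
Local Notation tel := (tel A q).
Local Notation tel_aug := (tel_aug b).

(** The dual of [tel], with linear maps from the free module to [V] viewed as sequences in [V]. *)
Definition tel_diff (y : nat -> V) : nat -> V := fun n => y n.+1 *+ q n - y n.
Fact tel_diff_lin : linear tel_diff.
Proof.
move=> a x y; apply/funext => n; rewrite /tel_diff !fctE mulrnDl scalerMnr scalerBr opprD.
by rewrite addrACA.
Qed.
Definition tel_im : submodule (nat -> V) := im (mklin tel_diff_lin).

Definition to_hom (U W : lmodType A) (f : {linear U -> W}) : Hom U W :=
  @to_submod _ _ (linear_maps U W) f (fun a x y => linearP f a x y).

Lemma rho_d x : rho (d 0 x) = 0.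
Proof. by apply/rho_ker; exists x. Qed.

Lemma comparison_data : exists (u : nat -> Q 0) (w : nat -> Q 1),
  (forall n, rho (u n) = b n) /\ (forall n, d 0 (w n) = u n.+1 *+ q n - u n).
Proof.
have /choice[u uE] : forall n, exists x, rho x = b n by move=> n; apply: rho_surj.
have /choice[w wE] : forall n, exists y, u n.+1 *+ q n - u n = d 0 y.
  by move=> n; apply/rho_ker; rewrite linBB linMn !uE bq subrr.
by exists u, w; split=> // n; apply/esym/wE.
Qed.

Section Compare.
Variables (u : nat -> Q 0) (w : nat -> Q 1).
Hypothesis uE : forall n, rho (u n) = b n.
Hypothesis wE : forall n, d 0 (w n) = u n.+1 *+ q n - u n.
Let g0 : {linear E -> Q 0} := fglift u.
Let g1 : {linear E -> Q 1} := fglift w.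
Let g0E n : g0 << n >> = u n. Proof. exact: fglift_gen. Qed.
Let g1E n : g1 << n >> = w n. Proof. exact: fglift_gen. Qed.

Lemma compare_g x : d 0 (g1 x) = g0 (tel x).
Proof.
apply: (@fglift_ext A nat _ (d 0 \o g1) (g0 \o tel)) => n.
transitivity (d 0 (g1 << n >>)) => //; transitivity (g0 (tel << n >>)) => //.
by rewrite telE linBB linMn !g0E g1E wE.
Qed.
Lemma compare_rho x : rho (g0 x) = tel_aug x.
Proof.
apply: (@fglift_ext A nat _ (rho \o g0) tel_aug) => n.
transitivity (rho (g0 << n >>)) => //.
by rewrite g0E uE; apply/esym/tel_augE.
Qed.

(** Two projective resolutions of [B] are compared: [g0], [g1] and [f0], [f1] are chain maps in the
    two directions, [h] is a homotopy in degree 0 on [Q], and [e] one on the telescope. *)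
Lemma compare_ex : exists (f0 : {linear Q 0 -> E}) (f1 : {linear Q 1 -> E})
    (h : {linear Q 0 -> Q 1}) (e : {linear E -> E}),
  [/\ forall x, tel (f1 x) = f0 (d 0 x), forall x, f1 (d 1 x) = 0,
      forall x, d 0 (h x) = x - g0 (f0 x) & forall x, f1 (g1 x) = x + e (tel x)].
Proof.
have [|f0 f0E] := projective_lift (@Q_proj 0) (d := tel_aug) (f := rho).
  by move=> x; have [y yE] := tel_aug_surj b_gen (rho x); exists y.
have [|f1 f1E] := projective_lift (@Q_proj 1) (d := tel) (f := f0 \o d 0).
  by move=> x; apply: (tel_exact bq b_free (x := _)); rewrite f0E rho_d.
have [|h hE] := projective_lift (@Q_proj 0) (d := d 0) (f := idfun \- (g0 \o f0)).
  move=> x; apply/rho_ker; rewrite -[X in rho X]/(x - g0 (f0 x)).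
  by rewrite linBB compare_rho f0E subrr.
have [|e eE] := projective_lift (free_projective (R := A) (X := nat)) (d := tel)
    (f := (f0 \o g0) \- idfun).
  move=> x; apply: (tel_exact bq b_free (x := _)); rewrite -[X in tel_aug X]/(f0 (g0 x) - x).
  by rewrite linBB f0E compare_rho subrr.
exists f0, f1, h, e; split=> // x.
  by apply: (@tel_inj A q); rewrite f1E -[LHS]/(f0 (d 0 (d 1 x))) cc_dd lin00.
apply/eqP; rewrite -subr_eq0; apply/eqP; apply: (@tel_inj A q).
have a : tel (f1 (g1 x)) = f0 (g0 (tel x)) by rewrite -compare_g; apply: f1E.
have c : tel (e (tel x)) = f0 (g0 (tel x)) - tel x by apply: eE.
by rewrite linBB linDD a c [tel x + _]addrC subrK subrr.
Qed.

Let ev1 (phi : submod_type (cocycles K 1)) : quot_mod tel_im :=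
  to_quot tel_im (fun n => val (val phi) (w n)).

Lemma cocycleP n (phi : submod_type (cocycles K n)) x : val (val phi) (d n x) = 0.
Proof. by have /(congr1 (fun f : Hom _ _ => val f x)) := submodP phi. Qed.

(** A cocycle is recorded by its values on the [w n]. For surjectivity, a sequence extended to [C]
    is realized by [C \o f1] up to the coboundary of [C \o e]. For injectivity, if the values of phi
    are the coboundary of a sequence with extension [Y], then phi is the coboundary of
    [Y \o f0 + phi \o h]. *)
Lemma ext1_iso : zmod_iso (cohomology K 1) (quot_mod tel_im).
Proof.
have [f0 [f1 [h [e [f1t f1d hE eE]]]]] := compare_ex.
apply: (@quot_zmod_iso _ _ _ _ ev1) => [phi psi|v|phi].
- apply: etrans (to_quotB _ _ _); apply: (congr1 (to_quot tel_im)).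
  have vB : val (val (phi - psi)) = val (val phi) - val (val psi) :> (Q 1%N -> V).
    apply: etrans (linBB (sm_incl (linear_maps (Q 1%N) V)) (val phi) (val psi)).
    by apply: (congr1 val); apply: (linBB (sm_incl (cocycles K 1))).
  by rewrite vB.
- have [c ->] := to_quot_surj v; pose C : {linear E -> V} := fglift c.
  have Ccl : cocycles K 1 (to_hom (C \o f1)).
    by apply/val_inj/funext => x; rewrite /= f1d lin00.
  exists (to_submod Ccl); apply/to_quotP; exists (fun n => C (e << n >>)).
  apply/funext => n; rewrite !fctE -[val _ _]/(C (f1 (w n))) -[mklin _ _ _]/(_ *+ _ - _).
    have CE : C << n >> = c n by apply: fglift_gen.
  by rewrite -g1E eE telE (linDD C) (linBB e) (linMn e) (linBB C) (linMn C) CE addrC addKr.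
split.
  move=> /to_quot_eq0[y yE]; pose Y : {linear E -> V} := fglift y.
  pose phil := mklin (hom_linear (val phi)).
  exists (to_hom ((Y \o f0) \+ (phil \o h))).
  apply/val_inj/funext => x; rewrite -[RHS]/(Y (f0 (d 0 x)) + phil (h (d 0 x))).
  have YE z : Y (tel z) = phil (g1 z).
    apply: (@fglift_ext A nat V (Y \o tel) (phil \o g1)) => n.
    transitivity (Y (tel << n >>)) => //; transitivity (phil (g1 << n >>)) => //.
    have YE m : Y << m >> = y m by apply: fglift_gen.
    rewrite telE linBB linMn !YE g1E.
    by have /(congr1 (fun f => f n)) := yE.
  (* The homotopy identity in degree 1 holds up to a boundary, on which the cocycle vanishes. *)
  have [z zE] : exists z, h (d 0 x) - x + g1 (f1 x) = d 1 z.
    by apply: Q_exact; rewrite linDD linBB hE compare_g f1t addrAC subrK subrr.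
  rewrite -f1t YE addrC -linDD.
  have -> : h (d 0 x) + g1 (f1 x) = x + d 1 z by rewrite -zE addrA [x + _]addrC subrK.
  by rewrite linDD [phil (d 1 z)](cocycleP phi) addr0.
move=> [psi psiE]; apply/to_quot_eq0; exists (fun n => val psi (u n)).
apply/funext => n; rewrite psiE.
pose psil := mklin (hom_linear psi).
by rewrite -[LHS]/(psil (d 0 (w n))) wE linBB linMn.
Qed.

(* [d s d = d] above degree 0: together with exactness this contracts the complex. *)
Lemma hom_split_ex n : exists s : {linear Q n.+1 -> Q n.+2},
  forall x, d n.+1 (s (d n.+1 x)) = d n.+1 x.
Proof.
elim: n => [|n [s sE]].
  have [f0 [f1 [h [e [f1t f1d hE _]]]]] := compare_ex.
  have [|s sE] := projective_lift (@Q_proj 1) (d := d 1)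
      (f := (idfun \- (h \o d 0)) \- (g1 \o f1)).
    move=> x; apply: Q_exact; rewrite -[X in d 0 X]/(x - h (d 0 x) - g1 (f1 x)).
    by rewrite !linBB hE compare_g f1t subKr subrr.
  exists s => x; rewrite sE -[LHS]/(d 1 x - h (d 0 (d 1 x)) - g1 (f1 (d 1 x))).
  by rewrite cc_dd f1d (lin00 h) (lin00 g1) !subr0.
have [|s' s'E] := projective_lift (@Q_proj n.+2) (d := d n.+2) (f := idfun \- (s \o d n.+1)).
  move=> x; apply: Q_exact; rewrite -[X in d _ X]/(x - s (d n.+1 x)).
  by rewrite linBB sE subrr.
exists s' => x; rewrite s'E -[LHS]/(d n.+2 x - s (d n.+1 (d n.+2 x))).
by rewrite cc_dd lin00 subr0.
Qed.

(** The element [x - s (d x)] is a cycle, hence a boundary, so a cocycle phi vanishes on it and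
    equals [phi \o s \o d]. *)
Lemma ext_higher n : zmod_iso (cohomology K n.+2) zero_group.
Proof.
apply: quot_zmod_iso0 => phi.
have [s sE] := hom_split_ex n; pose phil := mklin (hom_linear (val phi)).
exists (to_hom (phil \o s)); apply/val_inj/funext => x.
rewrite -[RHS]/(phil (s (d n.+1 x))); apply/eqP; rewrite -subr_eq0; apply/eqP.
rewrite -[LHS]/(phil x - phil (s (d n.+1 x))) -linBB.
have [|z ->] := Q_exact (z := x - s (d n.+1 x)); last exact: cocycleP.
by rewrite linBB sE subrr.
Qed.

(** A 0-cocycle vanishes on the kernel of [rho], so it is determined by its values y_n on the [u n].
    These satisfy y_n = q_n y_(n+1). *)
Lemma ext_0 : (forall y : nat -> V, (forall n, y n = y n.+1 *+ q n) -> forall n, y n = 0) ->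
  zmod_iso (cohomology K 0) zero_group.
Proof.
move=> sep; apply: quot_zmod_iso0 => phi; pose phil := mklin (hom_linear (val phi)).
suff phi0 x : phil x = 0 by apply/val_inj/funext => x; apply: phi0.
have pd z : phil (d 0 z) = 0 := cocycleP phi z.
have [n [a e]] := b_gen (rho x).
have /rho_ker[z zE] : rho (x - a *: u n) = 0 by rewrite linBB linZZ uE e subrr.
have un m : phil (u m) = 0.
  apply: (sep (fun m => phil (u m))) => {}m; apply/eqP; rewrite eq_sym -subr_eq0.
  by rewrite -linMn -linBB -wE pd.
by rewrite -(subrK (a *: u n) x) zE linDD pd linZZ un scaler0 addr0.
Qed.
End Compare.

Theorem ext_telescope n :
  (forall y : nat -> V, (forall n, y n = y n.+1 *+ q n) -> forall n, y n = 0) ->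
  zmod_iso (cohomology K n) (if n == 1%N then (quot_mod tel_im : zmodType) else zero_group).
Proof.
move=> sep; have [u [w [uE wE]]] := comparison_data.
case: n => [|[|n]]; [exact: ext_0 uE wE sep|exact: ext1_iso uE wE|exact: ext_higher uE wE n].
Qed.
End Ext.

Definition modulus (q : nat -> nat) (n : nat) : nat := \prod_(i < n) q i.

(** The value of [cover N] at m is a free module, of which [N m] is a retract. *)
Lemma rg_projective_value (R : nzRingType) (N : rgmod R) m :
  rg_projective N -> projective (N m).
Proof.
move=> pN U V g f gs.
have [i iE] := cover_retract pN.
have [h hE] := @free_projective R (cover_gen N m) U V g (f \o cover_proj N m) gs.
exists (h \o i m : {linear _ -> _}) => x; have := hE (i m x).
rewrite /= => ->; congr (f _); exact: (iE m x).
Qed.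

(** * Contraction of a resolution of [t] at [1] *)

Section SplitAtOne.
Variables (k : comNzRingType) (P : projective_resolution (t_mod k)).

Definition aug1 (x : P 0 1%N) : k := val (res_aug P 1 x) ord_max.
Fact aug1_lin : linear (aug1 : P 0 1%N -> k^o).
Proof. by move=> a x y; rewrite /aug1 linDD linZZ /= !ffunE. Qed.

Fact t1_subproof : [ffun i : 'I_2 => (i != ord0)%:R : k^o] \in sm_pred (pointed k 1).
Proof. by apply/sm_predP; rewrite /= ffunE eqxx. Qed.
Definition t1_gen : t_mod k 1 := SubmodElt t1_subproof.

Lemma ord2P (i : 'I_2) : i = ord0 \/ i = ord_max.
Proof. by case: i => [[|[|//]] h]; [left|right]; apply/val_inj. Qed.

Lemma t1E (x : t_mod k 1) : x = val x ord_max *: t1_gen.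
Proof.
apply/val_inj/ffunP => i; rewrite [RHS]ffunE; case: (ord2P i) => ->.
  by have -> : val x ord0 = 0 := submodP x; rewrite ffunE eqxx scaler0.
by rewrite [X in _ *: X]ffunE [_ *: _]mulr1.
Qed.

Lemma aug1_gen : exists2 u : P 0 1%N, aug1 u = 1 & forall x, res_aug P 1 x = aug1 x *: res_aug P 1 u.
Proof.
have [u uE] := res_aug_surj P t1_gen; exists u; last by move=> x; rewrite uE; apply: t1E.
by rewrite /aug1 uE /= ffunE.
Qed.

(** [t] takes the value [k] at [1], so the values of [P] there form a projective resolution of a
    free module of rank one. It contracts onto the span of the lift [u] of the generator. *)
Lemma split0 (u : P 0 1%N) : (forall x, res_aug P 1 x = aug1 x *: res_aug P 1 u) ->
  exists s : {linear P 0 1%N -> P 1 1%N}, forall x, res_d P 0 1 (s x) = x - aug1 x *: u.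
Proof.
move=> uE.
have fl : linear (fun x : P 0 1%N => x - aug1 x *: u).
  move=> a x y; rewrite -[aug1 _]/((mklin aug1_lin) _) linDD linZZ /=.
  by rewrite scalerDl opprD addrACA scalerBr scalerA.
have [|h hE] := projective_lift (rg_projective_value (m := 1%N) (@res_proj _ _ P 0))
  (d := res_d P 0 1) (f := mklin fl); last by exists h => x; apply: hE.
by move=> x; apply/res_exact0; rewrite mklinE linBB linZZ -uE subrr.
Qed.

Lemma split_step n (s : {linear P n 1%N -> P n.+1 1%N}) :
  (forall x, res_d P n 1 (s (res_d P n 1 x)) = res_d P n 1 x) ->
  exists s' : {linear P n.+1 1%N -> P n.+2 1%N},
    forall x, res_d P n.+1 1 (s' x) = x - s (res_d P n 1 x).
Proof.
move=> sE.
have [|h hE] := projective_lift (rg_projective_value (m := 1%N) (@res_proj _ _ P n.+1))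
  (d := res_d P n.+1 1) (f := idfun \- (s \o res_d P n 1)); last by exists h => x; apply: hE.
move=> x; apply/res_exact.
by rewrite -[X in res_d _ _ _ X]/(x - s (res_d P n 1 x)) linBB sE subrr.
Qed.

Lemma split_ex n : exists s : {linear P n 1%N -> P n.+1 1%N},
  forall x, res_d P n 1 (s (res_d P n 1 x)) = res_d P n 1 x.
Proof.
elim: n => [|n [s sE]].
  have [u _ uE] := aug1_gen; have [s sE] := split0 uE; exists s => x; rewrite sE.
  have -> : aug1 (res_d P 0 1 x) = 0; last by rewrite scale0r subr0.
  rewrite /aug1; have /res_exact0 -> : exists y, res_d P 0 1 x = res_d P 0 1 y by exists x.
  by rewrite /= ffunE.
have [s' s'E] := split_step sE; exists s' => x.
by rewrite s'E res_dd lin00 subr0.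
Qed.
End SplitAtOne.

(** * Reduction to linear functions *)

Section QuotOp.
Variables (k : comNzRingType) (A : comAlgType k) (F : lgmod A).
Variables (S S' : forall m, submodule (F m)) (Sc : lg_closed S) (Sc' : lg_closed S').
Variable t : lgnat (lg_sub Sc) (lg_sub Sc').
Hypothesis tE : forall m y, val (t m y) = val y.

Lemma sub_coker_eq0 m (y : lg_sub Sc' m) : to_quot (im (t m)) y = 0 <-> S m (val y).
Proof.
rewrite to_quot_eq0; split=> [[x ->]|Sy]; first by rewrite tE; apply: submodP.
by exists (to_submod Sy); apply/val_inj; rewrite tE.
Qed.

Lemma sub_nat_inj m : injective (t m).
Proof. by move=> x y e; apply: val_inj; rewrite -!tE e. Qed.

Lemma sub_coker_mapE m l (f : pmap m l) y :
  lg_map (lg_coker t) f (to_quot (im (t m)) y) = to_quot (im (t l)) (lg_map (lg_sub Sc') f y).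
Proof. exact: lg_quot_mapE. Qed.

Section Op.
Variables (m l : nat) (T : {linear F m -> F l}).
Hypothesis TS : forall y, S m y -> S l (T y).
Hypothesis TS' : forall y, S' m y -> S' l (T y).
Definition sub_op : {linear lg_sub Sc' m -> lg_sub Sc' l} :=
  corestrict (f := T \o sm_incl (S' m)) (fun y => TS' (submodP y)).
Fact quot_op_subproof y : im (t m) y ->
  (mklin (to_quot_lin (im (t l))) \o sub_op) y = 0.
Proof.
move=> [z yz]; have Sy : S m (val y) by rewrite yz tE; apply: submodP.
by apply/sub_coker_eq0; apply: TS Sy.
Qed.
Definition quot_op : {linear lg_coker t m -> lg_coker t l} := quot_lift quot_op_subproof.
Lemma quot_opE y : quot_op (to_quot (im (t m)) y) = to_quot (im (t l)) (sub_op y).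
Proof. exact: quot_liftE. Qed.
End Op.
End QuotOp.

Lemma midE s t : val (mid s t) = (val s + val t) / 2.
Proof. by []. Qed.

Section NonZero.
Variables (k : comNzRingType) (A : comAlgType k) (ev : point -> {rmorphism A -> rat}) (m : nat).
Fact fn_oner_neq0 : 1 != 0 :> fn ev m.
Proof.
pose t : point := @exist rat (fun q => 0 < q) 1 ltr01.
by apply/eqP => /(congr1 (fun y : fn ev m => y (fun=> t))) /eqP; rewrite oner_eq0.
Qed.
HB.instance Definition _ := GRing.PzSemiRing_isNonZero.Build (fn ev m) fn_oner_neq0.
End NonZero.

Section Numeric.
Variables (k : comNzRingType) (A : comAlgType k) (ev : point -> {rmorphism A -> rat}).
Hypothesis ev_inj : forall a, (forall n, ev n a = 0) -> a = 0.
Hypothesis ev_scal : forall (c : k) n n', ev n c%:A = ev n' c%:A.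
Local Notation fn := (fn ev).
Local Notation fnmod := (fnmod ev).

(** * Injectivity of evaluation on tensor powers *)

Section TensorInjective.
Lemma ev_torsion_free (a : A) (n : int) : n != 0 -> a *~ n = 0 -> a = 0.
Proof.
move=> n0 an; apply: ev_inj => t; apply: (mulfI (x := n%:~R)); first by rewrite intr_eq0.
by rewrite mulr0 mulrzl -(rmorph0 (ev t)) -an rmorphMz.
Qed.

Section Generation.
Variables (m r : nat) (b : 'I_r -> A).
Local Notation tgen := (gen (@tens_rel k A m)).

(** Factor 0 is 1 because [A] acts through it: coefficients in [A] take its place. *)
Definition btens (c : {ffun 'I_m -> 'I_r}) : {ffun 'I_m.+1 -> A} :=
  [ffun i => if unlift ord0 i is Some j then b (c j) else 1].

Definition bspan (z : loday_ob A m) : Prop :=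
  exists al : {ffun 'I_m -> 'I_r} -> A, z = \sum_c al c *: tgen (btens c).
Fact bspan0 : bspan 0.
Proof. by exists (fun=> 0); rewrite big1 // => c _; rewrite scale0r. Qed.
Fact bspanD x y : bspan x -> bspan y -> bspan (x + y).
Proof.
move=> [al ->] [be ->]; exists (fun c => al c + be c).
by rewrite -big_split; apply: eq_bigr => c _; rewrite scalerDl.
Qed.
Fact bspanZ a x : bspan x -> bspan (a *: x).
Proof.
move=> [al ->]; exists (fun c => a * al c).
by rewrite scaler_sumr; apply: eq_bigr => c _; rewrite scalerA.
Qed.
Definition bspan_sm := @Submodule A (loday_ob A m) bspan bspan0 bspanD bspanZ.

Lemma tgenD a i x y : tgen (upd a i (x + y)) = tgen (upd a i x) + tgen (upd a i y).
Proof.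
apply/eqP; rewrite -subr_eq0 opprD addrA /gen -!to_quotB; apply/eqP.
exact/gen_rel/TensAdd.
Qed.
Lemma tgenB a i x y : tgen (upd a i (x - y)) = tgen (upd a i x) - tgen (upd a i y).
Proof. by apply/eqP; rewrite eq_sym subr_eq -tgenD subrK. Qed.
Lemma tgenM a x y : tgen (upd a ord0 (x * y)) = x *: tgen (upd a ord0 y).
Proof.
apply/eqP; rewrite -subr_eq0 /gen -to_quotZ -!to_quotB; apply/eqP.
exact/gen_rel/TensMod.
Qed.
Lemma upd_id (a : {ffun 'I_m.+1 -> A}) i : upd a i (a i) = a.
Proof. by apply/ffunP => j; rewrite ffunE; case: eqP => [->|]. Qed.

(** The factors of index at least p are already members of [b]. The induction expands the last of
    the others by additivity; at the end factor 0 is pulled out as a coefficient. *)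
Lemma bspan_gen p (a : {ffun 'I_m.+1 -> A}) : (forall i, i != ord0 -> ispan b (a i)) ->
  (forall i : 'I_m.+1, i != ord0 -> (p <= i)%N -> exists l, a i = b l) -> bspan (tgen a).
Proof.
elim: p a => [|p IH] a sa ba.
  have /choice[c cE] : forall j : 'I_m, exists l, a (fintype.lift ord0 j) = b l.
    by move=> j; apply: ba.
  rewrite -(upd_id a ord0) -[a ord0]mulr1 tgenM; apply: bspanZ.
  exists (fun c' => (c' == finfun c)%:R); rewrite (bigD1 (finfun c)) //= eqxx scale1r.
  rewrite big1 ?addr0 => [|c' /negPf ->]; last by rewrite scale0r.
  congr (gen _ _); apply/ffunP => i; rewrite !ffunE.
  by case: unliftP => [j ->|->]; rewrite ?eqxx // ffunE cE.
have [pm|mp] := ltnP p m.+1; last first.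
  by apply: IH => // i i0 pi; move: (ltn_ord i); rewrite ltnNge (leq_trans mp pi).
pose i : 'I_m.+1 := Ordinal pm.
have [i0|i0] := eqVneq i ord0.
  apply: IH => // j j0 pj; apply: ba => //; move/(congr1 val): i0 => /= ->.
  by rewrite lt0n.
have fz : zmod_morphism (fun x => tgen (upd a i x)) by move=> x y; apply: tgenB.
pose f : {additive A -> loday_ob A m} := HB.pack_for {additive A -> loday_ob A m}
  (fun x => tgen (upd a i x)) (GRing.isZmodMorphism.Build A (loday_ob A m) _ fz).
have [c ai] := sa i i0.
rewrite -(upd_id a i) ai -[X in bspan X]/(f _) raddf_sum.
apply: (sm_sum (S := bspan_sm)) => l _; rewrite raddfMz -scaler_int; apply: bspanZ.
apply: IH => j j0; rewrite ffunE; case: eqVneq => [_|ji] //.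
- exact: ispan_gen.
- exact: sa.
- by exists l.
- by rewrite leq_eqVlt => /predU1P[e|]; [case/eqP: ji; apply/val_inj/esym|apply: ba].
Qed.

End Generation.

Lemma loday_bspan m (z : loday_ob A m) : exists s : seq A, forall r (b : 'I_r -> A),
  (forall x, x \in s -> ispan b x) -> bspan b z.
Proof.
pose Q (z : loday_ob A m) := exists s : seq A, forall r (b : 'I_r -> A),
  (forall x, x \in s -> ispan b x) -> bspan b z.
have Q0 : Q 0 by exists [::] => *; apply: bspan0.
have QD x y : Q x -> Q y -> Q (x + y).
  move=> [s sE] [t tE]; exists (s ++ t) => r b st; apply: bspanD.
    by apply: sE => w ws; apply: st; rewrite mem_cat ws.
  by apply: tE => w ws; apply: st; rewrite mem_cat ws orbT.
have QZ a x : Q x -> Q (a *: x) by move=> [s sE]; exists s => r b /sE; apply: bspanZ.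
apply: (pres_ind (S := @Submodule _ _ Q Q0 QD QZ)) z => a.
exists [seq a i | i : 'I_m.+1] => r b ss; apply: (bspan_gen (p := m.+1)).
  by move=> i _; apply: ss; apply: codom_f.
by move=> i _; rewrite leqNgt ltn_ord.
Qed.

(** The product [D] of the denominators turns a rational relation between the functions into an
    integral one, which holds in [A] by [ev_inj]. *)
Lemma ispan_free_rat r (b : 'I_r -> A) :
  (forall c : 'I_r -> int, \sum_i b i *~ c i = 0 -> forall i, c i = 0) ->
  forall c : 'I_r -> rat, (forall t, \sum_i c i * ev t (b i) = 0) -> forall i, c i = 0.
Proof.
move=> bf c c0 i; pose D : int := \prod_j denq (c j).
have D0 : D != 0 by apply/prodf_neq0 => j _; apply: denq_neq0.
have /choice[d dE] : forall j, exists d : int, d%:~R = c j * D%:~R.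
  move=> j; exists (numq (c j) * \prod_(l | l != j) denq (c l)).
  have -> : D = denq (c j) * \prod_(l | l != j) denq (c l) by rewrite /D (bigD1 j).
  rewrite !intrM mulrA; congr (_ * _).
  by rewrite numqE.
have : d i = 0.
  apply: (bf d); apply: ev_inj => t.
  transitivity ((\sum_i c i * ev t (b i)) * D%:~R); last by rewrite c0 mul0r.
  rewrite raddf_sum mulr_suml; apply: eq_bigr => j _.
  by rewrite raddfMz -mulrzl dE mulrAC.
move/(congr1 (fun x : int => x%:~R : rat)); rewrite dE => /eqP.
by rewrite mulf_eq0 intr_eq0 (negPf D0) orbF => /eqP.
Qed.

(** An element of the kernel involves finitely many elements of [A], which lie in the span of an
    independent family [b]. Expand it in tensors of members of [b] with coefficients in [A].
    Evaluating the factors 1, ..., m at separating points and contracting with the dual matrix [d]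
    isolates the value of each coefficient at an arbitrary [n0]. *)
Lemma tfun_inj m : injective (tfun ev_scal m).
Proof.
move=> z z' e; apply/eqP; rewrite -subr_eq0; apply/eqP.
have : tfun ev_scal m (z - z') = 0 by rewrite linBB e subrr.
move: (z - z') => {e z'}z z0.
have [s sP] := loday_bspan z.
have [r [b [bf bs]]] := ispan_free ev_torsion_free s.
have [al zE] := sP _ b bs.
have [q [pts [d dE]]] := separating_points (ispan_free_rat bf).
rewrite zE big1 // => c _; suff -> : al c = 0 by rewrite scale0r.
apply: ev_inj => n0.
pose pt (u : {ffun 'I_m -> 'I_q}) (i : 'I_m.+1) :=
  if unlift ord0 i is Some j then pts (u j) else n0.
have key (u : {ffun 'I_m -> 'I_q}) : \sum_c' ev n0 (al c') * \prod_j ev (pts (u j)) (b (c' j)) = 0.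
  transitivity (tfun ev_scal m z (pt u)); last by rewrite z0.
  rewrite zE linSS fn_sum; apply: eq_bigr => c' _.
  rewrite linZZ tfunE fnZ /tprod big_ord_recl /pt unlift_none; congr (_ * _).
  rewrite ffunE unlift_none rmorph1 mul1r; apply: eq_bigr => j _.
  by rewrite ffunE liftK.
have : \sum_(u : {ffun 'I_m -> 'I_q}) (\sum_c' ev n0 (al c') *
    \prod_j ev (pts (u j)) (b (c' j))) * \prod_j d (u j) (c j) = 0.
  by rewrite big1 // => u _; rewrite key mul0r.
under eq_bigr do rewrite mulr_suml.
rewrite exchange_big /= => <-.
rewrite (bigD1 c) //= [X in _ + X]big1 ?addr0 => [|c' c'c].
  under eq_bigr do rewrite -mulrA -big_split.
  rewrite -mulr_sumr -(bigA_distr_bigA (fun j l => ev (pts l) (b (c j)) * d l (c j))) /=.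
  by rewrite big1 ?mulr1 // => j _; rewrite dE eqxx.
under eq_bigr do rewrite -mulrA -big_split.
rewrite -mulr_sumr -(bigA_distr_bigA (fun j l => ev (pts l) (b (c' j)) * d l (c j))) /=.
have [j cj] : exists j, c' j != c j.
  by apply/existsP; apply: contraNT c'c => /existsPn h; apply/eqP/ffunP => j; apply/eqP/negPn.
by rewrite (bigD1 j) //= dE (negPf cj) mul0r mulr0.
Qed.
End TensorInjective.

Fact tfun_nat m l (f : pmap m l) (z : loday A m) :
  tfun ev_scal l (lg_map (loday A) f z) = lg_map fnmod f (tfun ev_scal m z).
Proof.
apply: (pres_hom_ext (g := tfun ev_scal l \o loday_map A f)
  (h := fnmap ev f \o tfun ev_scal m)) z => a.
transitivity (tfun ev_scal l (loday_map A f (gen (@tens_rel k A m) a))) => //.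
transitivity (fnmap ev f (tfun ev_scal m (gen (@tens_rel k A m) a))) => //.
rewrite loday_mapE !tfunE; apply/funext => n; rewrite fnmapE /tprod.
rewrite (partition_big f xpredT) //=; apply: eq_bigr => j _.
by rewrite ffunE rmorph_prod; apply: eq_bigr => i /eqP ->.
Qed.
Definition tnat : lgnat (loday A) fnmod :=
  @LGNat _ (loday A) fnmod (fun m => tfun ev_scal m) tfun_nat.

(* The image of A (x) ... (x) A in the functions of m + 1 variables; [Rq] below is
   its tensor product with Q. *)
Definition Rsm m : submodule (fn m) := im (tnat m).
Fact Rsm_closed : lg_closed (F := fnmod) Rsm.
Proof. exact: lg_im_closed. Qed.

Section Fixed.
Variable m : nat.
Implicit Types x y z : fn m.

Definition fvar (i : 'I_m.+1) (a : A) : fn m := fun n => ev (n i) a.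

Lemma Rsm_tprod a : Rsm m (tprod ev a).
Proof. by exists (gen (@tens_rel k A m) a); apply/esym/(tfunE ev_scal a). Qed.
Lemma Rsm_ind (S : submodule (fn m)) : (forall a, S (tprod ev a)) -> forall y, Rsm m y -> S y.
Proof.
move=> Sp _ [z ->].
have S0 : S (tfun ev_scal m 0) by rewrite lin00; apply: sm0.
have SD (z1 z2 : loday A m) : S (tfun ev_scal m z1) -> S (tfun ev_scal m z2) ->
  S (tfun ev_scal m (z1 + z2)) by rewrite linDD; apply: smD.
have SZ a (z1 : loday A m) : S (tfun ev_scal m z1) -> S (tfun ev_scal m (a *: z1)).
  by rewrite linZZ; apply: smZ.
apply: (pres_ind (S := @Submodule _ _ (fun z : loday A m => S (tfun ev_scal m z)) S0 SD SZ)) z => a.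
by have := Sp a; rewrite -(tfunE ev_scal a).
Qed.
Lemma Rsm_var i a : Rsm m (fvar i a).
Proof.
suff -> : fvar i a = tprod ev (upd [ffun=> 1] i a) by apply: Rsm_tprod.
apply/funext => n; rewrite tprod_upd big1 ?mulr1 // => j _.
by rewrite ffunE rmorph1.
Qed.
Lemma Rsm1 : Rsm m 1.
Proof.
suff -> : 1 = tprod ev [ffun=> 1] :> fn m by apply: Rsm_tprod.
by apply/funext => n; rewrite /tprod big1 // => i _; rewrite ffunE rmorph1.
Qed.
Lemma tprod_var a : tprod ev a = \prod_i fvar i (a i).
Proof. by apply/funext => n; rewrite fn_prod. Qed.

Lemma smMr (S : submodule (fn m)) z (zS : forall a, S (tprod ev a * z)) y :
  Rsm m y -> S (y * z).
Proof.
have S0 : S (0 * z) by rewrite mul0r; apply: sm0.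
have SD y1 y2 : S (y1 * z) -> S (y2 * z) -> S ((y1 + y2) * z).
  by rewrite mulrDl; apply: smD.
have SZ a y1 : S (y1 * z) -> S ((a *: y1) * z) by rewrite -fnZM; apply: smZ.
exact: (Rsm_ind (S := @Submodule _ _ (fun y => S (y * z)) S0 SD SZ)).
Qed.
Lemma RsmM y z : Rsm m y -> Rsm m z -> Rsm m (y * z).
Proof.
move=> yR zR; apply: smMr yR => a; rewrite mulrC; apply: smMr zR => b.
suff -> : tprod ev b * tprod ev a = tprod ev [ffun i => b i * a i] by apply: Rsm_tprod.
apply/funext => n; rewrite fnM /tprod -big_split; apply: eq_bigr => i _.
by rewrite ffunE rmorphM.
Qed.
Lemma smMn (S : submodule (fn m)) y j : S y -> S (y *+ j).
Proof.
by move=> Sy; elim: j => [|j IH]; rewrite ?mulr0n ?mulrS; [apply: sm0|apply: smD].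
Qed.
Lemma RsmX y j : Rsm m y -> Rsm m (y ^+ j).
Proof.
by move=> yR; elim: j => [|j IH]; rewrite ?expr0 ?exprS; [apply: Rsm1|apply: RsmM].
Qed.

Lemma fn_torsion_free y j : (0 < j)%N -> y *+ j = 0 -> y = 0.
Proof.
move=> j0 yj; apply/funext => n; have /eqP := congr1 (fun g : fn m => g n) yj.
by rewrite fnMn mulrn_eq0 eqn0Ngt j0 => /eqP.
Qed.

Definition diag0 y : Prop := forall t, y (fun=> t) = 0.

Fact diag0_0 : diag0 0. Proof. by []. Qed.
Fact diag0D x y : diag0 x -> diag0 y -> diag0 (x + y).
Proof. by move=> x0 y0 t; rewrite fnD x0 y0 addr0. Qed.
Fact diag0Z a x : diag0 x -> diag0 (a *: x).
Proof. by move=> x0 t; rewrite fnZ x0 mulr0. Qed.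
Definition diag := @Submodule A (fn m) diag0 diag0_0 diag0D diag0Z.
Lemma diag0M y z : diag0 z -> diag0 (y * z).
Proof. by move=> z0 t; rewrite fnM z0 mulr0. Qed.

(** The reduced part of a subfunctor: for m = 0 every point is on the diagonal. *)
Definition bar (S : submodule (fn m)) : submodule (fn m) := sm_cap S diag.

Definition in_Rq y := exists2 N, (0 < N)%N & Rsm m (y *+ N).
Fact Rq0 : in_Rq 0. Proof. by exists 1%N => //; apply: sm0. Qed.
Fact RqD x y : in_Rq x -> in_Rq y -> in_Rq (x + y).
Proof.
move=> [N N0 xN] [M M0 yM]; exists (N * M)%N; first by rewrite muln_gt0 N0.
rewrite mulrnDl mulrnA mulnC mulrnA; apply: smD; exact: smMn.
Qed.
Fact RqZ a x : in_Rq x -> in_Rq (a *: x).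
Proof. by move=> [N N0 xN]; exists N => //; rewrite scalerMnr; apply: smZ. Qed.
Definition Rq : submodule (fn m) := @Submodule A (fn m) in_Rq Rq0 RqD RqZ.
Lemma RqM y z : Rsm m y -> Rq z -> Rq (y * z).
Proof. by move=> yR [N N0 zN]; exists N => //; rewrite -mulrnAr; apply: RsmM. Qed.
Lemma Rsm_Rq y : Rsm m y -> Rq y.
Proof. by move=> yR; exists 1%N. Qed.
End Fixed.

Lemma bar_closed (S : forall m, submodule (fn m)) : lg_closed (F := fnmod) S ->
  lg_closed (F := fnmod) (fun m => bar (S m)).
Proof. by move=> Sc m l f y [Sy y0]; split=> [|t]; [apply: Sc|apply: y0]. Qed.
Fact Rq_closed : lg_closed (F := fnmod) Rq.
Proof.
move=> m l f y [N N0 yN]; exists N => //.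
have := Rsm_closed f yN; congr (Rsm l _); exact: fnmapMn.
Qed.
Definition Rb_closed := bar_closed Rsm_closed.
Definition Rqb_closed := bar_closed Rq_closed.

Lemma Rb_ideal m (y z : fn m) : Rsm m y -> bar (Rsm m) z -> bar (Rsm m) (y * z).
Proof. by move=> yR [zR z0]; split; [apply: RsmM|apply: diag0M]. Qed.

(** * Quotients of function spaces with local units *)

Section UnitalPair.
Variables (I S S' : forall m, submodule (fn m)).
Hypothesis Ic : lg_closed (F := fnmod) I.
Hypothesis I0 : forall m y, I m y -> diag0 y.
Hypothesis IM : forall m y z, I m y -> I m z -> I m (y * z).
Hypotheses (Sc : lg_closed (F := fnmod) S) (Sc' : lg_closed (F := fnmod) S').
Hypothesis SM : forall m y z, I m y -> S m z -> S m (y * z).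
Hypothesis SM' : forall m y z, I m y -> S' m z -> S' m (y * z).
Hypothesis unit1 : forall m y, S' m y -> exists2 x, I m x & S m (y - x * y).
Variable t : lgnat (lg_sub Sc) (lg_sub Sc').
Hypothesis tE : forall m y, val (t m y) = val y.
Local Notation X := (lg_sub Ic).
Local Notation Q := (lg_coker t).

Fact fn_mul_lin m (x : fn m) : linear (fun y : fn m => x * y).
Proof. by move=> a y z; rewrite mulrDr -fnMZ. Qed.
Definition pair_act m (x : X m) : {linear Q m -> Q m} :=
  quot_op tE (T := mklin (fn_mul_lin (val x))) (fun y => SM (submodP x) (z := y))
    (fun y => SM' (submodP x) (z := y)).
Definition pair_mul m (x : X m) (y : lg_sub Sc' m) : lg_sub Sc' m :=
  to_submod (SM' (submodP x) (submodP y)).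
Lemma pair_actE m (x : X m) (y : lg_sub Sc' m) :
  pair_act x (to_quot (im (t m)) y) = to_quot (im (t m)) (pair_mul x y).
Proof. exact: quot_opE. Qed.

(** [unit1] provides a unit for one class in S' / S. If x1 is a unit for one class and x2 for the
    remaining ones, then x1 + x2 - x1 x2 is one for all of them, since 1 minus it is (1 - x1)(1 -
    x2). *)
Lemma pair_unital : unital_action (F := Q) pair_act.
Proof.
split.
- move=> m l f x q; have [y ->] := to_quot_surj q.
  rewrite pair_actE.
  transitivity (to_quot (im (t l)) (lg_map (lg_sub Sc') f (pair_mul x y))).
    exact: lg_quot_mapE.
  transitivity (pair_act (lg_map X f x) (to_quot (im (t l)) (lg_map (lg_sub Sc') f y))).
    by rewrite pair_actE; congr (to_quot _ _); apply/val_inj.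
  by congr (pair_act _ _); apply/esym/lg_quot_mapE.
- move=> m q; have [y ->] := to_quot_surj q.
  by rewrite pair_actE; apply/(sub_coker_eq0 tE); rewrite /= mul0r; apply: sm0.
- move=> m x x' q; have [y ->] := to_quot_surj q.
  by rewrite !pair_actE; congr (to_quot _ _); apply/val_inj; rewrite /= mulrCA.
- move=> m s; elim: s => [|q s [x2 x2E]]; first by exists 0.
  have [y yE] := to_quot_surj q; have [x1 x1R x1E] := unit1 (submodP y).
  have xR : I m (x1 + val x2 - x1 * val x2).
    apply: smB; first exact/smD/submodP.
    by apply: IM (submodP x2).
  exists (to_submod xR) => r; rewrite inE => /predU1P[->|rs].
    rewrite yE pair_actE; apply/eqP; rewrite -subr_eq0 -to_quotB; apply/eqP/(sub_coker_eq0 tE).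
    have -> : val (pair_mul (to_submod xR) y - y) = val x2 * (val y - x1 * val y) - (val y - x1 * val y).
      by rewrite raddfB /=; ring.
    by apply: smB => //; apply: SM (submodP x2) _.
  have [z zE] := to_quot_surj r; have := x2E r rs.
  rewrite zE !pair_actE => /eqP; rewrite -subr_eq0 -to_quotB => /eqP/(sub_coker_eq0 tE) h.
  apply/eqP; rewrite -subr_eq0 -to_quotB; apply/eqP/(sub_coker_eq0 tE).
  have -> : val (pair_mul (to_submod xR) z - z) =
      val (pair_mul x2 z - z) - x1 * val (pair_mul x2 z - z).
    by rewrite !raddfB /=; ring.
  by apply: smB => //; apply: SM x1R _.
Qed.

Lemma diag0_reduced (x : X 0) : x = 0.
Proof.
apply/val_inj/funext => n; have x0 := I0 (submodP x).
rewrite -[RHS](x0 (n ord0)); congr (val x _); apply/funext => i.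
by rewrite ord1.
Qed.

Lemma pair_acyclic (P : projective_resolution (t_mod k)) : acyclic P Q.
Proof. exact: (@unital_acyclic _ _ P X diag0_reduced Q _ pair_unital). Qed.
End UnitalPair.

Section Frobenius.
Hypothesis frob : forall (p : nat) (a : A), prime p -> exists b, a ^+ p - a = b *+ p.

(** The congruence of y^p and y modulo p is stable under products, and under sums because the inner
    binomial coefficients are divisible by p. Hence it spreads from the single factors to the whole
    tensor power. *)
Lemma frobenius_Rsm m p (y : fn m) : prime p -> Rsm m y ->
  exists2 z, Rsm m z & y ^+ p - y = z *+ p.
Proof.
move=> pp; have p0 := prime_gt0 pp; move=> yR.
pose Q y := Rsm m y /\ exists2 z, Rsm m z & y ^+ p - y = z *+ p.
suff: Q y by case.
have QM y1 y2 : Q y1 -> Q y2 -> Q (y1 * y2).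
  move=> [R1 [z1 S1 e1]] [R2 [z2 S2 e2]]; split; first exact: RsmM.
  exists (y1 ^+ p * z2 + z1 * y2).
    by apply: smD; apply: RsmM => //; apply: RsmX.
  by rewrite mulrnDl -mulrnAr -e2 -mulrnAl -e1 exprMn; ring.
have Qv i a : Q (fvar i a).
  split; first exact: Rsm_var.
  have [b e] := frob a pp; exists (fvar i b); first exact: Rsm_var.
  apply/funext => n; rewrite !fnE /fvar -rmorphXn -rmorphB e; exact: raddfMn.
have Q1 : Q 1.
  by split; [apply: Rsm1|exists 0; [apply: sm0|rewrite expr1n subrr mul0rn]].
have Q0 : Q 0.
  split; first exact: sm0.
  by exists 0; [apply: sm0|rewrite expr0n eqn0Ngt p0 subrr mul0rn].
have QD y1 y2 : Q y1 -> Q y2 -> Q (y1 + y2).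
  move=> [R1 [z1 S1 e1]] [R2 [z2 S2 e2]]; split; first exact: smD.
  case: p pp p0 {QM Qv Q1 Q0} Q e1 e2 => // q pp _ _ e1 e2.
  have /choice[c cE] : forall i : 'I_q, exists c, 'C(q.+1, bump 0 i) = (c * q.+1)%N.
    by move=> i; apply/dvdnP/prime_dvd_bin => //=; rewrite /bump /= add1n ltnS ltn_ord.
  exists (z1 + z2 + \sum_(i < q) (y1 ^+ (q - i) * y2 ^+ (bump 0 i)) *+ c i).
    apply: smD; first exact: smD.
    by apply: sm_sum => i _; apply/smMn/RsmM; apply: RsmX.
  rewrite exprDn big_ord_recl big_ord_recr /= subn0 subnn !expr0 mul1r mulr1 bin0 binn !mulr1n.
  rewrite !mulrnDl -e1 -e2 -sumrMnl.
  have -> : \sum_(i < q) (y1 ^+ (q.+1 - bump 0 i) * y2 ^+ bump 0 i) *+ 'C(q.+1, bump 0 i) =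
     \sum_(i < q) (y1 ^+ (q - i) * y2 ^+ bump 0 i) *+ c i *+ q.+1.
    by apply: eq_bigr => i _; rewrite -mulrnA -(cE i) /= /bump /= add1n subSS.
  by ring.
have QZ a y1 : Q y1 -> Q (a *: y1).
  suff -> : a *: y1 = fvar ord0 a * y1 by move=> h; apply: QM.
  exact/funext.
apply: (Rsm_ind (S := @Submodule _ _ Q Q0 QD QZ)) yR => a.
by rewrite /= tprod_var; apply: (big_ind Q).
Qed.

(* If (1 - x) z = M y, then (1 - y^(p-1)) (1 - x) z = M (y - y^p) is divisible by p M. *)
Lemma unit_mod m N (z : fn m) : (0 < N)%N -> bar (Rsm m) z ->
  exists2 x, bar (Rsm m) x & exists2 y, Rsm m y & z - x * z = y *+ N.
Proof.
elim/ltn_ind: N z => N IH z N0 zb.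
have [->|N1] := eqVneq N 1%N.
  by exists 0; [apply: sm0|exists z; [case: zb|rewrite mul0r subr0]].
have pp : prime (pdiv N) by rewrite pdiv_prime // ltn_neqAle eq_sym N1.
set p := pdiv N in pp; have /dvdnP[M NE] := pdiv_dvd N; rewrite -/p in NE.
have p0 := prime_gt0 pp; have M0 : (0 < M)%N by move: N0; rewrite NE muln_gt0 => /andP[].
have [|x xb [y yR e]] := IH M _ z M0 zb; first by rewrite NE ltn_Pmulr // prime_gt1.
have yb : bar (Rsm m) y.
  split=> // t; have := congr1 (fun g : fn m => g (fun=> t)) e.
  rewrite !fnE; case: zb => _ ->; case: xb => _ ->; rewrite mul0r subrr => /esym/eqP.
  by rewrite mulrn_eq0 eqn0Ngt M0 => /eqP.
have [y2 y2R e2] := frobenius_Rsm pp yR.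
have ypE : y ^+ p = y ^+ p.-1 * y by rewrite -exprSr prednK.
have yp : bar (Rsm m) (y ^+ p.-1).
  case: (p) pp => [|[|q]] // _; rewrite exprS mulrC; apply: Rb_ideal => //; exact: RsmX.
exists (x + y ^+ p.-1 - y ^+ p.-1 * x).
  by apply: smB; [apply: smD|apply: Rb_ideal => //; case: yp].
exists (- y2); first exact: smN.
rewrite NE mulrnA mulrnAC mulNrn -e2 ypE mulNrn.
transitivity ((z - x * z) - y ^+ p.-1 * (z - x * z)); first by ring.
by rewrite e; ring.
Qed.
End Frobenius.

(** * Homogeneous and polynomial functions *)

Definition fcst m (c : rat) : fn m := fun=> c.
Arguments fcst : clear implicits.
Definition xv m (i : 'I_m.+1) : fn m := fun n => val (n i) - val (n ord0).

Lemma Rq_cst m c (y : fn m) : Rq m y -> Rq m (fcst m c * y).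
Proof.
move=> [N N0 yN].
have [a [b [d [d0 cd]]]] : exists a b d : nat, (0 < d)%N /\ c * d%:R = a%:R - b%:R.
  have e : c * `|denq c|%:R = (numq c)%:~R by rewrite numqE pmulrn absz_denq.
  case: (numq c) e => j e.
    by exists j, 0%N, `|denq c|%N; rewrite absz_gt0 denq_neq0 subr0 e.
  by exists 0%N, j.+1, `|denq c|%N; rewrite absz_gt0 denq_neq0 e sub0r NegzE rmorphN.
exists (N * d)%N; first by rewrite muln_gt0 N0.
have -> : (fcst m c * y) *+ (N * d) = (y *+ N) *+ a - (y *+ N) *+ b.
  apply/funext => n; rewrite fnMn fnM fnD fnN !fnMn -[fcst m c n]/c.
  transitivity (y n * N%:R * (c * d%:R)); first by ring.
  by rewrite cd; ring.
by apply: smB; apply: smMn.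
Qed.

Lemma Rq_mul m (y z : fn m) : Rq m y -> Rq m z -> Rq m (y * z).
Proof.
move=> [N N0 yN] [M M0 zM]; exists (N * M)%N; first by rewrite muln_gt0 N0.
have -> : y * z *+ (N * M) = (y *+ N) * (z *+ M) by rewrite mulrnA -mulrnAl -mulrnAr.
exact: RsmM.
Qed.

(* Homogeneous polynomials in the differences n_i - n_0 with coefficients in A (x) Q,
   regarded as functions of n_0. *)
Inductive hom m : nat -> fn m -> Prop :=
| HomC b : Rq 0 b -> hom 0 (fnmap ev (pnull 0 m) b)
| HomX d y i : hom d y -> hom d.+1 (y * xv i)
| HomD d y z : hom d y -> hom d z -> hom d (y + z).

Lemma hom0P m (y : fn m) : hom 0 y -> exists2 b, Rq 0 b & y = fnmap ev (pnull 0 m) b.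
Proof.
suff H d : hom d y -> d = 0%N -> exists2 b, Rq 0 b & y = fnmap ev (pnull 0 m) b by move/H; apply.
elim=> {d y}[b bR _|//|d y z _ IHy _ IHz d0].
  by exists b.
have [b bR ->] := IHy d0; have [c cR ->] := IHz d0.
by exists (b + c); [apply: smD|rewrite linDD].
Qed.

Lemma homQ m d c (y : fn m) : hom d y -> hom d (fcst m c * y).
Proof.
elim=> {d y}[b bR|d y i _ IH|d y z _ IHy _ IHz].
- by rewrite -[X in hom 0 X]/(fnmap ev (pnull 0 m) (fcst 0 c * b)); apply/HomC/Rq_cst.
- by rewrite mulrA; apply: HomX.
- by rewrite mulrDr; apply: HomD.
Qed.
Lemma homN m d (y : fn m) : hom d y -> hom d (- y).
Proof. by move=> /(homQ (-1)); congr (hom d _); apply/funext => n; rewrite fnM /fcst mulN1r. Qed.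
Lemma hom_0 m d : hom d (0 : fn m).
Proof.
elim: d => [|d IH].
  by rewrite -[0](lin00 (fnmap ev (pnull 0 m))); apply: HomC; exists 1%N => //; apply: sm0.
by rewrite -(mul0r (xv ord0)); apply: HomX.
Qed.
Lemma hom_coef_mul m b d (y : fn m) : Rq 0 b -> hom d y ->
  hom d (fnmap ev (pnull 0 m) b * y).
Proof.
move=> bR; elim=> {d y}[c cR|d y i _ IH|d y z _ IHy _ IHz].
- by rewrite -fnmapM; apply/HomC/Rq_mul.
- by rewrite mulrA; apply: HomX.
- by rewrite mulrDr; apply: HomD.
Qed.
Lemma homM m d e (y z : fn m) : hom d y -> hom e z -> hom (d + e) (y * z).
Proof.
move=> + hz; elim=> {d y}[c cR|d y i _ IH|d y z' _ IHy _ IHz].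
- exact: hom_coef_mul.
- by rewrite mulrAC addSn; apply: HomX.
- by rewrite mulrDl; apply: HomD.
Qed.
Lemma Rq_var a : Rq 0 (fvar ord0 a).
Proof. exact/Rsm_Rq/Rsm_var. Qed.
Lemma hom_var m a : hom 0 (fvar (ord0 : 'I_m.+1) a).
Proof. exact: (HomC m (Rq_var a)). Qed.
Lemma scale_var m a (y : fn m) : a *: y = fvar ord0 a * y.
Proof. by []. Qed.
Lemma homZ m a d (y : fn m) : hom d y -> hom d (a *: y).
Proof. by rewrite scale_var; apply: hom_coef_mul (Rq_var a). Qed.
Lemma hom_map m l (f : pmap m l) d (y : fn m) : hom d y -> hom d (fnmap ev f y).
Proof.
elim=> {d y}[b bR|d y i _ IH|d y z _ IHy _ IHz].
- have -> : fnmap ev f (fnmap ev (pnull 0 m) b) = fnmap ev (pnull 0 l) b.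
    by rewrite -[LHS]/((fnmap ev f \o fnmap ev (pnull 0 m)) b) -fnmap_comp pnullf.
  exact: HomC.
- rewrite fnmapM; have -> : fnmap ev f (xv i) = xv (f i); last exact: HomX.
  by apply/funext => n; rewrite fnmapE /xv /= pfun0.
- by rewrite linDD; apply: HomD.
Qed.

(** A contraction by 1/2 towards the base coordinate: it fixes the coefficients and halves each
    difference [xv i]. *)
Definition halve m (n : 'I_m.+1 -> point) : 'I_m.+1 -> point := fun i => mid (n i) (n ord0).
Lemma hom_halve m d (y : fn m) : hom d y -> forall n, y (halve n) = 2^-1 ^+ d * y n.
Proof.
elim=> {d y}[b bR|d y i _ IH|d y z _ IHy _ IHz] n.
- by rewrite expr0 mul1r !fnmapE; congr (b _); apply/funext => i /=; rewrite /halve midxx.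
- by rewrite !fnM IH /xv /halve /= exprS; ring.
- by rewrite !fnD IHy IHz mulrDr.
Qed.
Lemma hom_diag m d (y : fn m) : hom d.+1 y -> diag0 y.
Proof.
suff H e : hom e y -> e != 0%N -> diag0 y by move/H; apply.
elim=> {e y}[b _ //|e y i _ _ _ t|e y z _ IHy _ IHz ed t].
  by rewrite fnM /xv subrr mulr0.
by rewrite fnD IHy // IHz // addr0.
Qed.
Lemma hom_Rq (w : A) : (forall n, ev n w = val n) -> forall m d (y : fn m), hom d y -> Rq m y.
Proof.
move=> ew m d y; elim=> {d y}[b bR|d y i _ IH|d y z _ IHy _ IHz].
- exact: Rq_closed bR.
- rewrite mulrC; apply: RqM => //.
  have -> : xv i = fvar i w - fvar ord0 w by apply/funext => n; rewrite /xv fnD fnN /fvar !ew.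
  by apply: smB; apply: Rsm_var.
- exact: smD.
Qed.

(** The factorization through the wedge used for halving: after the fold the two copies of a point
    coincide and so does their midpoint, whereas after a retraction one copy is the base coordinate
    and the midpoint is that of [halve]. *)
Definition wedge_mid m (y : fn m) : fn (m + m) :=
  fun n => y (fun i => mid (n (winl m i)) (n (winr m i))).
Fact wedge_mid_lin m : linear (@wedge_mid m).
Proof.
move=> a y z; apply/funext => n; rewrite /wedge_mid !fnE; congr (_ * _ + _).
by rewrite !pfun0 midxx.
Qed.
Lemma hom_wedge_mid m d (y : fn m) : hom d y -> hom d (wedge_mid y).
Proof.
elim=> {d y}[b bR|d y i _ IH|d y z _ IHy _ IHz].
- have -> : wedge_mid (fnmap ev (pnull 0 m) b) = fnmap ev (pnull 0 (m + m)) b.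
    apply/funext => n; rewrite /wedge_mid !fnmapE; congr (b _); apply/funext => i.
    by rewrite /comp -[pfun (pnull _ _) i]/ord0 !pfun0 midxx.
  exact: HomC.
- have -> : wedge_mid (y * xv i) = fcst _ 2^-1 * (wedge_mid y * xv (winl m i) + wedge_mid y * xv (winr m i)).
    apply/funext => n; rewrite /wedge_mid !(fnM, fnD) /xv !pfun0 midxx -[fcst _ _ n]/(2^-1).
    by rewrite midE; field.
  by apply: homQ; apply: HomD; apply: HomX.
- exact: HomD.
Qed.
Lemma wedge_mid_nat m l (f : pmap m l) (y : fn m) :
  wedge_mid (fnmap ev f y) = fnmap ev (wmap f) (wedge_mid y).
Proof.
apply/funext => n; rewrite /wedge_mid !fnmapE; congr (y _); apply/funext => i.
by rewrite /comp copair_winl copair_winr.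
Qed.

(* A component of degree d is multiplied by 2^-d by [halve], so that iterating [halve]
   at a point gives more zeros than the degree to a polynomial. *)
Lemma hom_independent m D (y : nat -> fn m) : (forall d, hom d (y d)) ->
  \sum_(d < D) y d = 0 -> forall d, (d < D)%N -> y d = 0.
Proof.
move=> hy y0 d dD; apply/funext => n.
pose p := \poly_(d < D) y d n.
suff /(congr1 (fun q : {poly rat} => q`_d)) : p = 0 by rewrite coef_poly dD coef0.
pose rs := [seq (2^-1 : rat) ^+ j | j <- iota 0 D].
apply: (@roots_geq_poly_eq0 _ p rs); last by rewrite size_map size_iota size_poly.
  apply/allP => _ /mapP[j _ ->]; apply/rootP.
  have hj e : y e (iter j (@halve m) n) = (2^-1 ^+ j) ^+ e * y e n.
    elim: j => [|j IH]; first by rewrite expr0 expr1n mul1r.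
    by rewrite iterS (hom_halve (hy e)) IH mulrA exprS exprMn.
  transitivity ((\sum_(d < D) y d : fn m) (iter j (@halve m) n)); last by rewrite y0.
  rewrite horner_poly fn_sum.
  by apply: eq_bigr => e _; rewrite hj mulrC.
rewrite map_inj_uniq ?iota_uniq // => i j /eqP.
rewrite !exprVn (inj_eq invr_inj) -!natrX eqr_nat => /eqP.
exact: expnI.
Qed.
Local Notation qcst m := (fcst m).
Local Notation acyclic := (@acyclic k A).

Section Fixed.
Variable m : nat.
Implicit Types y z : fn m.

(** The formal variable of [p] records the degree, and evaluation at 1 forgets it; products of
    polynomial functions thus come from products of polynomials. *)
Definition is_pol y := exists2 p : {poly fn m}, (forall d, hom d p`_d) & y = p.[1].

Lemma horner1_sum (p : {poly fn m}) : p.[1] = \sum_(d < size p) p`_d.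
Proof. by rewrite horner_coef; apply: eq_bigr => d _; rewrite expr1n mulr1. Qed.
Lemma poly_sum (ys : nat -> fn m) D : (\poly_(d < D) ys d).[1] = \sum_(d < D) ys d.
Proof. by rewrite horner_poly; apply: eq_bigr => d _; rewrite expr1n mulr1. Qed.
Lemma pol_intro ys D : (forall d, hom d (ys d)) -> is_pol (\sum_(d < D) ys d).
Proof.
move=> h; exists (\poly_(d < D) ys d); last by rewrite poly_sum.
by move=> d; rewrite coef_poly; case: ifP => _ //; apply: hom_0.
Qed.
Lemma pol0 : is_pol 0.
Proof. by exists 0; [move=> d; rewrite coef0; apply: hom_0|rewrite horner0]. Qed.
Lemma polD y z : is_pol y -> is_pol z -> is_pol (y + z).
Proof.
move=> [p hp ->] [q hq ->]; exists (p + q); last by rewrite hornerD.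
by move=> d; rewrite coefD; apply: HomD.
Qed.
Lemma polM y z : is_pol y -> is_pol z -> is_pol (y * z).
Proof.
move=> [p hp ->] [q hq ->]; exists (p * q); last by rewrite hornerM.
move=> d; rewrite coefM; elim/big_ind: _ => [|u v|i _]; [exact: hom_0|exact: HomD|].
have {1}-> : d = (i + (d - i))%N by rewrite subnKC // -ltnS.
exact: homM.
Qed.
Lemma pol_hom d y : hom d y -> is_pol y.
Proof.
move=> hy; exists (y%:P * 'X^d); last by rewrite hornerM hornerXn hornerC expr1n mulr1.
by move=> e; rewrite coefCM coefXn; case: eqP => [->|_]; rewrite ?mulr1 // mulr0; apply: hom_0.
Qed.
Lemma pol_coef a : is_pol (fvar ord0 a).
Proof. exact/pol_hom/hom_var. Qed.
Lemma polZ a y : is_pol y -> is_pol (a *: y).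
Proof. by rewrite scale_var; apply/polM/pol_coef. Qed.
Definition pol := @Submodule A (fn m) is_pol pol0 polD polZ.

Definition polb := bar pol.
(** Components of positive degree vanish on the diagonal, and a component of degree 0 is determined
    by its values there. *)
Lemma polb_poly y : polb y ->
  exists2 p : {poly fn m}, (forall d, hom d p`_d) /\ p`_0 = 0 & y = p.[1].
Proof.
move=> [[p hp ->] p0]; exists p => //; split=> //.
have [b bR e] := hom0P (hp 0%N); suff b0 : b = 0 by rewrite e b0 lin00.
apply/funext => n; rewrite -[RHS](p0 (n ord0)) (horner_coef_wide _ (leqnSn _)) fn_sum.
rewrite big_ord_recl big1 ?addr0 => [|i _].
  by rewrite expr0 mulr1 e fnmapE; congr (b _); apply/funext => i; rewrite ord1.
by rewrite expr1n mulr1; apply: (hom_diag (hp _)).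
Qed.
Lemma polb_intro ys D : (forall d, hom d (ys d)) -> ys 0%N = 0 -> polb (\sum_(d < D) ys d).
Proof.
move=> h y0; split; first exact: pol_intro.
move=> t; rewrite fn_sum big1 // => -[[|d] dD] _ /=; first by rewrite y0.
exact: (hom_diag (h _)).
Qed.

Lemma L1Z a y : hom 1 y -> hom 1 (a *: y). Proof. exact: homZ. Qed.
Definition L1 := @Submodule A (fn m) (fun y => hom 1 y) (hom_0 _ _) (@HomD m 1) L1Z.
Lemma L1_polb y : L1 y -> polb y.
Proof. by move=> hy; split; [apply: pol_hom hy|apply: (hom_diag hy)]. Qed.

Lemma polX y j : is_pol y -> is_pol (y ^+ j).
Proof.
move=> Py; elim: j => [|j IH]; rewrite ?expr0 ?exprS; last exact: polM.
rewrite -[1]/(qcst m 1) -[qcst m 1]mulr1; apply: (@pol_hom 0).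
by rewrite -(fnmap1 _ (pnull 0 m)); apply/homQ/HomC/Rsm_Rq/Rsm1.
Qed.
Lemma pol1 : is_pol 1. Proof. by rewrite -(expr0 0); apply/polX/pol0. Qed.
Lemma polQ c y : is_pol y -> is_pol (qcst m c * y).
Proof.
apply: polM; rewrite -[qcst m c]mulr1; apply: (@pol_hom 0); apply: homQ.
by rewrite -(fnmap1 _ (pnull 0 m)); apply/HomC/Rsm_Rq/Rsm1.
Qed.
End Fixed.

Lemma L1_closed : lg_closed (F := fnmod) L1.
Proof. by move=> m l f y; apply: hom_map. Qed.
Lemma pol_closed : lg_closed (F := fnmod) pol.
Proof.
move=> m l f y [p hp ->]; rewrite horner1_sum [lg_map _ _ _]linSS.
by apply: (@pol_intro l (fun d => fnmap ev f p`_d)) => d; apply: hom_map.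
Qed.
Definition polb_closed := bar_closed pol_closed.

Section Halve.
Fact halve_fun_lin m : linear (fun (y : fn m) => (fun n => y (halve n)) : fn m).
Proof. by move=> a y z; apply/funext => n; rewrite !fnE {1}/halve midxx. Qed.
Definition hv m : {linear fn m -> fn m} := mklin (@halve_fun_lin m).
Lemma hvE m d (y : fn m) : hom d y -> hv m y = qcst m (2^-1 ^+ d) * y.
Proof. by move=> hy; apply/funext => n; rewrite mklinE (hom_halve hy). Qed.
Lemma hv_hom m d (y : fn m) : hom d y -> hom d (hv m y).
Proof. by move=> hy; rewrite (hvE hy); apply: homQ. Qed.
Lemma hv_polb m (y : fn m) : polb m y -> polb m (hv m y).
Proof.
move=> /polb_poly[p [hp p0] ->]; rewrite horner1_sum linSS.
by apply: (@polb_intro m (fun d => hv m p`_d)) => [d|]; [apply: hv_hom|rewrite p0 lin00].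
Qed.
Definition wm m : {linear fn m -> fn (m + m)} := mklin (@wedge_mid_lin m).
Lemma wm_hom m d (y : fn m) : hom d y -> hom d (wm m y).
Proof. exact: hom_wedge_mid. Qed.
Lemma wm_polb m (y : fn m) : polb m y -> polb (m + m) (wm m y).
Proof.
move=> /polb_poly[p [hp p0] ->]; rewrite horner1_sum linSS.
apply: (@polb_intro _ (fun d => wm m p`_d)) => [d|]; last by rewrite p0 lin00.
exact: hom_wedge_mid.
Qed.
Lemma hv_nat m l (f : pmap m l) (y : fn m) : hv l (fnmap ev f y) = fnmap ev f (hv m y).
Proof.
apply/funext => n; rewrite mklinE !fnmapE mklinE; congr (y _); apply/funext => i.
by rewrite /comp /halve pfun0.
Qed.
End Halve.

Section Linear.
Variable t : lgnat (lg_sub L1_closed) (lg_sub polb_closed).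
Hypothesis tE : forall m y, val (t m y) = val y.
Local Notation Q := (lg_coker t).
Local Notation toQ m := (to_quot (im (t m))).

Let hq m : {linear Q m -> Q m} := quot_op tE (@hv_hom m 1) (@hv_polb m).
Let sq m : {linear Q m -> Q (m + m)%N} := quot_op tE (@wm_hom m 1) (@wm_polb m).

Let hq_fun m (y : lg_sub polb_closed m) : lg_sub polb_closed m :=
  @sub_op _ _ fnmod _ polb_closed m m (hv m) (@hv_polb m) y.
Let sq_fun m (y : lg_sub polb_closed m) : lg_sub polb_closed (m + m) :=
  @sub_op _ _ fnmod _ polb_closed m (m + m) (wm m) (@wm_polb m) y.
Let hqE m y : hq m (toQ m y) = toQ m (hq_fun y). Proof. exact: quot_opE. Qed.
Let sqE m y : sq m (toQ m y) = toQ (m + m)%N (sq_fun y). Proof. exact: quot_opE. Qed.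
Let mapE m l (f : pmap m l) y :
  lg_map Q f (toQ m y) = toQ l (lg_map (lg_sub polb_closed) f y).
Proof. exact: sub_coker_mapE. Qed.
Let toQ_eq m (y z : lg_sub polb_closed m) : val y = val z -> toQ m y = toQ m z.
Proof. by move/val_inj ->. Qed.

Lemma hom_sub_halve m d (y : fn m) : hom d y ->
  y - hv m y - hv m y = qcst m (1 - 2 * 2^-1 ^+ d) * y.
Proof. by move=> hy; rewrite (hvE hy); apply/funext => n; rewrite !(fnD, fnN, fnM) /fcst; ring. Qed.

(** For d = 1 the constant is 0, which is why the linear functions remain. *)
Lemma halving_const d : (1 < d)%N -> 1 - 2 * 2^-1 ^+ d != 0 :> rat.
Proof.
case: d => [|[|d]] // _; rewrite exprS mulrA mulfV // mul1r subr_eq0 eq_sym.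
by rewrite lt_eqF // exprn_ilt1 // invf_lt1.
Qed.

(** In degree d the operator 1 - 2h is multiplication by 1 - 2 * 2^-d, which is invertible for d >
    1. Degree 0 is absent because of the diagonal, and degree 1 is divided out. *)
Lemma linear_part_acyclic (P : projective_resolution (t_mod k)) : acyclic P Q.
Proof.
have hn m l (f : pmap m l) q : hq l (lg_map Q f q) = lg_map Q f (hq m q).
  have [y ->] := to_quot_surj q; rewrite mapE hqE hqE mapE.
  by apply: toQ_eq; apply: hv_nat.
apply: (@halving_acyclic k A P Q sq (@LGNat _ Q Q hq hn)).
- move=> m l f q; have [y ->] := to_quot_surj q; rewrite mapE sqE sqE mapE.
  by apply: toQ_eq; apply: wedge_mid_nat.
- move=> m q; have [y ->] := to_quot_surj q; rewrite sqE mapE.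
  apply: toQ_eq; apply/funext => n.
  rewrite -[LHS]/(val y (fun i => mid ((n \o wfold m) (winl m i)) ((n \o wfold m) (winr m i)))).
  congr (val y _); apply/funext => i; by rewrite /comp copair_winl copair_winr midxx.
- move=> m q; have [y ->] := to_quot_surj q; rewrite sqE mapE [RHS]hqE.
  apply: toQ_eq; apply/funext => n.
  rewrite -[LHS]/(val y (fun i => mid ((n \o wretl m) (winl m i)) ((n \o wretl m) (winr m i)))).
  congr (val y _); apply/funext => i; by rewrite /comp copair_winl copair_winr.
- move=> m q; have [y ->] := to_quot_surj q; rewrite sqE mapE [RHS]hqE.
  apply: toQ_eq; apply/funext => n.
  rewrite -[LHS]/(val y (fun i => mid ((n \o wretr m) (winl m i)) ((n \o wretr m) (winr m i)))).
  congr (val y _); apply/funext => i; rewrite /comp copair_winl copair_winr /halve.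
  by apply/val_inj; rewrite !midE addrC.
- move=> m q; have [y ->] := to_quot_surj q; rewrite -[LGNat _ m]/(hq m) hqE -!to_quotB.
  move=> /(sub_coker_eq0 tE) yl; apply/(sub_coker_eq0 tE).
  have {}yl : hom 1 (val y - hv m (val y) - hv m (val y)) by [].
  have [p [hp p0] yE] := polb_poly (submodP y); rewrite yE horner1_sum in yl *.
  pose c d : rat := 1 - 2 * 2^-1 ^+ d.
  (* [D] exceeds 1 whatever the size of [p], so degree 1 is among the indices. Subtracting the
     linear function [l] there yields a vanishing sum of homogeneous terms, and independence
     applies. *)
  set l := (X in hom 1 X) in yl; pose D := (size p).+2.
  pose ys d := qcst m (c d) * p`_d - (if d == 1%N then l else 0).
  have hys d : hom d (ys d).
    rewrite /ys; case: eqP => [->|_]; rewrite ?subr0; last exact: homQ.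
    by apply: HomD; [apply: homQ|apply: homN].
  have lE : l = \sum_(d < D) qcst m (c d) * p`_d.
    rewrite /l -horner1_sum (horner_coef_wide (n := D)) ?leqW // linSS -!sumrB.
    by apply: eq_bigr => d _; rewrite expr1n mulr1 (hom_sub_halve (hp d)).
  have ys0 : \sum_(d < D) ys d = 0.
    rewrite /ys sumrB -lE (bigD1 (inord 1)) //= inordK // eqxx big1 ?addr0 ?subrr // => d dn.
    by case: eqP => // d1; case/eqP: dn; apply/val_inj; rewrite /= inordK.
  have yz := hom_independent hys ys0.
  apply: (sm_sum (S := L1 m)) => d _; have [->|d1] := eqVneq (val d) 1%N; first exact: hp.
  suff -> : p`_d = 0 by apply: hom_0.
  case d0 : (val d) => [|[|e]]; rewrite ?d0 // in d1 *.
  have := yz d (leqW (leqW (ltn_ord d))); rewrite /ys d0 /= subr0 => e0.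
  apply/funext => n; have /eqP := congr1 (fun g : fn m => g n) e0.
  by rewrite fnM mulf_eq0 (negPf (halving_const _)) //= => /eqP.
- move=> m q; have [y ->] := to_quot_surj q.
  have [p [hp p0] yE] := polb_poly (submodP y).
  (* The inverse of 1 - 2h in degrees above 1; what it misses is of degree 1, the component of
     degree 0 being zero. *)
  pose c d : rat := if (d <= 1)%N then 0 else (1 - 2 * 2^-1 ^+ d)^-1.
  pose x := \sum_(d < size p) qcst m (c d) * p`_d.
  have Px : polb m x.
    by apply: (@polb_intro m (fun d => qcst m (c d) * p`_d)) => [d|];
      [apply: homQ|rewrite p0 mulr0].
  exists (to_quot (im (t m)) (to_submod Px : lg_sub polb_closed m)); apply/eqP.
  rewrite -subr_eq0 -[LGNat _ m]/(hq m) hqE -!to_quotB; apply/eqP/(sub_coker_eq0 tE).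
  suff: hom 1 (val y - (x - hv m x - hv m x)) by [].
  rewrite yE horner1_sum /x !(linSS (hv m)) -!sumrB; apply: (sm_sum (S := L1 m)) => d _.
  rewrite (hom_sub_halve (homQ (c d) (hp d))).
  have -> : p`_d - qcst m (1 - 2 * 2^-1 ^+ d) * (qcst m (c d) * p`_d) =
      qcst m (1 - (1 - 2 * 2^-1 ^+ d) * c d) * p`_d.
    by apply/funext => n; rewrite !(fnD, fnN, fnM) /fcst; ring.
  have [d1|d1] := leqP d 1; last first.
    rewrite /c leqNgt d1 /= mulfV ?subrr ?halving_const //.
    have -> : qcst m 0 * p`_d = 0 by apply/funext => n; rewrite fnM /fcst mul0r.
    exact: hom_0.
  case: (val d) d1 => [|[|//]] _; last exact: homQ.
  by rewrite p0 mulr0; apply: hom_0.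
Qed.
End Linear.

(** * From linear functions back to tensor powers *)

Hypothesis frob : forall (p : nat) (a : A), prime p -> exists b, a ^+ p - a = b *+ p.
Variable w : A.
Hypothesis ew : forall n, ev n w = val n.
Hypothesis den : forall a, exists j v (f : {poly rat}),
  v * w ^+ j = 1 /\ forall n, val n ^+ j * ev n a = f.[val n].

Definition RP m := bar (sm_cap (Rsm m) (pol m)).
Fact RP_closed : lg_closed (F := fnmod) RP.
Proof.
apply: bar_closed => m l f y [yR yP].
by split; [apply: Rsm_closed|apply: pol_closed].
Qed.
Fact RP_diag m (y : fn m) : RP m y -> diag0 y. Proof. by case. Qed.
Fact RP_M m (y z : fn m) : RP m y -> RP m z -> RP m (y * z).
Proof.
by move=> [[yR yP] _] [[zR zP] z0]; split; [split; [apply: RsmM|apply: polM]|apply: diag0M].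
Qed.

Lemma pol_var m (i : 'I_m.+1) : pol m (fvar i w).
Proof.
have -> : fvar i w = xv i + fvar ord0 w.
  by apply/funext => n; rewrite fnD /xv /fvar !ew subrK.
apply: polD; last exact: pol_coef.
by apply: (@pol_hom _ 1); rewrite -[xv i]mul1r -(fnmap1 _ (pnull 0 m)); apply/HomX/HomC/Rsm_Rq/Rsm1.
Qed.

Lemma pol_horner m (i : 'I_m.+1) (f : {poly rat}) : pol m (fun n => f.[val (n i)]).
Proof.
have -> : (fun n => f.[val (n i)]) = \sum_(d < size f) qcst m f`_d * fvar i w ^+ d.
  apply/funext => n; rewrite fn_sum horner_coef; apply: eq_bigr => d _.
  by rewrite fnM fnX /fvar ew.
by apply: sm_sum => d _; apply/polQ/polX/pol_var.
Qed.

Definition prodw m : fn m := \prod_(i < m) fvar (fintype.lift ord0 i) w.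
Arguments prodw : clear implicits.
Lemma pol_prodw m : pol m (prodw m).
Proof. by apply: (big_ind (is_pol (m := m))); [apply: pol1|apply: polM|move=> i _; apply: pol_var]. Qed.
Lemma Rsm_prodw m : Rsm m (prodw m).
Proof. by apply: big_ind; [apply: Rsm1|apply: RsmM|move=> i _; apply: Rsm_var]. Qed.

(** The witness [v] is the inverse of w^j in [A]. When [A] contains only polynomials, j = 0
    serves. *)
Definition clears m (y : fn m) := exists j v, v * w ^+ j = 1 /\ pol m (prodw m ^+ j * y).

Lemma clears_M m (y z : fn m) : clears y -> clears z -> clears (y * z).
Proof.
move=> [i [u [ui Py]]] [j [v [vj Pz]]]; exists (i + j)%N, (u * v).
by rewrite exprD mulrACA ui vj mulr1 exprD mulrACA; split=> //; apply: polM.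
Qed.
Lemma clears_pol m (y : fn m) : pol m y -> clears y.
Proof. by move=> Py; exists 0%N, 1; rewrite !expr0 !mul1r. Qed.
Lemma clears_D m (y z : fn m) : clears y -> clears z -> clears (y + z).
Proof.
move=> [i [u [ui Py]]] [j [v [vj Pz]]]; exists (i + j)%N, (u * v).
rewrite exprD mulrACA ui vj mulr1; split=> //; rewrite exprD mulrDr; apply: polD.
  by rewrite mulrAC; apply: polM => //; apply/polX/pol_prodw.
by rewrite -mulrA; apply: polM => //; apply/polX/pol_prodw.
Qed.
Lemma clears_var m (i : 'I_m.+1) a : clears (fvar i a).
Proof.
case: (unliftP ord0 i) => [l ->|->]; last exact/clears_pol/pol_coef.
have [j [v [f [vj fE]]]] := den a; exists j, v; split=> //.
have -> : prodw m ^+ j * fvar (fintype.lift ord0 l) a =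
    (\prod_(i < m | i != l) fvar (fintype.lift ord0 i) w) ^+ j *
    (fun n => f.[val (n (fintype.lift ord0 l))]).
  rewrite /prodw (bigD1 l) //= exprMn mulrAC mulrC; congr (_ * _).
  by apply/funext => n; rewrite fnM fnX /fvar ew fE.
apply: polM; last exact: pol_horner.
by apply: polX; apply: (big_ind (is_pol (m := m))); [apply: pol1|apply: polM|move=> i' _; apply: pol_var].
Qed.

Lemma clears_Rsm m (y : fn m) : Rsm m y -> clears y.
Proof.
have c0 : clears (0 : fn m) by apply/clears_pol/pol0.
have cZ a (z : fn m) : clears z -> clears (a *: z).
  by rewrite scale_var; apply/clears_M/clears_pol/pol_coef.
apply: (Rsm_ind (S := @Submodule A (fn m) (@clears m) c0 (@clears_D m) cZ)) => a /=.
rewrite tprod_var; apply: (big_ind (@clears m)); [|exact: clears_M|by move=> i _; apply: clears_var].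
exact/clears_pol/pol1.
Qed.

Lemma clears_Rq m (y : fn m) : Rq m y -> clears y.
Proof.
move=> [N N0 /clears_Rsm[j [v [vj Pz]]]]; exists j, v; split=> //.
have -> : prodw m ^+ j * y = qcst m N%:R^-1 * (prodw m ^+ j * (y *+ N)).
  apply/funext => n; rewrite !fnM fnMn -[qcst m _ n]/(N%:R^-1).
  have N0' : N%:R != 0 :> rat by rewrite pnatr_eq0 -lt0n.
  by field.
exact: polQ.
Qed.

Lemma polb_barRq m (y : fn m) : polb m y -> bar (Rq m) y.
Proof.
move=> [[p hp ->] y0]; split=> //; rewrite horner1_sum; apply: sm_sum => d _.
exact: hom_Rq ew _ _ _ (hp d).
Qed.

(** Take x = 1 - v(n_0)^m (w_1 ... w_m)^j, where v is the inverse of w^j. On the diagonal the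
    product is 1, so x vanishes; and (1 - x) y is polynomial because the power of w_1 ... w_m clears
    the denominators of y. *)
Lemma unit_poly m (y : fn m) : bar (Rq m) y -> exists2 x, RP m x & polb m (y - x * y).
Proof.
move=> [yR y0]; have [j [v [vj Py]]] := clears_Rq yR.
pose x := 1 - fvar ord0 (v ^+ m) * prodw m ^+ j; exists x; last first.
  split=> [|t]; last by rewrite fnD fnN fnM y0 mulr0 subrr.
  have -> : y - x * y = fvar ord0 (v ^+ m) * (prodw m ^+ j * y) by rewrite /x; ring.
  by apply: polM => //; apply: pol_coef.
split=> [|t].
  split; apply: smB; [exact: Rsm1| |exact: pol1|].
    by apply: RsmM; [apply: Rsm_var|apply/RsmX/Rsm_prodw].
  by apply: polM; [apply: pol_coef|apply/polX/pol_prodw].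
rewrite /x fnD fnN fnM fnX /prodw fn_prod /fvar prodr_const card_ord -!rmorphXn -rmorphM.
by rewrite -exprM mulnC exprM -exprMn vj expr1n rmorph1 subrr.
Qed.

Lemma unit_int m (y : fn m) : bar (Rq m) y ->
  exists2 x, bar (Rsm m) x & bar (Rsm m) (y - x * y).
Proof.
move=> [[N N0 yN] y0].
have zb : bar (Rsm m) (y *+ N) by split=> // t; rewrite fnMn y0 mul0rn.
have [x xb [y' yR' e]] := unit_mod frob N0 zb; exists x => //.
split=> [|t]; last by rewrite fnD fnN fnM y0 mulr0 subrr.
suff -> : y - x * y = y' by [].
apply/eqP; rewrite -subr_eq0; apply/eqP; apply: (fn_torsion_free N0).
by rewrite !mulrnBl -mulrnAr e subrr.
Qed.

(** The chain is [L1], [polb], [bar Rq], [bar Rsm], [Rsm], and finally the tensor power itself.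
    Every inclusion has an acyclic cokernel; they point upwards except for that of [bar Rsm] in
    [bar Rq], so the transfer goes down at that place and again along the isomorphism with [Rsm]. *)
Theorem concentrated_loday (P : projective_resolution (t_mod k)) (B : lmodType A) :
  concentrated P B (lg_sub L1_closed) -> concentrated P B (loday A).
Proof.
move=> c1.
have [t1 t1E] := psub_rel (F := fnmod) L1_polb L1_closed polb_closed.
have c2 := concentrated_ext (sub_nat_inj t1E) (linear_part_acyclic t1E (P := P)) c1.
have [t2 t2E] := psub_rel (F := fnmod) polb_barRq polb_closed Rqb_closed.
have c3 : concentrated P B (lg_sub Rqb_closed).
  apply: (concentrated_ext (sub_nat_inj t2E) _ c2).
  apply: (pair_acyclic RP_closed RP_diag RP_M _ _ unit_poly t2E).
    by move=> m y z [[_ yP] _] [zP z0]; split; [apply: polM|apply: diag0M].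
  by move=> m y z [[yR _] y0] [zR z0]; split; [apply: RqM|apply: diag0M].
have RbRqb m (y : fn m) : bar (Rsm m) y -> bar (Rq m) y.
  by move=> [yR y0]; split=> //; apply: Rsm_Rq.
have [t3 t3E] := psub_rel (F := fnmod) RbRqb Rb_closed Rqb_closed.
have c4 : concentrated P B (lg_sub Rb_closed).
  apply: (concentrated_sub (sub_nat_inj t3E) _ c3).
  apply: (pair_acyclic Rb_closed _ _ _ _ unit_int t3E).
  - by move=> m y [].
  - by move=> m y z [yR _] zb; apply: Rb_ideal.
  - by move=> m y z [yR _] zb; apply: Rb_ideal.
  - by move=> m y z [yR y0] [zR z0]; split; [apply: RqM|apply: diag0M].
have RbR m (y : fn m) : bar (Rsm m) y -> Rsm m y by case.
have [t4 t4E] := psub_rel (F := fnmod) RbR Rb_closed Rsm_closed.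
have c5 : concentrated P B (lg_sub Rsm_closed).
  apply: (concentrated_ext (sub_nat_inj t4E) _ c4).
  apply: constant_acyclic => m q; have [y ->] := to_quot_surj q.
  rewrite (sub_coker_mapE t4); apply/eqP; rewrite -subr_eq0 -to_quotB.
  apply/eqP/(sub_coker_eq0 t4E).
  suff: bar (Rsm m) (fnmap ev (pnull m m) (val y) - val y) by [].
  split=> [|t]; last by rewrite fnD fnN fnmapE subrr.
  by apply: smB; [apply: Rsm_closed; apply: submodP|apply: submodP].
pose f m : {linear loday A m -> lg_sub Rsm_closed m} :=
  corestrict (S := Rsm m) (f := tfun ev_scal m) (fun z => ex_intro _ z erefl).
have fN m l (u : pmap m l) z : f l (lg_map (loday A) u z) =
    lg_map (lg_sub Rsm_closed) u (f m z).
  by apply/val_inj; apply: tfun_nat.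
pose t5 := @LGNat _ (loday A) (lg_sub Rsm_closed) _ fN.
apply: (concentrated_sub (t := t5) _ _ c5).
  by move=> m x y /(congr1 val); apply: tfun_inj.
apply: acyclic0 => m q; have [y ->] := to_quot_surj q; apply/to_quot_eq0.
have [z e] := submodP y; exists z; apply/val_inj; exact: e.
Qed.

(** * Homology of the linear part *)

Section LinearPart.
Local Notation F := (lg_sub L1_closed).
(** The module A (x) Q, realized as functions of one point that have a positive multiple in the
    image of [A]. *)
Definition lin_coef : lmodType A := submod_type (Rq 0).
Local Notation B := lin_coef.
Local Notation con m := (fnmap ev (pnull 0 m)).

(** At this point the i-th difference is 1 and the others are 0, so evaluation reads off the i-th
    coefficient of a linear function. For i = 0, where the difference is identically 0, [coord] is
    set to 0. *)
Definition ctest m (i : 'I_m.+1) (n : 'I_1 -> point) : 'I_m.+1 -> point :=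
  fun j => if j == i then psucc (n ord0) else n ord0.
Definition coord m (i : 'I_m.+1) (y : fn m) : fn 0 :=
  if i == ord0 then 0 else fun n => y (ctest i n).

Fact coord_lin m (i : 'I_m.+1) : linear (coord i).
Proof.
move=> a y z; rewrite /coord; case: eqP => [_|/eqP i0]; first by rewrite scaler0 addr0.
by apply/funext => n; rewrite !fnE /ctest eq_sym (negPf i0).
Qed.

Lemma xv0 m : xv (ord0 : 'I_m.+1) = 0.
Proof. by apply/funext => n; rewrite /xv subrr. Qed.

Lemma coord_xv m (i j : 'I_m.+1) b : coord i (con m b * xv j) = if (i != ord0) && (i == j) then b else 0.
Proof.
rewrite /coord; case: eqP => // /eqP i0; apply/funext => n; rewrite fnM.
have -> : con m b (ctest i n) = b n.
  by rewrite fnmapE; congr (b _); apply/funext => l; rewrite /ctest /= eq_sym (negPf i0) [l]ord1.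
rewrite /xv /ctest /= [ord0 == i]eq_sym (negPf i0) eq_sym.
by case: eqP => _; rewrite ?subrr ?mulr0 //= addrC addKr mulr1.
Qed.

Lemma hom1_coord m (y : fn m) : hom 1 y ->
  y = \sum_i con m (coord i y) * xv i /\ forall i, Rq 0 (coord i y).
Proof.
move=> hy; pose Q (y : fn m) := y = \sum_i con m (coord i y) * xv i /\ forall i, Rq 0 (coord i y).
suff H d : hom d y -> d = 1%N -> Q y by apply: H hy _.
elim=> {y hy d}[//|d y j + _ [d0]|d y z _ IHy _ IHz d1].
  rewrite d0 => /hom0P[b bR ->]; split=> [|i].
    rewrite (bigD1 j) //= coord_xv eqxx andbT big1 ?addr0 => [|i ij].
      by case: eqP => //= ->; rewrite xv0 !mulr0.
    by rewrite coord_xv (negPf ij) andbF; apply: mul0r.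
  by rewrite coord_xv; case: ifP => // _; apply: sm0.
have [ey Ry] := IHy d1; have [ez Rz] := IHz d1.
have cD i : coord i (y + z) = coord i y + coord i z := linDD (mklin (coord_lin i)) y z.
split=> [|i]; last by rewrite cD; apply: smD.
rewrite {1}ey {1}ez -big_split; apply: eq_bigr => i _.
by rewrite cD linDD mulrDl.
Qed.

(** Coefficients add up over the fibres. The base point is excluded, as the terms that it receives
    disappear. *)
Lemma coord_map m l (f : pmap m l) (y : fn m) (j : 'I_l.+1) : hom 1 y -> j != ord0 ->
  coord j (fnmap ev f y) = \sum_(i | f i == j) coord i y.
Proof.
move=> /hom1_coord[ey _] j0; rewrite {1}ey linSS.
have -> : coord j (\sum_i fnmap ev f (con m (coord i y) * xv i)) =
    \sum_i coord j (fnmap ev f (con m (coord i y) * xv i)) by exact: (linSS (mklin (coord_lin j))).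
rewrite [RHS]big_mkcond; apply: eq_bigr => i _.
have -> : fnmap ev f (con m (coord i y) * xv i) = con l (coord i y) * xv (f i).
  rewrite fnmapM; congr (_ * _); last by apply/funext => n; rewrite fnmapE /xv /= pfun0.
  by rewrite -[LHS]/((fnmap ev f \o con m) _) -fnmap_comp pnullf.
by rewrite coord_xv j0 eq_sym.
Qed.

Definition coordL m (i : 'I_m.+1) : {linear F m -> B} :=
  corestrict (f := mklin (coord_lin i) \o sm_incl (L1 m))
    (fun y => (hom1_coord (submodP y)).2 i).

Fact emb_subproof (b : B) : hom 1 (con 1 (val b) * xv (ord_max : 'I_2)).
Proof. exact/HomX/HomC/submodP. Qed.
Definition emb_fun (b : B) : F 1%N := @to_submod _ _ (L1 1) _ (emb_subproof b).
Fact emb_lin : linear emb_fun.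
Proof.
move=> a b c; apply/val_inj; rewrite [RHS]linearP.
transitivity (con 1 (a *: val b + val c) * xv (ord_max : 'I_2)).
  by congr (con 1 _ * _); exact: (submod_val_lin a b c).
by rewrite linDD linZZ mulrDl fnZM.
Qed.
Definition emb : {linear B -> F 1%N} := mklin emb_lin.

Fact pick1_subproof m (i : 'I_m.+1) : (if (ord0 : 'I_2) == ord0 then ord0 else i) = ord0.
Proof. by rewrite eqxx. Qed.
Definition pick1 m (i : 'I_m.+1) : pmap 1 m :=
  PMap (pick1_subproof i : (fun j : 'I_2 => if j == ord0 then ord0 else i) ord0 = ord0).
Lemma pick1_0 m : pick1 (ord0 : 'I_m.+1) = pnull 1 m.
Proof. by apply: pmap_eq => j /=; rewrite if_same. Qed.
Lemma pick1_comp m l (f : pmap m l) i : pcomp f (pick1 i) = pick1 (f i).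
Proof. by apply: pmap_eq => j /=; case: ifP => // _; rewrite pfun0. Qed.

Lemma coord_emb i (b : B) : coordL i (emb b) = if i != ord0 then b else 0.
Proof.
apply/val_inj; rewrite -[LHS]/(coord i (con 1 (val b) * xv (ord_max : 'I_2))) coord_xv.
by case: (ord2P i) => ->.
Qed.

Lemma emb_coord m (y : F m) :
  y = \sum_i (lg_map F (pick1 i) (emb (coordL i y)) - lg_map F (pnull 1 m) (emb (coordL i y))).
Proof.
apply/val_inj; have [e _] := hom1_coord (submodP y); rewrite {1}e.
have -> (I : finType) (G : I -> F m) : val (\sum_i G i) = \sum_i val (G i).
  exact: (linSS (sm_incl _)).
apply: eq_bigr => i _.
have me (f : pmap 1 m) (b : B) : val (lg_map F f (emb b)) = con m (val b) * xv (f ord_max).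
  rewrite -[LHS]/(fnmap ev f (con 1 (val b) * xv (ord_max : 'I_2))) fnmapM.
  congr (_ * _); last by apply/funext => n; rewrite fnmapE /xv /= pfun0.
  by rewrite -[LHS]/((fnmap ev f \o con 1) _) -fnmap_comp pnullf.
have -> : val (lg_map F (pick1 i) (emb (coordL i y)) - lg_map F (pnull 1 m) (emb (coordL i y))) =
  val (lg_map F (pick1 i) (emb (coordL i y))) - val (lg_map F (pnull 1 m) (emb (coordL i y))).
  exact: (linBB (sm_incl _)).
by rewrite !me /= xv0 mulr0 subr0.
Qed.
Local Notation crd i := (coordL i).

Section Dif.
Variable N : rgmod k.
(** The counterpart on [N] of the expansion [emb_coord]: across the coend relation, the i-th term
    moves to [dif i x] paired with the i-th coefficient. *)
Definition dif m (i : 'I_m.+1) : {linear N m -> N 1%N} :=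
  rg_map N (pick1 i) \- rg_map N (pnull 1 m).
Lemma dif0 m x : dif (ord0 : 'I_m.+1) x = 0.
Proof. by rewrite -[LHS]/(rg_map N (pick1 ord0) x - rg_map N (pnull 1 m) x) pick1_0 subrr. Qed.
Lemma dif_map m l (f : pmap m l) i x : dif i (rg_map N f x) = dif (f i) x.
Proof.
rewrite -[LHS]/((rg_map N (pick1 i) \o rg_map N f) x - (rg_map N (pnull 1 m) \o rg_map N f) x).
by rewrite -!rg_comp pick1_comp pnullf.
Qed.
End Dif.

Lemma dif_nat (N N' : rgmod k) (u : rgnat N N') m (i : 'I_m.+1) x :
  u 1%N (dif N i x) = dif N' i (u m x).
Proof.
rewrite -[dif N i x]/(rg_map N (pick1 i) x - rg_map N (pnull 1 m) x) linBB.
by rewrite !rgn_nat.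
Qed.

Section Eval.
Variables (N : rgmod k) (M : lmodType A) (T : N 1%N -> B -> M).
Hypothesis TDl : forall p p' b, T (p + p') b = T p b + T p' b.
Hypothesis TDr : forall p b b', T p (b + b') = T p b + T p b'.
Hypothesis TZl : forall c p b, T (c *: p) b = c%:A *: T p b.
Hypothesis TZr : forall a p b, T p (a *: b) = a *: T p b.

(** [F] is [B] tensored with the reduced free functor on pointed sets, so its coend with [N] is the
    reduced part of the value of [N] at [1], tensored with [B]. A bilinear [T] therefore gives a map
    out of it. *)
Definition lin_eval_fun m (x : N m) (y : F m) : M := \sum_i T (dif N i x) (crd i y).
Fact lin_eval_bal : balanced lin_eval_fun.
Proof.
have T0 b : T 0 b = 0 by apply: (addrI (T 0 b)); rewrite -TDl !addr0.
have TS p I (r : seq I) (Q : pred I) (G : I -> B) :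
    T p (\sum_(i <- r | Q i) G i) = \sum_(i <- r | Q i) T p (G i).
  apply: (big_morph (T p)) => [x y|]; first exact: TDr.
  by apply: (addrI (T p 0)); rewrite -TDr !addr0.
split; rewrite /lin_eval_fun.
- by move=> m x x' y; rewrite -big_split; apply: eq_bigr => i _; rewrite linDD TDl.
- by move=> m x y y'; rewrite -big_split; apply: eq_bigr => i _; rewrite linDD TDr.
- by move=> m c x y; rewrite scaler_sumr; apply: eq_bigr => i _; rewrite linZZ TZl.
- by move=> m a x y; rewrite scaler_sumr; apply: eq_bigr => i _; rewrite linZZ TZr.
- move=> m l f x y; rewrite (partition_big f predT) //; apply: eq_bigr => j _.
  have [->|j0] := eqVneq j ord0.
    by rewrite dif0 T0 big1 // => i /eqP fi; rewrite dif_map fi dif0 T0.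
  have -> : crd j (lg_map F f y) = \sum_(i | f i == j) crd i y.
    apply/val_inj; rewrite [RHS](linSS (sm_incl _)).
    exact: (coord_map f (submodP y) j0).
  by rewrite TS; apply: eq_bigr => i /eqP fi; rewrite dif_map fi.
Qed.
Definition lin_eval : {linear coend N F -> M} := coend_lift lin_eval_bal.
Lemma lin_evalE m (x : N m) (y : F m) : lin_eval (cpure x y) = \sum_i T (dif N i x) (crd i y).
Proof. exact: coend_liftE. Qed.
End Eval.

Section Homotopy.
Variables (N N' : rgmod k) (s : {linear N 1%N -> N' 1%N}).
Let T (p : N 1%N) (b : B) : coend N' F := cpure (s p) (emb b).
Fact lin_homotopy_Dl p p' b : T (p + p') b = T p b + T p' b.
Proof. by rewrite /T linDD cpureDl. Qed.
Fact lin_homotopy_Dr p b b' : T p (b + b') = T p b + T p b'.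
Proof. by rewrite /T linDD cpureDr. Qed.
Fact lin_homotopy_Zl c p b : T (c *: p) b = c%:A *: T p b.
Proof. by rewrite /T linZZ cpureZl. Qed.
Fact lin_homotopy_Zr a p b : T p (a *: b) = a *: T p b.
Proof. by rewrite /T linZZ cpureZr. Qed.
Definition lin_homotopy : {linear coend N F -> coend N' F} :=
  lin_eval lin_homotopy_Dl lin_homotopy_Dr lin_homotopy_Zl lin_homotopy_Zr.
Lemma lin_homotopyE m (x : N m) (y : F m) :
  lin_homotopy (cpure x y) = \sum_i cpure (s (dif N i x)) (emb (crd i y)).
Proof. exact: lin_evalE. Qed.
End Homotopy.
Arguments lin_homotopy : simpl never.

Lemma sum_dif (N : rgmod k) m (x : N m) (y : F m) :
  \sum_i cpure (dif N i x) (emb (crd i y)) = cpure x y.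
Proof.
rewrite [in RHS](emb_coord y).
have cS (G : 'I_m.+1 -> F m) : cpure x (\sum_i G i) = \sum_i cpure x (G i).
  by apply: (big_morph (@cpure _ _ N F m x)) => [a b|]; [apply: cpureDr|apply: cpure0r].
rewrite cS; apply: eq_bigr => i _.
rewrite cpureDr cpureNr -!cpure_nat -cpureNl -cpureDl.
by congr (cpure _ _).
Qed.

Variable P : projective_resolution (t_mod k).
Local Notation cx := (coend_complex (A := A) P F).
Local Notation d n := (cc_d cx n).

(** Applying a contraction of the resolution at [1] to each [dif i x] contracts the coend
    complex. *)
Lemma d_lin_homotopy n (s : {linear P n 1%N -> P n.+1 1%N})
    (s' : {linear P n.+1 1%N -> P n.+2 1%N}) z :
  (forall x, res_d P n.+1 1 (s' x) = x - s (res_d P n 1 x)) ->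
  d n.+1 (lin_homotopy s' z) = z - lin_homotopy s (d n z).
Proof.
move=> s'E; apply: (coend_ext (g := d n.+1 \o lin_homotopy s')
  (h := idfun \- (lin_homotopy s \o d n))) => m x y.
transitivity (coend_map F (res_d P n.+1) (lin_homotopy s' (cpure x y))) => //.
transitivity (cpure x y - lin_homotopy s (coend_map F (res_d P n) (cpure x y))) => //.
rewrite coend_mapE' !lin_homotopyE linSS -[X in X - _]sum_dif -sumrB.
by apply: eq_bigr => i _; rewrite coend_mapE' s'E cpureDl cpureNl dif_nat.
Qed.

Let T (p : P 0 1%N) (b : B) : B := (aug1 p)%:A *: b.
Let aug1D (p p' : P 0 1%N) : aug1 (p + p') = aug1 p + aug1 p'.
Proof. exact: (linDD (mklin (@aug1_lin _ P))). Qed.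
Let aug1Z c (p : P 0 1%N) : aug1 (c *: p) = c * aug1 p.
Proof. exact: (linZZ (mklin (@aug1_lin _ P))). Qed.
Fact lin_aug_Dl p p' b : T (p + p') b = T p b + T p' b.
Proof. by rewrite /T aug1D !scalerDl. Qed.
Fact lin_aug_Dr p b b' : T p (b + b') = T p b + T p b'.
Proof. exact: scalerDr. Qed.
Fact lin_aug_Zl c p b : T (c *: p) b = c%:A *: T p b.
Proof. by rewrite /T aug1Z scalerA mulr_algl scalerA. Qed.
Fact lin_aug_Zr a p b : T p (a *: b) = a *: T p b.
Proof. by rewrite /T !scalerA mulrC. Qed.
Definition lin_aug : {linear cx 0 -> B} :=
  lin_eval lin_aug_Dl lin_aug_Dr lin_aug_Zl lin_aug_Zr.
Lemma lin_augE m (x : P 0 m) (y : F m) :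
  lin_aug (cpure x y) = \sum_i (aug1 (dif (P 0) i x))%:A *: crd i y.
Proof. exact: (lin_evalE lin_aug_Dl lin_aug_Dr lin_aug_Zl lin_aug_Zr). Qed.

Lemma lin_aug_d z : lin_aug (d 0 z) = 0.
Proof.
apply: (coend_ext (g := lin_aug \o d 0) (h := \0)) => m x y.
transitivity (lin_aug (coend_map F (res_d P 0) (cpure x y))) => //.
rewrite coend_mapE' lin_augE big1 // => i _.
rewrite -dif_nat /aug1.
have /res_exact0 -> : exists y', res_d P 0 1 (dif (P 1) i x) = res_d P 0 1 y' by eexists.
by rewrite /= ffunE scale0r scale0r.
Qed.

Section Degree0.
Variables (u : P 0 1%N) (s : {linear P 0 1%N -> P 1 1%N}).
Hypothesis u1 : aug1 u = 1.
Hypothesis sE : forall x, res_d P 0 1 (s x) = x - aug1 x *: u.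

Lemma d_lin_homotopy0 z : d 0 (lin_homotopy s z) = z - cpure u (emb (lin_aug z)).
Proof.
have iota_lin : linear (fun b : B => cpure u (emb b)).
  by move=> a b c; rewrite linDD linZZ cpureDr cpureZr.
apply: (coend_ext (g := d 0 \o lin_homotopy s)
  (h := idfun \- (mklin iota_lin \o lin_aug))) => m x y.
transitivity (coend_map F (res_d P 0) (lin_homotopy s (cpure x y))) => //.
transitivity (cpure x y - mklin iota_lin (lin_aug (cpure x y))) => //.
rewrite lin_homotopyE lin_augE (linSS (coend_map F (res_d P 0))) (linSS (mklin iota_lin)) -(sum_dif x y) -sumrB.
by apply: eq_bigr => i _; rewrite coend_mapE' sE cpureDl cpureNl cpureZl (linZZ (mklin iota_lin)).
Qed.

Lemma lin_aug_emb b : lin_aug (cpure u (emb b)) = b.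
Proof.
rewrite lin_augE big_ord_recl big_ord1 dif0.
have -> : fintype.lift ord0 ord0 = ord_max :> 'I_2 by apply/val_inj.
rewrite !coord_emb -[dif _ ord_max _]/(rg_map (P 0) (pick1 ord_max) u - rg_map (P 0) (pnull 1 1) u).
have -> : pick1 (ord_max : 'I_2) = pid 1.
  by apply: pmap_eq => j; case: (ord2P j) => ->.
rewrite rg_id.
have -> : aug1 (u - rg_map (P 0) (pnull 1 1) u) = 1.
  have -> : aug1 (u - rg_map (P 0) (pnull 1 1) u) = aug1 u - aug1 (rg_map (P 0) (pnull 1 1) u).
    exact: (linBB (mklin (@aug1_lin _ P))).
  rewrite u1 {1}/aug1 rgn_nat /= ffunE.
  by have -> : val (res_aug P 1 u) ord0 = 0 := submodP (res_aug P 1 u); rewrite subr0.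
by rewrite scaler0 add0r !scale1r.
Qed.
End Degree0.

Theorem concentrated_linear_part : concentrated P B F.
Proof.
split=> [n z zc|].
  have [s sE] := @split_ex _ P n; have [s' s'E] := split_step sE.
  exists (lin_homotopy s' z).
  by rewrite (d_lin_homotopy _ s'E) [d n z]zc lin00 subr0.
have [u u1 uE] := @aug1_gen _ P; have [s sE] := split0 uE.
have q0 : lin_aug (0 : cx 0) = 0 by apply: lin00.
have qD (x y : cx 0 * B) : lin_aug x.1 = x.2 -> lin_aug y.1 = y.2 -> lin_aug (x + y).1 = (x + y).2.
  by move=> ex ey; rewrite (linDD lin_aug) ex ey.
have qZ a (x : cx 0 * B) : lin_aug x.1 = x.2 -> lin_aug (a *: x).1 = (a *: x).2.
  by move=> ex; rewrite (linZZ lin_aug) ex.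
exists (@Submodule _ _ (fun x : cx 0 * B => lin_aug x.1 = x.2) q0 qD qZ); split.
- by move=> z; exists (lin_aug z).
- by move=> v; exists (cpure u (emb v)); apply: lin_aug_emb.
- move=> z; split=> [z0|[z' ->]]; last exact: lin_aug_d.
  exists (lin_homotopy s z); rewrite (d_lin_homotopy0 sE).
  by rewrite [lin_aug z]z0 lin00 cpure0r subr0.
- by move=> v /esym e; exact: etrans e q0.
Qed.
End LinearPart.

(** * A (x) Q as a telescope *)

Section Cohomology.
Variable q : nat -> nat.
Hypothesis q_gt0 : forall n, (0 < q n)%N.
Hypothesis cofinal : forall N, (0 < N)%N -> exists n (c : A), c *+ N = (modulus q n)%:R.
Local Notation M := (modulus q).
Local Notation B := lin_coef.

Lemma modulus_gt0 n : (0 < M n)%N.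
Proof. by rewrite prodn_gt0. Qed.
Lemma modulusS n : M n.+1 = (M n * q n)%N.
Proof. by rewrite /modulus big_ord_recr. Qed.
Lemma modulus_neq0 n : (M n)%:R != 0 :> rat.
Proof. by rewrite pnatr_eq0 -lt0n modulus_gt0. Qed.

Fact frac_subproof n : Rq 0 (fcst 0 (M n)%:R^-1 * 1).
Proof. exact/Rq_cst/Rsm_Rq/Rsm1. Qed.
Definition frac n : B := to_submod (frac_subproof n).

Lemma fracE n t : val (frac n) t = (M n)%:R^-1.
Proof. exact: mulr1. Qed.

Lemma frac_q n : frac n.+1 *+ q n = frac n.
Proof.
apply/val_inj; have -> : val (frac n.+1 *+ q n) = val (frac n.+1) *+ q n.
  exact: (linMn (sm_incl (Rq 0))).
apply/funext => t; rewrite fnMn !fracE modulusS natrM.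
have := modulus_neq0 n; have : (q n)%:R != 0 :> rat by rewrite pnatr_eq0 -lt0n.
by move=> *; field; apply/andP.
Qed.

(** If N v comes from [a], and N divides M_n in [A] with quotient [c], then v = c a / M_n. *)
Lemma frac_gen v : exists n a, v = a *: frac n.
Proof.
have [N N0 [y yE]] := submodP v.
have [a aE] : exists a, forall t, (val v *+ N) t = ev (t ord0) a.
  have : Rsm 0 (val v *+ N) by exists y.
  pose T (z : fn 0) := exists a, forall t, z t = ev (t ord0) a.
  have T0 : T 0 by exists 0 => t; rewrite rmorph0.
  have TD z z' : T z -> T z' -> T (z + z').
    by move=> [a aE] [a' aE']; exists (a + a') => t; rewrite fnD aE aE' rmorphD.
  have TZ c z : T z -> T (c *: z).
    by move=> [a aE]; exists (c * a) => t; rewrite fnZ aE rmorphM.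
  apply: (Rsm_ind (S := Submodule T0 TD TZ)) => a; exists (a ord0) => t.
  by rewrite /tprod big_ord1.
have [n [c cE]] := cofinal N0; exists n, (c * a).
apply/val_inj; have -> : val ((c * a) *: frac n) = (c * a) *: val (frac n).
  exact: (linZZ (sm_incl (Rq 0))).
apply/funext => t; rewrite fnZ fracE rmorphM -aE fnMn.
have e : ev (t ord0) c * N%:R = (M n)%:R by rewrite mulr_natr -rmorphMn cE rmorph_nat.
by rewrite -(mulr_natr (val v t)) mulrCA e mulfK ?modulus_neq0.
Qed.

Lemma frac_free n a : a *: frac n = 0 -> a = 0.
Proof.
move=> e; apply: ev_inj => t.
have : (a *: val (frac n)) (fun=> t) = 0.
  have <- : val (a *: frac n) = a *: val (frac n) by exact: (linZZ (sm_incl (Rq 0))).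
  by rewrite e.
rewrite fnZ fracE => /eqP; rewrite mulf_eq0 => /orP[/eqP //|].
by rewrite invr_eq0 (negPf (modulus_neq0 n)).
Qed.

Theorem HGamma_telescope (V : lmodType A) (P : projective_resolution (t_mod k))
    (Q : projective_replacement (coend_complex P (loday A))) n :
  (forall y : nat -> V, (forall n, y n = y n.+1 *+ q n) -> forall n, y n = 0) ->
  zmod_iso (HGamma V Q n) (if n == 1%N then (quot_mod (tel_im q V) : zmodType) else zero_group).
Proof.
have c := concentrated_loday (concentrated_linear_part P).
have [Qx [rho rs rk]] := replacement_augmentation Q c.
exact: (ext_telescope frac_q frac_gen frac_free (@pr_proj _ _ Q) Qx rs rk).
Qed.
End Cohomology.
End Numeric.

(** * Digits *)

Lemma inZp_int m (b : int) : ((inZp 1 : 'I_m.+1) *~ b == 0) = ((m.+1)%:Z %| b)%Z.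
Proof.
have nat_case n : ((inZp 1 : 'I_m.+1) *+ n == 0) = (m.+1 %| n)%N.
  by rewrite Zp_mulrn -val_eqE /= modnMml mul1n.
case: b => n; first by rewrite -pmulrn nat_case dvdzE.
by rewrite NegzE mulrNz oppr_eq0 -pmulrn nat_case dvdzE.
Qed.

Lemma res_scaleE (N : nat -> nat) (a : int) (x : residues N) i : (a *: x) i = x i *~ a.
Proof.
have nat_case n : (x *+ n) i = x i *+ n.
  by elim: n => [|n IH]; rewrite ?mulr0n // !mulrS -IH.
case: a => n; first exact: nat_case.
by rewrite NegzE mulrNz -pmulrn -nat_case.
Qed.

Section InverseLimit.
(** The limit runs over all moduli [(N i).+1]. Among them [idx n] locates M_n, and [lvl_ex] says
    that the M_n are cofinal for divisibility. *)
Variables (N q idx : nat -> nat).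
Hypothesis q_gt0 : forall n, (0 < q n)%N.
Local Notation M := (modulus q).
Local Notation M_gt0 := (modulus_gt0 q_gt0).
Hypothesis idxE : forall n, (N (idx n)).+1 = M n.
Hypothesis lvl_ex : forall i, exists n, ((N i).+1 %| M n)%N.

Lemma modulus_dvd n m : (n <= m)%N -> (M n %| M m)%N.
Proof.
move=> /subnK <-; elim: (m - n)%N => [|j IH]; first exact: dvdnn.
by rewrite addSn modulusS dvdn_mulr.
Qed.

Definition rsd (x : limZ N) n : nat := val x (idx n).

Lemma rsd_lt x n : (rsd x n < M n)%N.
Proof. by rewrite -idxE ltn_ord. Qed.

Lemma rsd0 x : rsd x 0 = 0%N.
Proof. by have := rsd_lt x 0; rewrite /modulus big_ord0 ltnS leqn0 => /eqP. Qed.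

Lemma rsd_compat x n m : (n <= m)%N -> rsd x m = rsd x n %[mod M n].
Proof. by move=> nm; rewrite -idxE; apply: (submodP x); rewrite !idxE modulus_dvd. Qed.

Lemma rsd_comp (x : limZ N) i n : ((N i).+1 %| M n)%N -> val x i = (rsd x n %% (N i).+1)%N :> nat.
Proof.
move=> iM; have -> : (rsd x n %% (N i).+1)%N = (val x i %% (N i).+1)%N.
  by apply: (submodP x); rewrite idxE.
by rewrite modn_small.
Qed.

Lemma rsdD x y n : rsd (x + y) n = ((rsd x n + rsd y n) %% M n)%N.
Proof.
rewrite -idxE /rsd; have -> : val (x + y) = val x + val y.
  exact: (linDD (sm_incl (compat N))).
by [].
Qed.

(** The n-th digit of [x] in the mixed radix [q], the place values being the M_n. *)
Definition dig x n : nat := (rsd x n.+1 %/ M n)%N.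
Lemma digE x n : rsd x n.+1 = (dig x n * M n + rsd x n)%N.
Proof.
by rewrite {1}(divn_eq (rsd x n.+1) (M n)) (rsd_compat x (leqnSn n)) (modn_small (rsd_lt x n)).
Qed.

(** By cofinality the congruences modulo the M_n imply those at all other levels. *)
Lemma limZ_eq (s : nat) (a : int) (x : limZ N) :
  s%:Z *: x = a *: limZ1 N <-> forall n, ((M n)%:Z %| s%:Z * (rsd x n)%:Z - a)%Z.
Proof.
have valE i : val (s%:Z *: x - a *: limZ1 N) i =
    (inZp 1 : 'I_(N i).+1) *~ (s%:Z * (val x i)%:Z - a).
  have -> : val (s%:Z *: x - a *: limZ1 N) = s%:Z *: val x - a *: val (limZ1 N).
    by rewrite -[LHS]/(sm_incl (compat N) _) linBB !linZZ.
  transitivity ((s%:Z *: val x) i - (a *: val (limZ1 N)) i) => //.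
  rewrite !res_scaleE mulrzBr [s%:Z * _]mulrC mulrzA; congr (_ *~ _ - _).
  rewrite -pmulrn Zp_mulrn; apply/val_inj.
  by rewrite /= modnMml mul1n modn_small.
have eqE : s%:Z *: x = a *: limZ1 N <->
    forall i, ((N i).+1%:Z %| s%:Z * (val x i)%:Z - a)%Z.
  split=> [e i|e]; first by rewrite -inZp_int -valE e subrr.
  apply/eqP; rewrite -subr_eq0; apply/eqP/val_inj/functional_extensionality_dep => i.
  by rewrite valE; apply/eqP; rewrite inZp_int.
rewrite eqE; split=> [h n|h i]; first by rewrite -idxE; apply: h.
have [n iM] := lvl_ex i; rewrite (rsd_comp x iM).
have : ((N i).+1%:Z %| s%:Z * (rsd x n)%:Z - a)%Z by apply: dvdz_trans (h n); rewrite dvdzE.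
set r := (rsd x n %% _)%N => h'.
have -> : s%:Z * r%:Z - a = s%:Z * (rsd x n)%:Z - a - s%:Z * (rsd x n %/ (N i).+1)%:Z * (N i).+1%:Z.
  by rewrite {1}(divn_eq (rsd x n) (N i).+1) -/r PoszD PoszM; ring.
by apply: rpredB => //; apply: dvdz_mull.
Qed.

Section Digits.
Variables (c : nat -> nat) (cq : forall n, (c n < q n)%N).
Definition digsum n : nat := \sum_(i < n) c i * M i.
Lemma digsumS n : digsum n.+1 = (c n * M n + digsum n)%N.
Proof. by rewrite /digsum big_ord_recr /= addnC. Qed.
Lemma digsum_lt n : (digsum n < M n)%N.
Proof.
elim: n => [|n IH]; first by rewrite /digsum big_ord0 M_gt0.
rewrite digsumS modulusS; apply: (@leq_trans (c n * M n + M n)%N); first by rewrite ltn_add2l.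
by rewrite -mulSnr mulnC leq_mul2l cq orbT.
Qed.
Lemma digsum_compat n m : (n <= m)%N -> digsum m = digsum n %[mod M n].
Proof.
move=> nm; rewrite -(subnK nm); elim: (m - n)%N => [//|j IH].
rewrite addSn digsumS -modnDml; have /eqP -> : (M n %| c (j + n) * M (j + n))%N.
  by rewrite dvdn_mull // modulus_dvd // leq_addl.
by rewrite add0n.
Qed.
Lemma digsum_mod e n m : (e %| M n)%N -> (e %| M m)%N -> digsum m = digsum n %[mod e].
Proof.
wlog nm : n m / (n <= m)%N => [H en em|en _].
  by have [/H|/ltnW/H e'] := leqP n m; [apply|rewrite e'].
by rewrite -(modn_dvdm (digsum m) en) digsum_compat // modn_dvdm.
Qed.

Lemma digits_ex : exists x : limZ N, forall n, rsd x n = digsum n.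
Proof.
have [lvl lvlE] := choice lvl_ex.
pose x : residues N := fun i => inZp (digsum (lvl i)).
have xc : compat N x.
  move=> i j ji; rewrite [LHS](modn_dvdm _ ji) [RHS]modn_mod.
  by apply: digsum_mod => //; apply: dvdn_trans ji _.
exists (to_submod xc) => n; rewrite /rsd -[LHS]/(digsum (lvl (idx n)) %% (N (idx n)).+1)%N.
rewrite (digsum_mod (n := n)) ?idxE //; first by rewrite modn_small ?digsum_lt.
by rewrite -[X in (X %| _)%N]idxE.
Qed.
End Digits.

Variables (A : comNzRingType) (V : lmodType A) (o : V).
Hypothesis V_tf : forall n (y : V), (0 < n)%N -> y *+ n = 0 -> y = 0.
Hypothesis V_digit : forall n (v : V), exists d y, (d < q n)%N /\ v = o *+ d + y *+ q n.
Local Notation T := (tel_im q V).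

Definition dig_class (x : limZ N) : quot_mod T := to_quot T (fun n => o *+ dig x n).

(* The carries in the addition of digits are coboundaries. *)
Lemma dig_classD x y : dig_class (x + y) = dig_class x + dig_class y.
Proof.
pose eps n := ((rsd x n + rsd y n) %/ M n)%N.
have e n : (dig (x + y) n + eps n.+1 * q n = dig x n + dig y n + eps n)%N.
  have e1 j : (rsd x j + rsd y j = eps j * M j + rsd (x + y) j)%N.
    by rewrite rsdD -divn_eq.
  apply/eqP; rewrite -(eqn_pmul2r (M_gt0 n)) -(eqn_add2r (rsd (x + y) n)); apply/eqP.
  have := e1 n.+1; have := e1 n; rewrite !digE modulusS; nia.
apply/eqP; rewrite -subr_eq0 /dig_class -[X in _ - X]raddfD -to_quotB; apply/eqP.
apply/to_quot_eq0; exists (fun n => - (o *+ eps n)); apply/funext => n.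
rewrite -[RHS]/(- (o *+ eps n.+1) *+ q n - - (o *+ eps n)) !fctE.
have -> : o *+ dig (x + y) n =
    o *+ dig x n + o *+ dig y n + o *+ eps n - o *+ eps n.+1 *+ q n.
  by rewrite -mulrnA -!mulrnDr -e mulrnDr addrK.
by rewrite opprK mulNrn addrC -(addrA (o *+ dig x n + o *+ dig y n)) addKr addrC.
Qed.

Lemma dig_classB : zmod_morphism dig_class.
Proof. by move=> x y; apply: (addIr (dig_class y)); rewrite -dig_classD !subrK. Qed.

(** Division with carry: c_n plus the carry y_n is divided by q_n, the remainder is the n-th digit
    and the quotient the next carry. The carries are the coboundary between the sequence and its
    digits. *)
Lemma dig_class_surj : surj_fun dig_class.
Proof.
move=> v; have [c ->] := to_quot_surj v.
have /choice[f fP] : forall z : nat * V, exists r : nat * V,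
    (r.1 < q z.1)%N /\ z.2 = o *+ r.1 + r.2 *+ q z.1.
  by move=> [n u]; have [d [y dy]] := V_digit n u; exists (d, y).
pose fix y n : V := if n is j.+1 then (f (j, c j + y j)).2 else 0.
pose d n := (f (n, c n + y n)).1.
have dE n : c n + y n = o *+ d n + y n.+1 *+ q n := (fP (n, c n + y n)).2.
have [x xE] := digits_ex (c := d) (fun n => (fP (n, c n + y n)).1).
exists x; apply/to_quotP; exists (fun n => - y n); apply/funext => n.
rewrite -[RHS]/(- y n.+1 *+ q n - - y n) !fctE.
have -> : dig x n = d n.
  by apply/eqP; rewrite -(eqn_pmul2r (M_gt0 n)) -(eqn_add2r (rsd x n)) -digE !xE digsumS.
have -> : c n = o *+ d n + y n.+1 *+ q n - y n by rewrite -dE addrK.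
by rewrite mulNrn !opprD opprK !addrA subrr add0r.
Qed.

(** If the digits are the coboundary of y, summing them with weights M_k telescopes: the residue of
    x modulo M_n is M_n y_n - y_0, so x is the element z = -y_0. Conversely the quotients y_n form
    the required sequence, since M_n can be cancelled. *)
Lemma dig_class_eq0 x : dig_class x = 0 <->
  exists z, forall n, exists y, o *+ rsd x n - z = y *+ M n.
Proof.
rewrite to_quot_eq0; split=> [[y yE]|[z /choice[y yE]]].
  have e n : o *+ dig x n = y n.+1 *+ q n - y n by have /(congr1 (fun f => f n)) := yE.
  exists (- y 0%N) => n; exists (y n); rewrite opprK.
  elim: n => [|n IH]; first by rewrite rsd0 add0r /modulus big_ord0.
  rewrite digE mulrnDr -addrA IH mulrnA e mulrnBl modulusS mulnC mulrnA subrK.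
  by [].
exists y; apply/funext => n; apply/eqP; rewrite -subr_eq0; apply/eqP.
apply: (V_tf (M_gt0 n)); rewrite -[mklin _ _ _]/(y n.+1 *+ q n - y n).
rewrite !mulrnBl -!mulrnA [(q n * _)%N]mulnC -modulusS -!yE.
rewrite digE mulrnDr; apply/eqP; rewrite subr_eq0 opprB addrA subrK addrK.
by [].
Qed.

Theorem lim_quot_iso (S : submodule (limZ N)) :
  (forall x, S x <-> exists z, forall n, exists y, o *+ rsd x n - z = y *+ M n) ->
  zmod_iso (quot_mod T) (quot_mod S).
Proof.
move=> SE; apply/zmod_iso_sym/quot_zmod_iso; first exact: dig_classB.
  exact: dig_class_surj.
by move=> x; rewrite dig_class_eq0 SE.
Qed.

End InverseLimit.

(** * The rings of numerical polynomials *)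

(** The relation gives y_0 = M_n y_n for all n; so y_0 = 0, and then y_n = 0 as there is no
    torsion. *)
Lemma modulus_separated (q : nat -> nat) (V : zmodType) :
  (forall n, (0 < q n)%N) -> (forall n (y : V), (0 < n)%N -> y *+ n = 0 -> y = 0) ->
  (forall v : V, (forall n, exists y, v = y *+ modulus q n) -> v = 0) ->
  forall y : nat -> V, (forall n, y n = y n.+1 *+ q n) -> forall n, y n = 0.
Proof.
move=> q0 tf sep y yE; have e n : y n *+ modulus q n = y 0%N.
  elim: n => [|n <-]; first by rewrite /modulus big_ord0.
  by rewrite (yE n) modulusS mulnC mulrnA.
move=> n; apply: (tf _ _ (modulus_gt0 q0 n)); rewrite e.
by apply: sep => m; exists (y m); rewrite e.
Qed.

Lemma dvdz_unbounded (M : nat -> nat) (v : int) : (forall n, (n <= M n)%N) ->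
  (forall n, ((M n)%:Z %| v)%Z) -> v = 0.
Proof.
move=> Mn /(_ `|v|%N.+1); rewrite dvdzE => dv; apply/eqP; rewrite -absz_eq0 -leqn0 leqNgt.
by apply/negP => v0; have := leq_trans (Mn _) (dvdn_leq v0 dv); rewrite ltnn.
Qed.

(* [w] is the coordinate function; the last clause says that the elements of R are
   polynomials in w up to inverses in R of powers of w. *)
Definition evaluable (R : comNzRingType) : Prop :=
  exists (ev : point -> {rmorphism R -> rat}) (w : R),
    [/\ forall a, (forall n, ev n a = 0) -> a = 0,
        forall (p : nat) (a : R), prime p -> exists b, a ^+ p - a = b *+ p,
        forall n, ev n w = val n &
        forall a, exists (j : nat) (v : R) (f : {poly rat}),
          v * w ^+ j = 1 /\ forall n, val n ^+ j * ev n a = f.[val n]].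

Lemma modulus_fact n : modulus S n = n`!.
Proof. by elim: n => [|n IH]; rewrite ?modulusS ?IH ?factS 1?mulnC // /modulus big_ord0. Qed.

(** With q_n = n + 1 the place values are M_n = n!, which every positive integer divides eventually.
    The level of modulus n! has index n! - 1. *)
Theorem HGamma_int (A : comAlgType int) (aug : {rmorphism A -> int})
    (P : projective_resolution (t_mod int))
    (Q : projective_replacement (coend_complex P (loday A))) n :
  evaluable A ->
  zmod_iso (HGamma (aug_module aug) Q n) (if n == 1%N then Zhat_mod_Z else zero_group).
Proof.
move=> [ev [w [ev_inj frob ew den]]]; have ev_scal (c : int) t t' : ev t c%:A = ev t' c%:A.
  suff e s : ev s c%:A = c%:~R by rewrite !e.
  by rewrite -{1}[c]intz scaler_int rmorph_int.
have tf m (y : int) : (0 < m)%N -> y *+ m = 0 -> y = 0.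
  by move=> m0 /eqP; rewrite mulrn_eq0 eqn0Ngt m0 => /eqP.
have cof N : (0 < N)%N -> exists n (c : A), c *+ N = (modulus S n)%:R.
  move=> N0; have /dvdnP[c cE] : (N %| N`!)%N by rewrite dvdn_fact // N0 leqnn.
  by exists N, c%:R; rewrite modulus_fact cE natrM mulr_natr.
have sep : forall y : nat -> aug_module aug, (forall n, y n = y n.+1 *+ n.+1) -> forall n, y n = 0.
  apply: modulus_separated => // v vM; apply: (@dvdz_unbounded (modulus S)) => m.
    by rewrite modulus_fact fact_geq.
  by have [y ->] := vM m; rewrite -[y *+ _]mulr_natr natz dvdz_mull.
have digit m (v : int) : exists (d : nat) y, (d < m.+1)%N /\ v = 1 *+ d + y *+ m.+1.
  exists `|(v %% m.+1)%Z|%N, (v %/ m.+1)%Z; split.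
    by rewrite -ltz_nat gez0_abs ?modz_ge0 // ltz_pmod.
  by rewrite {1}(divz_eq v m.+1) addrC natz -[_ *+ m.+1]mulr_natr natz gez0_abs ?modz_ge0.
have idxE m : (modulus S m).-1.+1 = modulus S m by rewrite prednK // modulus_fact fact_gt0.
have lvl_ex i : exists m, (i.+1 %| modulus S m)%N.
  by exists i.+1; rewrite modulus_fact dvdn_fact // leqnn.
have h := HGamma_telescope (q := S) ev_inj ev_scal frob ew den ltn0Sn cof Q n sep.
apply: zmod_iso_trans h _.
case: ifP => _; last by exists idfun; exists idfun.
apply: (@lim_quot_iso _ S (fun m => (modulus S m).-1) _ idxE lvl_ex A (aug_module aug) (1 : int)) => //.
move=> x; have eqx z := limZ_eq (N := id) idxE lvl_ex 1 z x.
split=> [[z xz]|[z zP]]; exists z.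
  move=> m; have /eqx /(_ m) : 1%N%:Z *: x = z *: limZ1 _ by rewrite scale1r.
  by rewrite mul1r => /dvdzP[y yE]; exists y; rewrite -[y *+ _]mulr_natr natz -yE natz.
rewrite -[x]scale1r; apply/eqx => m.
have [y yE] := zP m; rewrite mul1r -[X in X - _]natz [_%:R - z]yE -[y *+ _]mulr_natr natz.
by rewrite dvdz_mull.
Qed.

(** * The integers localized at a prime *)

Section SubringVal.
Variables (E : comNzRingType) (S : subring E) (x : subring_type S).
Lemma subring_valX j : val (x ^+ j) = val x ^+ j.
Proof. by elim: j => [|j IH]; rewrite ?expr0 // !exprS -IH. Qed.
Lemma subring_valMn j : val (x *+ j) = val x *+ j.
Proof. by elim: j => [|j IH]; rewrite ?mulr0n // !mulrS -IH. Qed.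
End SubringVal.

Section LocalIntegers.
Variables (p : nat) (p_prime : prime p).
Implicit Types (x y : Zloc p).

Fact Zloc_frac_subproof (a : int) s : (0 < s)%N -> coprime p s ->
  localize p int_sub (a%:~R / s%:R).
Proof.
move=> s0 ps; exists s; split=> //; rewrite mulrC divfK ?pnatr_eq0 -?lt0n //.
exact: rpred_int.
Qed.
Definition Zloc_frac (a : int) s (s0 : (0 < s)%N) (ps : coprime p s) : Zloc p :=
  to_subring (Zloc_frac_subproof a s0 ps).

Lemma Zloc_ex x : exists (a : int) s, [/\ (0 < s)%N, coprime p s & s%:R * val x = a%:~R].
Proof. by have [s [s0 ps /intrP[a aE]]] := subringP x; exists a, s. Qed.

Lemma Zloc_dvd x (a : int) n : val x * (p ^ n)%:R = a%:~R -> ((p ^ n)%N%:Z %| a)%Z.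
Proof.
move=> xa; have [b [s [s0 ps sx]]] := Zloc_ex x.
have e : s%:Z * a = b * (p ^ n)%N%:Z.
  by apply: (@intr_inj rat); rewrite !intrM -xa -sx -!pmulrn mulrA.
have : ((p ^ n)%N%:Z %| s%:Z * a)%Z by rewrite e dvdz_mull.
by rewrite Gauss_dvdzr // coprimezE /= coprimeXl.
Qed.

Lemma Zloc_torsion_free n y : (0 < n)%N -> y *+ n = 0 -> y = 0.
Proof.
move=> n0 /(congr1 val); rewrite subring_valMn => /eqP.
by rewrite mulrn_eq0 eqn0Ngt n0 => /eqP y0; apply/val_inj.
Qed.

Lemma modulus_exp n : modulus (fun=> p) n = (p ^ n)%N.
Proof. by rewrite /modulus prod_nat_const card_ord. Qed.

Lemma Zloc_separated x : (forall n, exists y, x = y *+ modulus (fun=> p) n) -> x = 0.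
Proof.
move=> xy; have [a [s [s0 ps sx]]] := Zloc_ex x.
have a0 : a = 0.
  apply: (@dvdz_unbounded (expn p)) => n; first exact/ltnW/ltn_expl/prime_gt1.
  have [y yE] := xy n; apply: (@Zloc_dvd (y *+ s)).
  by rewrite -sx yE !subring_valMn modulus_exp mulr_natr mulr_natl mulrnAC.
have /eqP := sx; rewrite a0 mulf_eq0 pnatr_eq0 eqn0Ngt s0 => /eqP x0.
exact/val_inj.
Qed.

Lemma Zloc_digit x : exists d y, (d < p)%N /\ x = 1 *+ d + y *+ p.
Proof.
have [a [s [s0 ps sx]]] := Zloc_ex x.
have p0 := prime_gt0 p_prime; have pz : p%:Z != 0 by rewrite -lt0n.
have cps : coprimez p s by rewrite coprimezE.
(* The Chinese remainder is a multiple of s congruent to a modulo p, so [f] represents a / s modulo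
   p. *)
pose f := (zchinese p s a 0 %/ s)%Z; pose d := `|(f %% p)%Z|%N.
have dE : d%:Z = (f %% p)%Z by rewrite gez0_abs ?modz_ge0.
have /dvdzP[g gE] : (p%:Z %| a - s%:Z * d%:Z)%Z.
  rewrite -eqz_mod_dvd dE modzMmr; apply/eqP.
  have /eqP := zchinese_modr cps a 0; rewrite mod0z => /eqP/dvdz_mod0P sf.
  by rewrite /f mulrC divzK // zchinese_modl.
exists d, (Zloc_frac g s0 ps); split; first by rewrite -ltz_nat dE ltz_pmod.
apply/val_inj; rewrite -[RHS]/(val (1 *+ d) + val (Zloc_frac g s0 ps *+ p)) !subring_valMn.
have s0' : s%:R != 0 :> rat by rewrite pnatr_eq0 -lt0n.
apply: (mulfI s0'); rewrite sx mulrDr mulrnAr mulr1 -[_ *+ p]mulr_natr /=.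
rewrite mulrA mulrCA mulfV // mulr1.
have -> : a = s%:Z * d%:Z + g * p by rewrite -gE addrC subrK.
by rewrite intrD !intrM -!pmulrn mulr_natr.
Qed.

Lemma Zloc_in_ZpP (x : Zp p) :
  (forall i, (p ^ i).-1.+1 = modulus (fun=> p) i) ->
  Zloc_in_Zp p x <-> exists z : Zloc p, forall n, exists y : Zloc p,
    1 *+ rsd id x n - z = y *+ modulus (fun=> p) n.
Proof.
move=> idxE; have lvl_ex i : exists n, ((p ^ i).-1.+1 %| modulus (fun=> p) n)%N.
  by exists i; rewrite idxE.
have eqx s z := limZ_eq (N := fun i => (p ^ i).-1) (idx := id) idxE lvl_ex s z x.
split=> [[s [a [s0 ps /eqx sx]]]|[z zP]].
  exists (Zloc_frac a s0 ps) => n; have /dvdzP[g gE] := sx n.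
  exists (Zloc_frac g s0 ps); apply/val_inj.
  rewrite -[LHS]/(val (1 *+ rsd id x n) - a%:~R / s%:R) !subring_valMn /=.
  have s0' : s%:R != 0 :> rat by rewrite pnatr_eq0 -lt0n.
  have /(congr1 (fun v : int => v%:~R : rat)) := gE.
  rewrite intrB !intrM -!pmulrn => e.
  apply: (mulfI s0'); rewrite mulrBr mulrnAr mulr1 -[_ *+ modulus _ _]mulr_natr.
  have sK (v : rat) : s%:R * (v / s%:R) = v by rewrite mulrCA mulfV // mulr1.
  by rewrite [X in _ = X]mulrA !sK -e mulr_natr.
have [a [s [s0 ps sz]]] := Zloc_ex z; exists s, a; split=> //; apply/eqx => n.
rewrite modulus_exp; have [y yE] := zP n; apply: (@Zloc_dvd (y *+ s)).
have /(congr1 val) := yE; rewrite -[LHS]/(val (1 *+ rsd id x n) - val z) !subring_valMn modulus_exp /= => e.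
rewrite intrB intrM -!pmulrn -sz -mulrBr e.
by rewrite mulr_natr mulr_natl mulrnAC.
Qed.
End LocalIntegers.

Theorem HGamma_local (p : nat) (A : comAlgType (Zloc p)) (aug : {rmorphism A -> Zloc p})
    (P : projective_resolution (t_mod (Zloc p)))
    (Q : projective_replacement (coend_complex P (loday A))) n :
  prime p -> evaluable A ->
  zmod_iso (HGamma (aug_module aug) Q n) (if n == 1%N then Zp_mod_Zloc p else zero_group).
Proof.
move=> p_prime [ev [w [ev_inj frob ew den]]]; have p0 (m : nat) : (0 < p)%N := prime_gt0 p_prime.
(* A scalar is a fraction a / s, and a ring morphism to the rationals must send it to that
   fraction. *)
have ev_scal (c : Zloc p) t t' : ev t c%:A = ev t' c%:A.
  have [a [s [s0 ps sc]]] := Zloc_ex c.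
  have s0' : s%:R != 0 :> rat by rewrite pnatr_eq0 -lt0n.
  suff e u : s%:R * ev u c%:A = a%:~R by apply: (mulfI s0'); rewrite !e.
  have ca : c *+ s = a%:~R.
    apply/val_inj; rewrite subring_valMn -mulr_natl sc.
    by rewrite -[RHS]/((val : {rmorphism Zloc p -> rat}) _) rmorph_int.
  by rewrite mulr_natl -rmorphMn scalerMnl ca scaler_int rmorph_int.
(* N is a power of p times a factor [s] prime to p, and [s] is invertible in [Zloc p]. *)
have cof N : (0 < N)%N -> exists n (c : A), c *+ N = (modulus (fun=> p) n)%:R.
  move=> N0; have [s ps sE] := pfactor_coprime p_prime N0.
  have s0 : (0 < s)%N by move: N0; rewrite sE muln_gt0 => /andP[].
  exists (logn p N), (Zloc_frac 1 s0 ps)%:A; rewrite modulus_exp {1}sE mulrnA.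
  have s0' : s%:R != 0 :> rat by rewrite pnatr_eq0 -lt0n.
  have -> : (Zloc_frac 1 s0 ps)%:A *+ s = 1 :> A; last by [].
  rewrite scalerMnl -[RHS]scale1r; congr (_ *: _); apply/val_inj.
  by rewrite subring_valMn -[val _]/(1 / s%:R) mul1r -(mulr_natr (s%:R^-1)) mulVf.
have sep := modulus_separated p0 (@Zloc_torsion_free p) (@Zloc_separated p p_prime).
have idxE m : (p ^ m).-1.+1 = modulus (fun=> p) m by rewrite modulus_exp prednK // expn_gt0 p0.
have lvl_ex i : exists m, ((p ^ i).-1.+1 %| modulus (fun=> p) m)%N by exists i; rewrite idxE.
have h := HGamma_telescope (q := fun=> p) (V := aug_module aug) ev_inj ev_scal frob ew den p0 cof Q n sep.
apply: zmod_iso_trans h _.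
case: ifP => _; last by exists idfun; exists idfun.
apply: (@lim_quot_iso (fun i => (p ^ i).-1) (fun=> p) id _ idxE lvl_ex A (aug_module aug) (1 : Zloc p)) => //.
- exact: Zloc_torsion_free.
- by move=> _ v; apply: Zloc_digit.
- by move=> x; apply: Zloc_in_ZpP.
Qed.

(** * Fermat congruences in the rings of functions *)

Lemma dvdz_fermat (p : nat) (v : int) : prime p -> (p%:Z %| v ^+ p - v)%Z.
Proof.
move=> p_prime; rewrite -eqz_mod_dvd -modzXm -(modz_mod v) modzXm.
have : (0 <= v %% p)%Z by rewrite modz_ge0 // -lt0n prime_gt0.
case: (v %% p)%Z => // r _; rewrite -[Posz r ^+ p]/((r%:Z) ^+ p).
have -> : r%:Z ^+ p = (r ^ p)%N%:Z by rewrite -!natz natrX.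
by rewrite !modz_nat fermat_little.
Qed.

Section Frobenius.
Variables (E : comNzRingType) (iota : {rmorphism rat -> E}).

Definition frob_closed (S : subring E) : Prop :=
  forall (l : nat) x, prime l -> S x -> S (iota l%:R^-1 * (x ^+ l - x)).

Lemma iota_natK l y : prime l -> l%:R * (iota l%:R^-1 * y) = y.
Proof.
move=> l_prime; rewrite mulrA -(rmorph_nat iota) -rmorphM mulfV ?rmorph1 ?mul1r //.
by rewrite pnatr_eq0 -lt0n prime_gt0.
Qed.

Lemma iota_natVK l y : prime l -> iota l%:R^-1 * (l%:R * y) = y.
Proof. by move=> l_prime; rewrite mulrCA iota_natK. Qed.

Variables (S : subring E) (S_frob : frob_closed S).

(** With y = s x and e = (s^l - s) / l, an integer by Fermat, s^(l+1) (x^l - x) / l = s (y^l - y) /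
    l - e y. This serves both for localization at p and for values in Z[1/n]. *)
Lemma frob_shift (s : int) l x : prime l -> S (s%:~R * x) ->
  S (s%:~R ^+ l.+1 * (iota l%:R^-1 * (x ^+ l - x))).
Proof.
move=> l_prime Sy; have /dvdzP[e eE] := dvdz_fermat s l_prime.
set y := s%:~R * x in Sy.
have -> : s%:~R ^+ l.+1 * (iota l%:R^-1 * (x ^+ l - x)) =
    s%:~R * (iota l%:R^-1 * (y ^+ l - y)) - e%:~R * y.
  rewrite mulrCA [in RHS]mulrCA -[e%:~R * y](iota_natVK _ l_prime) -mulrBr; congr (_ * _).
  have -> : l%:R * (e%:~R * y) = (s%:~R ^+ l - s%:~R) * y.
    rewrite mulrA [_ * e%:~R]mulrC; congr (_ * _).
    by have /(congr1 (fun v : int => v%:~R : E)) := eE; rewrite intrB rmorphXn intrM -pmulrn.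
  by rewrite exprS /y exprMn; ring.
by apply: srB; apply: srM => //; [apply: sr_int|apply: S_frob|apply: sr_int].
Qed.

Lemma frob_localize p : prime p -> frob_closed (localize p S).
Proof.
move=> p_prime l x l_prime [s [s0 ps Sx]].
exists (s ^ l.+1)%N; split; [by rewrite expn_gt0 s0|by rewrite coprimeXr|].
by rewrite natrX; apply: (@frob_shift s).
Qed.

Lemma frob_sub l (a : subring_type S) : prime l -> exists b, a ^+ l - a = b *+ l.
Proof.
move=> l_prime; have Sa := S_frob l_prime (subringP a).
exists (to_subring Sa); apply/val_inj.
rewrite subring_valMn -[LHS]/(val (a ^+ l) - val a) subring_valX.
apply: etrans (esym (iota_natK _ l_prime)) _; exact: mulr_natl.
Qed.
End Frobenius.

Lemma frob_int : frob_closed idfun int_sub.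
Proof.
move=> l x l_prime /intrP[v ->]; have /dvdzP[e eE] := dvdz_fermat v l_prime.
have -> : v%:~R ^+ l - v%:~R = l%:R * e%:~R :> rat.
  by have /(congr1 (fun v : int => v%:~R : rat)) := eE; rewrite intrB rmorphXn intrM -pmulrn mulrC.
by rewrite iota_natVK //; apply: rpred_int.
Qed.

(** * Evaluation of the four rings at points *)

Section SubEval.
Variables (E : comNzRingType) (S : subring E) (f : E -> rat) (f_morph : morph_on S f).
Definition sub_eval (x : subring_type S) : rat := f (val x).
Fact sub_eval_zmod : zmod_morphism sub_eval.
Proof. by move=> x y; case: f_morph => _ fB _; apply: fB; apply: subringP. Qed.
Fact sub_eval_monoid : monoid_morphism sub_eval.
Proof. by case: f_morph => f1 _ fM; split=> [|x y] //; apply: fM; apply: subringP. Qed.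
Definition sub_ev : {rmorphism subring_type S -> rat} :=
  HB.pack_for {rmorphism subring_type S -> rat} sub_eval
    (GRing.isZmodMorphism.Build _ _ sub_eval sub_eval_zmod)
    (GRing.isMonoidMorphism.Build _ _ sub_eval sub_eval_monoid).
End SubEval.

Lemma poly_point_inj (f : {poly rat}) : (forall t : point, f.[val t] = 0) -> f = 0.
Proof.
move=> f0; pose rs := [seq i.+1%:R | i <- iota 0 (size f)] : seq rat.
apply: (@roots_geq_poly_eq0 _ f rs); last by rewrite size_map size_iota.
  apply/allP => _ /mapP[i _ ->]; apply/rootP.
  exact: (f0 (exist (fun q : rat => 0 < q) i.+1%:R (ltr0Sn rat i))).
by rewrite map_inj_uniq ?iota_uniq // => i j /eqP; rewrite eqr_nat => /eqP[].
Qed.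

Lemma poly_evaluable (S : subring {poly rat}) : frob_closed poly_const S -> S 'X ->
  evaluable (subring_type S).
Proof.
move=> Sf SX; pose f (t : point) (g : {poly rat}) := g.[val t].
have fm t : morph_on S (f t).
  by split=> [|g h _ _|g h _ _]; rewrite /f ?hornerC // ?hornerM // hornerD hornerN.
exists (fun t => sub_ev (fm t)), (to_subring SX); split.
- by move=> a a0; apply/val_inj/poly_point_inj.
- exact: frob_sub Sf.
- by move=> t; apply: hornerX.
- by move=> a; exists 0%N, 1, (val a); split=> [|t]; rewrite expr0 ?mulr1 ?mul1r.
Qed.

Lemma ratfun_evaluable (S : subring {fraction {poly rat}}) :
  (forall f, S f -> laurent f) -> frob_closed ratfun_const S ->
  S (FracField.tofrac 'X) -> (forall m, S (FracField.tofrac 'X^m)^-1) ->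
  evaluable (subring_type S).
Proof.
move=> Sl Sf SX SV; pose f (t : point) g := feval g (val t).
have t0 (t : point) : val t != 0 by rewrite gt_eqF // (valP t).
have fm t : morph_on S (f t).
  split=> [|g h /Sl lg /Sl lh|g h /Sl lg /Sl lh]; rewrite /f.
  - by rewrite feval1.
  - by rewrite fevalB.
  - by rewrite fevalM.
have fE (P : {poly rat}) m t :
    f t (FracField.tofrac P / FracField.tofrac 'X^m) = P.[val t] / val t ^+ m.
  by apply: feval_value; exists P, 'X^m; rewrite hornerXn expf_neq0.
exists (fun t => sub_ev (fm t)), (to_subring SX); split.
- move=> a a0; have [P [m aE]] := Sl _ (subringP a).
  apply/val_inj; rewrite [LHS]aE; suff -> : P = 0 by rewrite rmorph0 mul0r.
  apply: poly_point_inj => t; have : f t (val a) = 0 by exact: a0.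
  rewrite aE fE => /eqP; rewrite mulf_eq0 invr_eq0 expf_eq0 (negPf (t0 t)) andbF orbF.
  by move/eqP.
- exact: frob_sub Sf.
- move=> t; rewrite -[RHS]divr1 -[1](expr0 (val t)) -[X in X / _](hornerX) -fE.
  by rewrite expr0 rmorph1 divr1.
- move=> a; have [P [m aE]] := Sl _ (subringP a).
  exists m, (to_subring (SV m)), P; split=> [|t].
    apply/val_inj; rewrite -[LHS]/((FracField.tofrac 'X^m)^-1 * val (to_subring SX ^+ m)).
    by rewrite subring_valX /= -rmorphXn mulVf // Xn_neq0.
  rewrite -[sub_ev _ _]/(f t (val a)) aE fE mulrC divfK // expf_neq0 //.
Qed.

Lemma frob_numerical : frob_closed poly_const numerical_sub.
Proof.
move=> l f l_prime Sf n.
rewrite hornerM hornerC hornerD hornerN horner_exp; exact: frob_int l_prime (Sf n).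
Qed.

Lemma laurent_poly (P : {poly rat}) : laurent (FracField.tofrac P).
Proof. by exists P, 0%N; rewrite expr0 tofrac1 divr1. Qed.

Lemma laurentX f j : laurent f -> laurent (f ^+ j).
Proof. by move=> lf; elim: j => [|j IH]; [apply: laurent1|rewrite exprS; apply: laurentM]. Qed.

Lemma fevalX f x j : x != 0 -> laurent f -> feval (f ^+ j) x = feval f x ^+ j.
Proof.
move=> x0 lf; elim: j => [|j IH]; first by rewrite !expr0 feval1.
by rewrite !exprS fevalM // ?IH //; apply: laurentX.
Qed.

Lemma feval_poly (P : {poly rat}) x : feval (FracField.tofrac P) x = P.[x].
Proof.
by apply: feval_value; exists P, 1; rewrite hornerC oner_eq0 tofrac1 !divr1.
Qed.

Lemma frob_stable : frob_closed ratfun_const stable_sub.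
Proof.
move=> l f l_prime [lf nf]; have ll : laurent (f ^+ l - f) by apply/laurentB/lf/laurentX.
split; first exact/laurentM/ll/laurent_poly.
(* The exponent is the one that [frob_shift] gives for s = n^j. *)
move=> n n0; have [j fj] := nf n n0; exists (j * l.+1)%N.
have nr0 : n%:~R != 0 :> rat by rewrite intr_eq0.
rewrite fevalM //; last exact: laurent_poly.
rewrite feval_poly hornerC fevalB ?fevalX //; last exact: laurentX.
rewrite exprM -rmorphXn; apply: (frob_shift frob_int) => //.
by rewrite rmorphXn.
Qed.

Lemma numericalX : numerical_sub 'X.
Proof. by move=> n; rewrite hornerX rpred_int. Qed.

Lemma stableX : stable_sub (FracField.tofrac 'X).
Proof.
split; first exact: laurent_poly.
by move=> n n0; exists 0%N; rewrite feval_poly hornerX mul1r rpred_int.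
Qed.

Lemma stableV m : stable_sub (FracField.tofrac 'X^m)^-1.
Proof.
have lV : laurent (FracField.tofrac 'X^m)^-1 by exists 1, m; rewrite tofrac1 mul1r.
split=> // n n0; exists m; have nr0 : n%:~R != 0 :> rat by rewrite intr_eq0.
have -> : feval (FracField.tofrac 'X^m)^-1 n%:~R = (n%:~R ^+ m)^-1.
  apply: feval_value; exists 1, 'X^m; rewrite hornerXn hornerC tofrac1 !mul1r expf_neq0 //.
by rewrite mulfV ?expf_neq0 // rpred1.
Qed.

Lemma sub_localize (E : comNzRingType) (S : subring E) p x : S x -> localize p S x.
Proof. by move=> Sx; exists 1%N; rewrite coprimen1 mul1r. Qed.

Theorem corollary5p2 :
  (forall (P : projective_resolution (t_mod int)) (n : nat),
     (forall Q : projective_replacement (coend_complex P (loday Ast)),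
        zmod_iso (HGamma (aug_module aug_st) Q n)
          (if n == 1%N then Zhat_mod_Z else zero_group)) /\
     (forall Q : projective_replacement (coend_complex P (loday Anum)),
        zmod_iso (HGamma (aug_module aug_num) Q n)
          (if n == 1%N then Zhat_mod_Z else zero_group))) /\
  (forall (p : nat), prime p ->
   forall (P : projective_resolution (t_mod (Zloc p))) (n : nat),
     (forall Q : projective_replacement (coend_complex P (loday (Ast_loc p))),
        zmod_iso (HGamma (aug_module (aug_st_loc p)) Q n)
          (if n == 1%N then Zp_mod_Zloc p else zero_group)) /\
     (forall Q : projective_replacement (coend_complex P (loday (Anum_loc p))),
        zmod_iso (HGamma (aug_module (aug_num_loc p)) Q n)
          (if n == 1%N then Zp_mod_Zloc p else zero_group))).
Proof.
split=> [P n|p p_prime P n]; split=> Q.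
- exact: (@HGamma_int Ast aug_st P Q n
    (ratfun_evaluable stable_laurent frob_stable stableX stableV)).
- exact: (@HGamma_int Anum aug_num P Q n (poly_evaluable frob_numerical numericalX)).
- exact: (@HGamma_local p (Ast_loc p) (aug_st_loc p) P Q n p_prime (ratfun_evaluable
    (@stable_loc_laurent p) (frob_localize frob_stable p_prime)
    (sub_localize p stableX) (fun m => sub_localize p (stableV m)))).
- exact: (@HGamma_local p (Anum_loc p) (aug_num_loc p) P Q n p_prime (poly_evaluable
    (frob_localize frob_numerical p_prime) (sub_localize p numericalX))).
Qed.
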